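(* Let $\ell>0$, let $\mu_0,\mu_\ell\in\mathbb R$ satisfy $\mu_0>\frac12>\mu_\ell$, and let $u_0\in H^1(0,\ell)$ be real valued. Let $u\in C([0,\infty);H^1(0,\ell))$ be the solution of $$\begin{cases} u_t-u_{txx}+u_x+uu_x=0, & 0<x<\ell,\ t\ge0,\\ u_{tx}(0,t)=\mu_0u(0,t)+\tfrac13u(0,t)^2, & t\ge0,\\ u_{tx}(\ell,t)=\mu_\ell u(\ell,t)+\tfrac13u(\ell,t)^2, & t\ge0,\\ u(x,0)=u_0(x), & 0<x<\ell. \end{cases}$$ Then, as $t\to\infty$, $$u(t)\rightharpoonup0\ \text{ weakly in }H^1(0,\ell),\qquad \|u(t)\|_{H^s(0,\ell)}\to0\quad\text{for every }s<1.$$ There is no size restriction on $u_0$.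
   Context: For every real $u_0\in H^1(0,\ell)$ (with $\mu_0>\frac12>\mu_\ell$) the system has a unique global solution $u\in C([0,\infty);H^1(0,\ell))$ (a known result of Rosier). It satisfies $u_t\in C([0,\infty);H^2(0,\ell))$, so the boundary values $u_{tx}(0,t)$, $u_{tx}(\ell,t)$ make sense; for each $t$ the equation holds almost everywhere in $(0,\ell)$ (as an identity in $L^2(0,\ell)$). *)

(* Defs.v *)
From HB Require Import structures.
From mathcomp Require Import all_boot all_order all_algebra.
From mathcomp Require Import all_classical all_reals all_analysis.

Set Implicit Arguments.
Unset Strict Implicit.
Unset Printing Implicit Defensive.

Import Order.TTheory GRing.Theory Num.Theory.
Import numFieldNormedType.Exports.

Local Open Scope classical_set_scope.
Local Open Scope ring_scope.

(* Elements of the spaces L^2, H^k, H^s over (0,l) are represented by functions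
   R -> R; only their values almost everywhere on (0,l) matter. *)

Definition L2 (R : realType) (l : R) (f : R -> R) : Prop :=
  measurable_fun `]0, l[ f /\
  (@lebesgue_measure R).-integrable `]0, l[ (fun x => (f x ^+ 2)%:E).

(* C_c^infty(0,l), extended by zero to R *)
Definition test_function (R : realType) (l : R) (phi : R -> R) : Prop :=
  (forall (n : nat) (x : R), derivable (derive1n n phi) x 1) /\
  (exists a b : R, [/\ 0 < a, b < l & forall x, ~ (a <= x <= b) -> phi x = 0]).

Definition is_wderiv (R : realType) (l : R) (f g : R -> R) : Prop :=
  forall phi, test_function l phi ->
    \int[@lebesgue_measure R]_(x in `]0, l[) (f x * derive1 phi x) =
    - \int[@lebesgue_measure R]_(x in `]0, l[) (g x * phi x).

(* A square-integrable weak derivative of f, unique almost everywhere on (0,l)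
   when it exists; the default value 0 is irrelevant for f in H^1. *)
Definition wderiv (R : realType) (l : R) (f : R -> R) : R -> R :=
  xget (cst 0) [set g | L2 l g /\ is_wderiv l f g].

Fixpoint Hk (R : realType) (l : R) (k : nat) (f : R -> R) : Prop :=
  match k with
  | 0%N => L2 l f
  | k'.+1 => L2 l f /\ exists g, is_wderiv l f g /\ Hk l k' g
  end.

Definition Hk_normsq (R : realType) (l : R) (k : nat) (f : R -> R) : \bar R :=
  (\sum_(j < k.+1)
    \int[@lebesgue_measure R]_(x in `]0%R, l[)
      ((iter j (wderiv l) f x) ^+ 2)%:E)%E.

Definition Hk_norm (R : realType) (l : R) (k : nat) (f : R -> R) : \bar R :=
  (Hk_normsq l k f `^ 2^-1)%E.

(* The integrand vanishes on the diagonal, by the convention 0^-1 = 0. *)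
Definition slobodeckij (R : realType) (l sigma : R) (f : R -> R) : \bar R :=
  (\int[@lebesgue_measure R]_(x in `]0%R, l[)
    \int[@lebesgue_measure R]_(y in `]0%R, l[)
      ((f x - f y) ^+ 2 / (`|x - y| `^ (1 + 2 * sigma)))%R%:E)%E.

(* Sobolev-Slobodeckij norm of order r >= 0, with r = m + sigma, m integer and
   0 <= sigma < 1; it is Hk_norm when r is an integer. *)
Definition Hr_norm (R : realType) (l r : R) (f : R -> R) : \bar R :=
  let m := Num.truncn r in
  let sigma := (r - m%:R)%R in
  ((Hk_normsq l m f +
    (if sigma == 0%R then 0 else slobodeckij l sigma (iter m (wderiv l) f)))
   `^ 2^-1)%E.

(* For s < 0, H^s(0,l) is the dual of the closure of C_c^infty(0,l) in
   H^{-s}(0,l), and f acts on test functions through the L^2 pairing. *)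
Definition Hs_norm (R : realType) (l s : R) (f : R -> R) : \bar R :=
  if 0 <= s then Hr_norm l s f
  else ereal_sup
    [set (`|\int[@lebesgue_measure R]_(x in `]0, l[) (f x * phi x)|)%:E
      | phi in [set phi | test_function l phi /\
                          (Hr_norm l (- s) phi <= 1)%E]].

(* The representative of f that is continuous on [0,l], which exists for f in
   H^1 and is then unique on [0,l]; boundary values are read off from it. *)
Definition cont_rep (R : realType) (l : R) (f : R -> R) : R -> R :=
  xget (cst 0)
    [set g | {within `[0, l], continuous g} /\
             {ae @lebesgue_measure R, forall x, x \in `]0, l[ -> g x = f x}].

(* u in C([0,oo); H^k(0,l)), with u t x standing for u(x,t) *)
Definition C_Hk (R : realType) (l : R) (k : nat) (u : R -> R -> R) : Prop :=
  (forall t : R, 0 <= t -> Hk l k (u t)) /\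
  (forall t : R, 0 <= t ->
    Hk_norm l k (fun x => u s x - u t x)
      @[s --> within [set s | 0 <= s] (nbhs t)] --> 0%E).

(* v = u_t on [0,oo): limit in H^1(0,l) of the difference quotients of the
   curve t |-> u t, one-sided at t = 0 *)
Definition is_time_deriv (R : realType) (l : R) (u v : R -> R -> R) : Prop :=
  forall t : R, 0 <= t ->
    Hk_norm l 1 (fun x => (u s x - u t x) / (s - t) - v t x)
      @[s --> within [set s | 0 <= s] (dnbhs t)] --> 0%E.

Definition bbm_solution (R : realType) (l mu0 mul : R) (u0 : R -> R)
    (u : R -> R -> R) : Prop :=
  C_Hk l 1 u /\
  exists ut : R -> R -> R,
    [/\ is_time_deriv l u ut,
        C_Hk l 2 ut,
        forall t : R, 0 <= t ->
          {ae @lebesgue_measure R, forall x, x \in `]0, l[ ->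
             ut t x - wderiv l (wderiv l (ut t)) x
             + wderiv l (u t) x + u t x * wderiv l (u t) x = 0},
        forall t : R, 0 <= t ->
          let b := cont_rep l (u t) in
          let utx := cont_rep l (wderiv l (ut t)) in
          utx 0 = mu0 * b 0 + 3^-1 * b 0 ^+ 2 /\
          utx l = mul * b l + 3^-1 * b l ^+ 2
      & {ae @lebesgue_measure R, forall x, x \in `]0, l[ -> u 0 x = u0 x}].

(* Bounded linear functionals on H^1(0,l); boundedness makes L compatible with
   equality almost everywhere on (0,l). *)
Definition H1_dual (R : realType) (l : R) (L : (R -> R) -> R) : Prop :=
  (forall (a : R) (f g : R -> R), Hk l 1 f -> Hk l 1 g ->
     L (fun x => a * f x + g x) = a * L f + L g) /\
  (exists C : R, forall f, Hk l 1 f ->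
     (`|L f|%:E <= C%:E * Hk_norm l 1 f)%E).

Definition H1_weak_cvg (R : realType) (l : R) (u : R -> R -> R) (w : R -> R) :
    Prop :=
  forall L, H1_dual l L -> L (u t) @[t --> +oo] --> L w.

(* Main.v *)
(* Let U be the continuous representative of u(t), F = U + U^2/2 and
   Z = u_tx - F, so that Z_x = u_t.  Since mu0 > 1/2 > mul, the H^1 energy
   decreases at a rate comparable to U(0)^2 + U(l)^2; hence u is bounded in H^1.
   Let N be the integral of (e^{-4x} - e^{-4l})(U^2/2 + U^3/6) and q that of
   sinh(l - x) F, up to a factor 2.  For suitable constants, the bounded
   functional N - k U(0) q - C E, with E the energy, has a time derivative
   bounded below by a multiple of the integral of u_t^2 plus U(0)^2 + U(l)^2.
   The square of int F^2 + U(0)^2 is in turn controlled by that quantity, so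
   Barbalat's argument gives int F^2 + U(0)^2 -> 0; with the H^1 bound F -> 0
   uniformly, and as F = U (1 + U/2) while U(0) -> 0, continuity of U excludes
   the other zero U = -2 and U -> 0 uniformly.

   Weak convergence: u(t) is then asymptotically orthogonal in H^1 to any fixed
   function.  If |L (u t_i)| >= eps along t_i -> oo, a sum S of n sufficiently
   sparse signed terms has |S|^2 = O(n) and L S >= n eps, which is absurd for
   large n.

   Strong convergence for 0 < s < 1: off the strip |x - y| < eta the Slobodeckij
   integral is bounded by the sup norm of U; in the strip,
   (U x - U y)^2 <= |x - y| int_x^y u_x^2 and, for z between x and y,
   |x - y|^{-2r} <= |x - z|^{-r} |y - z|^{-r} with r = (1 + s) / 2, so Tonelli
   bounds it by C eta^{1-s} |u_x|^2. *)

Require Import Defs.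
From HB Require Import structures.
From mathcomp Require Import all_boot all_order all_algebra.
From mathcomp Require Import all_classical all_reals all_analysis.
From mathcomp Require Import measurable_realfun ring lra.
Set Implicit Arguments.
Unset Strict Implicit.
Unset Printing Implicit Defensive.
Import Order.TTheory GRing.Theory Num.Theory.
Import numFieldNormedType.Exports.
Local Open Scope classical_set_scope.
Local Open Scope ring_scope.

(** The obstacle is that the energy is dissipated only at the two endpoints, so decay inside (0,l)
    has to be extracted from the equation. At a fixed time the equation is a linear first-order
    system in x, namely W' = Z + F and Z' = W with W = u_t. It makes (W^2 - Z^2)' = 2 W F, and F is
    the derivative of U^2/2 + U^3/6 with respect to U: this is why the derivative of N controls the
    integral of u_t^2, up to terms in Z(0)^2 and W(0)^2. The boundary conditions express Z at the
    ends through U, but they give no hold on W(0) = u_t(0). The quantity q is there for that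
    purpose: sinh(l - x) and cosh(l - x) solve the adjoint system, so q is a combination of W(0),
    Z(0) and Z(l), and the derivative of U(0) q contains W(0)^2 with a negative coefficient. The
    term C E then pays for all remaining squares of boundary values of U. *)

Lemma norm_le_sqr (R : realType) (x y : R) : 0 <= y -> x ^+ 2 <= y ^+ 2 -> `|x| <= y.
Proof. by move=> y0; rewrite -[x ^+ 2]real_normK ?num_real// ler_pXn2r// nnegrE. Qed.

(** * Integration and absolutely continuous functions on (0,l) *)

Section Integrals.
Variables (R : realType) (l : R).
Local Notation mu := (@lebesgue_measure R).
Local Notation D := (`]0, l[%classic : set R).
Implicit Types (f g h : R -> R) (a c : R).

Definition intble (f : R -> R) := mu.-integrable D (EFin \o f).
Definition Int (f : R -> R) : R := \int[mu]_(x in D) f x.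

Lemma measurable_D : measurable (D : set (measurableTypeR R)).
Proof. exact: measurable_itv. Qed.
Local Hint Resolve measurable_D : core.
Local Hint Extern 0 (measurable _) => exact: measurable_D : core.

Lemma mu_D : 0 <= l -> mu D = l%:E.
Proof.
move=> l0; rewrite lebesgue_measure_itv/= lte_fin sube0.
by case: ltgtP l0 => // <-.
Qed.

Lemma mu_D_fin : (mu D < +oo)%E.
Proof. by rewrite lebesgue_measure_itv/=; case: ifP => _; rewrite ?ltry. Qed.

Lemma intble_meas f : intble f -> measurable_fun D f.
Proof. by move/measurable_int/measurable_EFinP. Qed.

Lemma intbleD f g : intble f -> intble g -> intble (fun x => f x + g x).
Proof. by move=> hf hg; have := integrableD measurable_D hf hg. Qed.

Lemma intbleZ a f : intble f -> intble (fun x => a * f x).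
Proof. by move=> hf; have := integrableZl measurable_D a hf. Qed.

Lemma intbleN f : intble f -> intble (fun x => - f x).
Proof. by move=> /(intbleZ (-1)); congr intble; apply/funext => x; rewrite mulN1r. Qed.

Lemma intbleB f g : intble f -> intble g -> intble (fun x => f x - g x).
Proof. by move=> hf /intbleN; exact: intbleD. Qed.

Lemma intble_abs f : intble f -> intble (fun x => `|f x|).
Proof. by move=> hf; have := integrable_norm hf. Qed.

Lemma intble_dom f g : measurable_fun D f -> (forall x, D x -> `|f x| <= g x) ->
  intble g -> intble f.
Proof.
move=> mf fg; apply: le_integrable => //; first exact/measurable_EFinP.
by move=> x Dx; rewrite /= lee_fin (le_trans (fg x Dx))// ler_norm.
Qed.

Lemma intble_cst c : intble (fun=> c).
Proof.
apply/integrableP; split; first exact/measurable_EFinP.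
have := integral_cst mu measurable_D `|c|%:E; rewrite /cst /= => ->.
by rewrite lte_mul_pinfty ?mu_D_fin// lee_fin.
Qed.

Lemma intble_bound f c : measurable_fun D f -> (forall x, D x -> `|f x| <= c) ->
  intble f.
Proof. by move=> mf fc; apply: (intble_dom mf fc (intble_cst c)). Qed.

Lemma intble_mulbound f g c : measurable_fun D f -> (forall x, D x -> `|f x| <= c) ->
  intble g -> intble (fun x => f x * g x).
Proof.
move=> mf fc ig; apply: (@intble_dom _ (fun x => c * `|g x|)).
- by apply: measurable_funM => //; exact: intble_meas.
- by move=> x Dx; rewrite normrM ler_wpM2r// fc.
- exact/intbleZ/intble_abs.
Qed.

Lemma IntD f g : intble f -> intble g -> Int (fun x => f x + g x) = Int f + Int g.
Proof. by move=> *; rewrite /Int RintegralD. Qed.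

Lemma IntZ a f : intble f -> Int (fun x => a * f x) = a * Int f.
Proof. by move=> *; rewrite /Int RintegralZl. Qed.

Lemma IntN f : intble f -> Int (fun x => - f x) = - Int f.
Proof.
move=> hf; rewrite -mulN1r -IntZ//; congr Int; apply/funext => x.
by rewrite mulN1r.
Qed.

Lemma IntB f g : intble f -> intble g -> Int (fun x => f x - g x) = Int f - Int g.
Proof. by move=> *; rewrite /Int RintegralB. Qed.

Lemma le_Int f g : intble f -> intble g -> (forall x, D x -> f x <= g x) ->
  Int f <= Int g.
Proof. by move=> *; rewrite /Int; apply: le_Rintegral. Qed.

Lemma Int_ge0 f : (forall x, D x -> 0 <= f x) -> 0 <= Int f.
Proof. by move=> *; rewrite /Int; apply: Rintegral_ge0. Qed.

Lemma le_abs_Int f : intble f -> `|Int f| <= Int (fun x => `|f x|).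
Proof. by move=> *; rewrite /Int; apply: le_normr_Rintegral. Qed.

Lemma Int_cst (c : R) : 0 <= l -> Int (fun=> c) = c * l.
Proof.
move=> l0; rewrite /Int Rintegral_cst//; congr (_ * _).
rewrite -[RHS]/(fine l%:E); congr fine; exact: mu_D.
Qed.

Lemma eq_Int f g : (forall x, D x -> f x = g x) -> Int f = Int g.
Proof. by move=> fg; apply: eq_Rintegral => x; rewrite inE => /fg. Qed.

Lemma ae_impl (P Q : R -> Prop) : (forall x, P x -> Q x) ->
  {ae mu, forall x, P x} -> {ae mu, forall x, Q x}.
Proof. by move=> PQ; apply: (@filterS _ _ (ae_filter_ringOfSetsType mu)). Qed.

Lemma ae_impl2 (P Q S : R -> Prop) : (forall x, P x -> Q x -> S x) ->
  {ae mu, forall x, P x} -> {ae mu, forall x, Q x} -> {ae mu, forall x, S x}.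
Proof. by move=> PQ; apply: (@filterS2 _ _ (ae_filter_ringOfSetsType mu)). Qed.

Definition aeq (f g : R -> R) := {ae mu, forall x, x \in `]0, l[ -> f x = g x}.

Lemma aeq_sym f g : aeq f g -> aeq g f.
Proof. by apply: ae_impl => x fg /fg. Qed.

Lemma aeq_trans f g h : aeq f g -> aeq g h -> aeq f h.
Proof. by apply: ae_impl2 => x fg gh xD; rewrite fg// gh. Qed.

Lemma aeq_ae_eq f g : aeq f g -> ae_eq mu D (EFin \o f) (EFin \o g).
Proof. by apply: ae_impl => x fg /= Dx; rewrite fg. Qed.

Lemma eq_Int_ae f g : measurable_fun D f -> measurable_fun D g -> aeq f g ->
  Int f = Int g.
Proof.
move=> mf mg fg; rewrite /Int /Rintegral; congr fine; apply: ae_eq_integral => //.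
- exact/measurable_EFinP.
- exact/measurable_EFinP.
- exact: aeq_ae_eq.
Qed.

Lemma intble_ae f g : intble f -> measurable_fun D g -> aeq f g -> intble g.
Proof.
move=> hf mg fg; have /integrableP[_ f_fin] := hf.
apply/integrableP; split; first exact/measurable_EFinP.
rewrite (_ : integral _ _ _ = \int[mu]_(x in D) `|(EFin \o f) x|)%E//.
apply: ae_eq_integral => //.
- by apply: measurableT_comp => //; exact/measurable_EFinP.
- by apply: measurableT_comp => //; exact: measurable_int hf.
- apply: ae_impl (aeq_ae_eq fg) => x h Dx; by rewrite h.
Qed.

Lemma Int0 : Int (fun=> 0) = 0.
Proof. by rewrite /Int /Rintegral (@integral0 _ _ _ mu). Qed.

Lemma EFin_Int f : intble f -> (\int[mu]_(x in D) (f x)%:E)%E = (Int f)%:E.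
Proof. by move=> hf; rewrite /Int /Rintegral fineK//; exact: integrable_fin_num. Qed.

Lemma Int_eq0_ae f : intble f -> (forall x, D x -> 0 <= f x) -> Int f = 0 ->
  aeq f (cst 0).
Proof.
move=> hf f0 If; have mf := measurable_int _ hf.
have E : (\int[mu]_(x in D) `|(EFin \o f) x|)%E = (Int f)%:E.
  rewrite -(EFin_Int hf); apply: eq_integral => x; rewrite inE => Dx.
  by rewrite /= ger0_norm// f0.
rewrite If in E; move/(ae_eq_integral_abs _ measurable_D mf) : E.
by apply: ae_impl => x /= h xD; have [] := h xD.
Qed.

Lemma L2_meas f : L2 l f -> measurable_fun D f.
Proof. by case. Qed.

Lemma L2_sqr f : L2 l f -> intble (fun x => f x ^+ 2).
Proof. by case. Qed.

Lemma L2_dom f g : measurable_fun D f -> (forall x, D x -> f x ^+ 2 <= g x) ->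
  intble g -> L2 l f.
Proof.
move=> mf fg ig; split => //; apply: (@intble_dom (fun x => f x ^+ 2) g) => //.
  exact: measurable_funX.
by move=> x Dx; rewrite ger0_norm ?sqr_ge0// fg.
Qed.

Lemma L2D f g : L2 l f -> L2 l g -> L2 l (fun x => f x + g x).
Proof.
move=> hf hg.
apply: (@L2_dom _ (fun x => 2 * f x ^+ 2 + 2 * g x ^+ 2)).
- by apply: measurable_funD; exact: L2_meas.
- by move=> x _; have := sqr_ge0 (f x - g x); rewrite !expr2; lra.
- by apply: intbleD; apply: intbleZ; exact: L2_sqr.
Qed.

Lemma L2_bound f c : measurable_fun D f -> (forall x, D x -> `|f x| <= c) -> L2 l f.
Proof.
move=> mf fc; apply: (@L2_dom _ (fun=> c ^+ 2)) (intble_cst _) => // x Dx.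
by rewrite -real_normK ?num_real// lerXn2r ?nnegrE ?fc// (le_trans _ (fc x Dx)).
Qed.

Lemma L2_cst c : L2 l (fun=> c).
Proof. exact: (@L2_bound _ `|c|). Qed.

Lemma L2_mulbound f g c : measurable_fun D f -> (forall x, D x -> `|f x| <= c) ->
  L2 l g -> L2 l (fun x => f x * g x).
Proof.
move=> mf fc hg; apply: (@L2_dom _ (fun x => c ^+ 2 * g x ^+ 2)).
- by apply: measurable_funM => //; exact: L2_meas.
- move=> x Dx; rewrite exprMn ler_wpM2r ?sqr_ge0//.
  by rewrite -real_normK ?num_real// lerXn2r ?nnegrE ?fc// (le_trans _ (fc x Dx)).
- exact/intbleZ/L2_sqr.
Qed.

Lemma L2Z a f : L2 l f -> L2 l (fun x => a * f x).
Proof. by move=> hf; apply: (@L2_mulbound (fun=> a) f `|a|). Qed.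

Lemma L2N f : L2 l f -> L2 l (fun x => - f x).
Proof. by move=> /(L2Z (-1)); congr L2; apply/funext => x; rewrite mulN1r. Qed.

Lemma L2B f g : L2 l f -> L2 l g -> L2 l (fun x => f x - g x).
Proof. by move=> hf /L2N; exact: L2D. Qed.

Lemma L2M f g : L2 l f -> L2 l g -> intble (fun x => f x * g x).
Proof.
move=> hf hg.
apply: (@intble_dom _ (fun x => f x ^+ 2 + g x ^+ 2)).
- by apply: measurable_funM; exact: L2_meas.
- move=> x _; rewrite normrM -(real_normK (num_real (f x))) -(real_normK (num_real (g x))).
  have := sqr_ge0 (`|f x| - `|g x|); have := sqr_ge0 (`|f x| + `|g x|).
  by rewrite !expr2; lra.
- by apply: intbleD; exact: L2_sqr.
Qed.

Lemma L2_intble f : L2 l f -> intble f.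
Proof.
by move=> hf; have := L2M (L2_cst 1) hf; under eq_fun do rewrite mul1r.
Qed.

Lemma CauchySchwarz f g : L2 l f -> L2 l g ->
  Int (fun x => f x * g x) ^+ 2 <=
  Int (fun x => f x ^+ 2) * Int (fun x => g x ^+ 2).
Proof.
move=> hf hg; set A := Int (fun x => f x ^+ 2); set C := Int (fun x => g x ^+ 2).
set B := Int _.
have A0 : 0 <= A by apply: Int_ge0 => x _; exact: sqr_ge0.
have C0 : 0 <= C by apply: Int_ge0 => x _; exact: sqr_ge0.
have quad k : 0 <= A + (- (2 * k) * B + k ^+ 2 * C).
  rewrite /A /B /C -IntZ; last exact: L2M.
  rewrite -(IntZ (k ^+ 2)); last exact: L2_sqr.
  rewrite -IntD; [|by apply: intbleZ; exact: L2M|by apply: intbleZ; exact: L2_sqr].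
  rewrite -IntD; [|exact: L2_sqr|apply: intbleD; apply: intbleZ; [exact: L2M|exact: L2_sqr]].
  apply: Int_ge0 => x _; have := sqr_ge0 (f x - k * g x); rewrite !expr2; lra.
have [C_eq0|C_neq0] := eqVneq C 0.
  have [-> |B_neq0] := eqVneq B 0; first by rewrite expr0n/= mulr_ge0.
  (* With [C = 0] the quadratic form is affine in [k]; this [k] gives it the value -1, so [B] must
     vanish. *)
  have := quad ((A + 1) / (2 * B)); rewrite C_eq0.
  have -> : A + (- (2 * ((A + 1) / (2 * B))) * B + ((A + 1) / (2 * B)) ^+ 2 * 0) = -1.
    by field.
  by lra.
have C_gt0 : 0 < C by rewrite lt_neqAle eq_sym C_neq0.
have := quad (B / C).
have -> : A + (- (2 * (B / C)) * B + (B / C) ^+ 2 * C) = (A * C - B ^+ 2) / C by field.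
by rewrite pmulr_lge0 ?invr_gt0// subr_ge0.
Qed.

End Integrals.

(** * Calculus of absolutely continuous functions on [0,l] *)

Section AbsolutelyContinuous.
Variables (R : realType) (l : R).
Local Notation mu := (@lebesgue_measure R).
Local Notation D := (`]0, l[%classic : set R).
Implicit Types (f g h : R -> R) (a c x y z : R).
Local Notation intble := (intble l).
Local Notation Int := (Int l).
Local Notation aeq := (aeq l).
Local Hint Extern 0 (measurable _) => exact: measurable_D : core.

(** Absolute continuity in integrated form. The calculus in x rests on this relation and not on
    pointwise derivatives, because u_x and u_txx exist only almost everywhere. *)
Definition ac f g := intble g /\
  forall x, 0 <= x <= l -> f x = f 0 + \int[mu]_(y in `]0, x[) g y.

(** Multiplication by [chi x] turns an integral over []0, x[] into one over the fixed interval []0,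
    l[], to which the algebra of [Int] applies. *)
Definition chi x y : R := (y < x)%R%:R.

Lemma chi_le1 x y : `|chi x y| <= 1.
Proof. by rewrite /chi; case: ltP; rewrite ?normr1 ?normr0. Qed.

Lemma measurable_chi x (A : set R) : measurable_fun A (chi x).
Proof.
have -> : chi x = \1_(`]-oo, x[%classic : set R).
  by apply/funext => y; rewrite indicE mem_setE in_itv.
exact: measurable_indic.
Qed.

Lemma intble_chi x g : intble g -> intble (fun y => chi x y * g y).
Proof.
by apply: (@intble_mulbound _ _ _ _ 1); [exact: measurable_chi|move=> y _; exact: chi_le1].
Qed.

Lemma prim_Int x g : 0 <= x <= l ->
  \int[mu]_(y in `]0, x[) g y = Int (fun y => chi x y * g y).
Proof.
move=> /andP[x0 xl].
have -> : (`]0, x[%classic : set R) = `]0, l[%classic `&` `]-oo, x[%classic.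
  apply/seteqP; split => y /=; rewrite !in_itv/=.
    by move=> /andP[-> yx]; rewrite yx (lt_le_trans yx xl).
  by move=> [/andP[-> _] ->].
rewrite Rintegral_mkcondr; apply: eq_Int => y _.
by rewrite /patch mem_setE in_itv/= /chi; case: ltP; rewrite ?mul1r ?mul0r.
Qed.

Lemma acE f g x : ac f g -> 0 <= x <= l -> f x = f 0 + Int (fun y => chi x y * g y).
Proof. by move=> [_ fE] xl; rewrite fE// prim_Int. Qed.

Lemma acP f g : intble g ->
  (forall x, 0 <= x <= l -> f x = f 0 + Int (fun y => chi x y * g y)) -> ac f g.
Proof. by move=> ig fE; split => // x xl; rewrite prim_Int// -fE. Qed.

Lemma chi1 x y : y < x -> chi x y = 1.
Proof. by rewrite /chi => ->. Qed.

Lemma chi0 x y : x <= y -> chi x y = 0.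
Proof. by rewrite /chi leNgt => /negbTE ->. Qed.

Lemma ac_endpoints f g : 0 <= l -> ac f g -> f l - f 0 = Int g.
Proof.
move=> l0 hf; rewrite (acE hf) ?l0 ?lexx// addrC addKr.
by apply: eq_Int => y /=; rewrite in_itv/= => /andP[_ yl]; rewrite chi1 ?mul1r.
Qed.

Lemma intble_patch g : intble g -> mu.-integrable setT (EFin \o (g \_ D)).
Proof. by move=> ig; rewrite -restrict_EFin; apply/(integrable_mkcond _ (measurable_D l)). Qed.

Lemma within_eq f g : (forall x, 0 <= x <= l -> f x = g x) ->
  {within `[0, l], continuous f} -> {within `[0, l], continuous g}.
Proof.
move=> fg; apply: (@subspace_eq_continuous _ _ _ f g) => x /set_mem.
by rewrite /= in_itv; exact: fg.
Qed.

Lemma prim_continuous g : 0 <= l -> intble g ->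
  {within `[0, l], continuous (fun x => \int[mu]_(y in `]0, x[) g y)}.
Proof.
move=> l0 ig; have iT := intble_patch ig.
have iS (A : set R) : measurable A -> mu.-integrable A (EFin \o (g \_ D)).
  by move=> mA; apply: integrableS iT.
have /= := parameterized_integral_continuous l0 (iS _ (measurable_itv `[0, l])).
rewrite /parameterized_integral; apply: within_eq => x /andP[x0 xl].
rewrite -Rintegral_itv_bndo_bndc; last by apply: iS; exact: measurable_itv.
rewrite -Rintegral_itv_obnd_cbnd; last by apply: iS; exact: measurable_itv.
apply: eq_Rintegral => y; rewrite inE/= in_itv/= => /andP[y0 yx].
by rewrite /patch mem_setE in_itv/= y0 (lt_le_trans yx xl).
Qed.

Lemma ac_continuous f g : 0 <= l -> ac f g -> {within `[0, l], continuous f}.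
Proof.
move=> l0 [ig fE].
have := @within_continuousD _ _ R _ (cst (f 0)) _ _ (prim_continuous l0 ig).
move=> H; apply: (@within_eq (cst (f 0) + (fun x => \int[mu]_(y in `]0, x[) g y))).
  by move=> x xl; rewrite [RHS]fE.
by apply: H => x; exact: cst_continuous.
Qed.

Lemma continuous_bounded f : {within `[0, l], continuous f} ->
  exists2 c : R, 0 <= c & forall x, 0 <= x <= l -> `|f x| <= c.
Proof.
move=> cf; have := continuous_compact cf (@segment_compact _ 0 l).
move=> /compact_bounded[M [_ Mf]]; exists `|M + 1| => // x xl.
have M1 : M < `|M + 1| by rewrite (lt_le_trans _ (ler_norm _))// ltrDl.
by apply: Mf M1 _ _; exists x => //=; rewrite in_itv.
Qed.

Lemma itv_oo_cc x : D x -> 0 <= x <= l.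
Proof. by rewrite /= in_itv/= => /andP[/ltW -> /ltW ->]. Qed.

Lemma continuous_meas f : {within `[0, l], continuous f} -> measurable_fun D f.
Proof.
move=> cf; apply: (@measurable_funS _ _ _ _ `[0, l]%classic).
- exact: measurable_itv.
- by move=> x /itv_oo_cc; rewrite /= in_itv.
- by apply: subspace_continuous_measurable_fun => //; exact: measurable_itv.
Qed.

Lemma ac_bounded f g : 0 <= l -> ac f g ->
  exists2 c : R, 0 <= c & forall x, 0 <= x <= l -> `|f x| <= c.
Proof. by move=> l0 /(ac_continuous l0)/continuous_bounded. Qed.

Lemma ac_meas f g : 0 <= l -> ac f g -> measurable_fun D f.
Proof. by move=> l0 /(ac_continuous l0)/continuous_meas. Qed.

Lemma ac_L2 f g : 0 <= l -> ac f g -> L2 l f.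
Proof.
move=> l0 hf; have [c _ fc] := ac_bounded l0 hf.
by apply: (L2_bound (ac_meas l0 hf)) => x /itv_oo_cc xl; exact: fc.
Qed.

Lemma ac_intbleM f g h : 0 <= l -> ac f g -> intble h -> intble (fun x => f x * h x).
Proof.
move=> l0 hf; have [c _ fc] := ac_bounded l0 hf.
by apply: (intble_mulbound (ac_meas l0 hf)) => x /itv_oo_cc xl; exact: fc.
Qed.

Lemma ac_L2M f g h : 0 <= l -> ac f g -> L2 l h -> L2 l (fun x => f x * h x).
Proof.
move=> l0 hf; have [c _ fc] := ac_bounded l0 hf.
by apply: (L2_mulbound (ac_meas l0 hf)) => x /itv_oo_cc xl; exact: fc.
Qed.

Lemma acD f1 g1 f2 g2 : ac f1 g1 -> ac f2 g2 ->
  ac (fun x => f1 x + f2 x) (fun x => g1 x + g2 x).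
Proof.
move=> h1 h2; apply: acP => [|x xl]; first exact: intbleD h1.1 h2.1.
under [X in _ = _ + Int X]eq_fun do rewrite mulrDr.
rewrite IntD; [|exact: intble_chi h1.1|exact: intble_chi h2.1].
by rewrite (acE h1 xl) (acE h2 xl) addrACA.
Qed.

Lemma acZ a f g : ac f g -> ac (fun x => a * f x) (fun x => a * g x).
Proof.
move=> h1; apply: acP => [|x xl]; first exact: intbleZ h1.1.
under [X in _ = _ + Int X]eq_fun do rewrite mulrCA.
by rewrite IntZ; [rewrite (acE h1 xl) mulrDr|exact: intble_chi h1.1].
Qed.

Lemma acN f g : ac f g -> ac (fun x => - f x) (fun x => - g x).
Proof.
move=> /(acZ (-1)).
by under eq_fun do rewrite mulN1r; under [X in ac _ X]eq_fun do rewrite mulN1r.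
Qed.

Lemma acB f1 g1 f2 g2 : ac f1 g1 -> ac f2 g2 ->
  ac (fun x => f1 x - f2 x) (fun x => g1 x - g2 x).
Proof. by move=> h1 /acN; exact: acD. Qed.

Lemma ac_cst c : ac (fun=> c) (fun=> 0).
Proof.
apply: acP => [|x xl]; first exact: intble_cst.
under [X in Int X]eq_fun do rewrite mulr0.
by rewrite Int0 addr0.
Qed.

Lemma ac_ae f g1 g2 : ac f g1 -> measurable_fun D g2 -> aeq g1 g2 -> ac f g2.
Proof.
move=> h mg2 g12; have ig2 := intble_ae h.1 mg2 g12.
apply: acP => // x xl; rewrite (acE h xl); congr (_ + _).
apply: eq_Int_ae; [| |by apply: ae_impl g12 => y e /e ->].
- by apply: (@intble_meas _ l); apply: intble_chi; exact: h.1.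
- by apply: (@intble_meas _ l); exact: intble_chi.
Qed.

Lemma ac_eq f1 f2 g1 g2 : ac f1 g1 -> 0 <= l ->
  (forall x, 0 <= x <= l -> f1 x = f2 x) -> (forall x, D x -> g1 x = g2 x) -> ac f2 g2.
Proof.
move=> h l0 f12 g12.
have mg2 : measurable_fun D g2.
  by apply: eq_measurable_fun (intble_meas h.1) => x /set_mem; exact: g12.
have aeg : aeq g1 g2 by apply: aeW => x /g12.
have [ig E] := ac_ae h mg2 aeg; split => // x xl.
by rewrite -!f12 ?lexx// E.
Qed.

Lemma meas_le z : measurable_fun [set: R] (fun x => (x <= z)%R%:R : R).
Proof.
have -> : (fun x => (x <= z)%R%:R) = \1_(`]-oo, z]%classic : set R) :> (R -> R).
  by apply/funext => y; rewrite indicE mem_setE in_itv.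
exact: measurable_indic.
Qed.

Lemma meas_ge z : measurable_fun [set: R] (fun x => (z <= x)%R%:R : R).
Proof.
have -> : (fun x => (z <= x)%R%:R) = \1_(`[z, +oo[%classic : set R) :> (R -> R).
  by apply/funext => y; rewrite indicE mem_setE in_itv/= andbT.
exact: measurable_indic.
Qed.

Lemma fubini_triangle g1 g2 : intble g1 -> intble g2 ->
  Int (fun y => g1 y * Int (fun z => (y <= z)%R%:R * g2 z)) =
  Int (fun z => g2 z * Int (fun y => (y <= z)%R%:R * g1 y)).
Proof.
move=> i1 i2.
pose k1 := g1 \_ D; pose k2 := g2 \_ D.
have ik1 : mu.-integrable setT (EFin \o k1) := intble_patch i1.
have ik2 : mu.-integrable setT (EFin \o k2) := intble_patch i2.
have mk1 : measurable_fun setT k1 by apply/measurable_EFinP; exact: measurable_int ik1.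
have mk2 : measurable_fun setT k2 by apply/measurable_EFinP; exact: measurable_int ik2.
have m1 : measurable_fun setT (fun p : measurableTypeR R * measurableTypeR R => k1 p.1).
  by apply: measurableT_comp.
have m2 : measurable_fun setT (fun p : measurableTypeR R * measurableTypeR R => k2 p.2).
  by apply: measurableT_comp.
pose h (p : measurableTypeR R * measurableTypeR R) := k1 p.1 * k2 p.2.
have mh : measurable_fun setT h by exact: measurable_funM.
pose t (p : measurableTypeR R * measurableTypeR R) : R := (p.1 <= p.2)%R%:R.
have mt : measurable_fun setT t.
  have -> : t = \1_[set p : measurableTypeR R * measurableTypeR R | p.1 <= p.2].
    by apply/funext => p; rewrite indicE /t; case: (boolP (p.1 <= p.2)) => pp;
      [rewrite mem_set|rewrite memNset//; exact/negP].
  apply: measurable_indic.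
  rewrite -[X in measurable X]setTI.
  have := @measurable_fun_ler _ _ R setT _ _ measurable_fst measurable_snd measurableT [set true].
  by apply.
have ih : (mu \x mu)%E.-integrable setT (EFin \o h).
  apply/integrable12ltyP; first exact/measurable_EFinP.
  rewrite (_ : (\int[mu]_x _)%E = \int[mu]_x (`|k1 x|%:E * \int[mu]_y `|k2 y|%:E))%E; last first.
    apply: eq_integral => x _; rewrite -ge0_integralZl//.
    - by apply: eq_integral => y _; rewrite /= normrM EFinM.
    - by apply/measurable_EFinP; exact: measurableT_comp.
  have /integrableP[_ fin1] := ik1; have /integrableP[_ fin2] := ik2.
  rewrite ge0_integralZr//.
  - by apply: lte_mul_pinfty => //; rewrite ?integral_ge0// ge0_fin_numE// integral_ge0.
  - by apply/measurable_EFinP; exact: measurableT_comp.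
  - exact: integral_ge0.
have iF : (mu \x mu)%E.-integrable setT (EFin \o (fun p => t p * h p)).
  apply: le_integrable ih => //; first exact/measurable_EFinP/measurable_funM.
  move=> p _; rewrite /= lee_fin normrM ler_piMl// /t.
  by case: (p.1 <= p.2)%R; rewrite ?normr1 ?normr0.
have := Fubini iF => /=.
have pI (b : R -> bool) g (k := g \_ D) : measurable_fun setT (fun x => (b x)%:R : R) -> intble g -> forall a,
    (\int[mu]_x ((b x)%:R * (a * k x))%:E)%E = (a * Int (fun x => (b x)%:R * g x))%:E.
  move=> mb ig a.
  rewrite -IntZ; last first.
    apply: (@intble_mulbound _ _ _ _ 1) => //; first exact: measurable_funS mb.
    by move=> x _; case: (b x); rewrite ?normr1 ?normr0.
  rewrite -EFin_Int; last first.
    apply: intbleZ; apply: (@intble_mulbound _ _ _ _ 1) => //; first exact: measurable_funS mb.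
    by move=> x _; case: (b x); rewrite ?normr1 ?normr0.
  rewrite [RHS]integral_mkcond; apply: eq_integral => x _.
  by rewrite /k /patch; case: ifP => _; rewrite ?mulr0// mulrCA.
have toI g w : Int (fun x => g x * w x) = fine (\int[mu]_x ((g \_ D) x * w x)%:E)%E.
  rewrite /Int /Rintegral integral_mkcond; congr fine; apply: eq_integral => x _.
  by rewrite /patch; case: ifP => _ //=; rewrite mul0r.
rewrite !toI => FE; congr fine; move: FE; rewrite /t /h/=.
rewrite (_ : (\int[mu]_x _)%E = \int[mu]_x (k1 x * Int (fun y => (x <= y)%R%:R * g2 y))%:E)%E; last first.
  by apply: eq_integral => x _; rewrite (pI (fun y => x <= y))//; exact: meas_ge.
move=> ->; apply: eq_integral => y _.
under eq_integral do rewrite (mulrC (k1 _)).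
by rewrite (pI (fun x => x <= y))//; exact: meas_le.
Qed.

(** The square is cut along its diagonal and Fubini exchanges the variables in one of the triangles.
    The diagonal, where [<] and [<=] differ, meets each line in a null set. *)
Lemma prod_Int g1 g2 : 0 <= l -> intble g1 -> intble g2 ->
  Int g1 * Int g2 = Int (fun y => g1 y * Int (fun z => chi y z * g2 z) +
                                  Int (fun z => chi y z * g1 z) * g2 y).
Proof.
move=> l0 i1 i2.
have acp g : intble g -> ac (fun y => Int (fun z => chi y z * g z)) g.
  move=> ig; apply: acP => // x xl; rewrite [X in _ = X + _](_ : _ = 0) ?add0r//.
  rewrite -[RHS](Int0 l).
  by apply: eq_Int => y; rewrite /= in_itv/= => /andP[/ltW y0 _]; rewrite chi0// mul0r.
have iA : intble (fun y => g1 y * Int (fun z => chi y z * g2 z)).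
  by under eq_fun do rewrite mulrC; exact: ac_intbleM (acp _ i2) i1.
have iB := ac_intbleM l0 (acp _ i1) i2.
rewrite IntD//.
have ile y g : intble g -> intble (fun z => (y <= z)%R%:R * g z).
  apply: (@intble_mulbound _ _ _ _ 1); first exact: measurable_funS (meas_ge y).
  by move=> x _; case: (y <= x); rewrite ?normr1 ?normr0.
have ig z g : intble g -> intble (fun y => (y <= z)%R%:R * g y).
  apply: (@intble_mulbound _ _ _ _ 1); first exact: measurable_funS (meas_le z).
  by move=> x _; case: (x <= z); rewrite ?normr1 ?normr0.
have spl y : Int g2 = Int (fun z => chi y z * g2 z) + Int (fun z => (y <= z)%R%:R * g2 z).
  rewrite -IntD; [|exact: intble_chi|exact: ile].
  by apply: eq_Int => z _; rewrite -mulrDl /chi; case: ltP; rewrite ?addr0 ?add0r mul1r.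
have -> : Int g1 * Int g2 = Int (fun y => g1 y * Int g2).
  by rewrite mulrC -IntZ//; apply: eq_Int => y _; rewrite mulrC.
have E y : g1 y * Int g2 = g1 y * Int (fun z => chi y z * g2 z) + g1 y * Int (fun z => (y <= z)%R%:R * g2 z).
  by rewrite -mulrDr -spl.
have iC : intble (fun y => g1 y * Int (fun z => (y <= z)%R%:R * g2 z)).
  have -> : (fun y => g1 y * Int (fun z => (y <= z)%R%:R * g2 z)) =
      (fun y => g1 y * Int g2 - g1 y * Int (fun z => chi y z * g2 z)).
    by apply/funext => y; rewrite E addrC addKr.
  apply: intbleB => //; under eq_fun do rewrite mulrC; exact: intbleZ.
under [LHS]eq_Int do rewrite E.
rewrite IntD// fubini_triangle//; congr (_ + _); apply: eq_Int => z Dz.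
rewrite mulrC; congr (_ * _); apply: eq_Int_ae.
- by apply: (@intble_meas _ l); exact: ig.
- by apply: (@intble_meas _ l); exact: intble_chi.
have : {ae mu, forall x, x != z}.
  exists [set z]; split => //; first exact: lebesgue_measure_set1.
  by move=> x /= /negP; rewrite negbK => /eqP.
by apply: ae_impl => x xz _; rewrite /chi lt_neqAle xz.
Qed.

(** Product rule without pointwise derivatives: once the values at 0 are split off, it is [prod_Int]
    for the derivatives cut off at [x]. *)
Lemma acM f1 g1 f2 g2 : 0 <= l -> ac f1 g1 -> ac f2 g2 ->
  ac (fun x => f1 x * f2 x) (fun x => g1 x * f2 x + f1 x * g2 x).
Proof.
move=> l0 h1 h2; have [i1 i2] := (h1.1, h2.1).
have I1 : intble (fun x => g1 x * f2 x).
  by under eq_fun do rewrite mulrC; exact: ac_intbleM h2 i1.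
have I2 := ac_intbleM l0 h1 i2.
apply: acP => [|x xl]; first exact: intbleD.
have c1 := intble_chi x i1; have c2 := intble_chi x i2.
have -> : f1 x * f2 x = f1 0 * f2 0 + f2 0 * Int (fun y => chi x y * g1 y) +
    f1 0 * Int (fun y => chi x y * g2 y) +
    Int (fun y => chi x y * g1 y) * Int (fun y => chi x y * g2 y).
  by rewrite (acE h1 xl) (acE h2 xl); ring.
suff -> : Int (fun y => chi x y * g1 y) * Int (fun y => chi x y * g2 y) =
    Int (fun y => chi x y * (g1 y * f2 y + f1 y * g2 y))
    - f2 0 * Int (fun y => chi x y * g1 y) - f1 0 * Int (fun y => chi x y * g2 y).
  by ring.
rewrite prod_Int// -IntZ// -[in RHS]IntZ//.
have i3 : intble (fun y => chi x y * (g1 y * f2 y + f1 y * g2 y)).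
  exact/intble_chi/intbleD.
rewrite -IntB//; last exact: intbleZ.
rewrite -IntB//; [|exact/intbleB/intbleZ|exact: intbleZ].
apply: eq_Int => y /itv_oo_cc yl; rewrite (acE h1 yl) (acE h2 yl).
have [yx|xy] := ltP y x; last by rewrite (chi0 xy) !(mul0r, mulr0, subrr, addr0).
have E g : Int (fun z => chi y z * (chi x z * g z)) = Int (fun z => chi y z * g z).
  apply: eq_Int => z _; rewrite mulrA; congr (_ * _).
  have [zy|yz] := ltP z y; last by rewrite (chi0 yz) mul0r.
  by rewrite !chi1 ?mulr1// (lt_trans zy).
by rewrite !E (chi1 yx); ring.
Qed.

Lemma ac_by_parts f1 g1 f2 g2 : 0 <= l -> ac f1 g1 -> ac f2 g2 ->
  Int (fun x => g1 x * f2 x + f1 x * g2 x) = f1 l * f2 l - f1 0 * f2 0.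
Proof. by move=> l0 h1 h2; rewrite -(ac_endpoints l0 (acM l0 h1 h2)). Qed.

End AbsolutelyContinuous.

(** * Test functions, weak derivatives and H^1 *)

Section Derivatives.
Variable R : realType.
Implicit Types (f g : R -> R) (x y a b c d : R).

(** Remainder form of differentiability, free of division. The time derivatives of integrals are
    proved through it. *)
Lemma is_derive_eps f x d :
  (forall e : R, 0 < e -> exists2 r : R, 0 < r &
    forall h : R, `|h| < r -> `|f (x + h) - f x - h * d| <= e * `|h|) ->
  is_derive x 1 f d.
Proof.
move=> H; have C : (fun h : R => h^-1 *: ((f \o shift x) (h *: 1) - f x)) @ 0^' --> d.
  apply/cvgrPdist_le => e e0; have [r r0 rP] := H _ e0.
  near=> h; have h0 : h != 0 by near: h; exact: nbhs_dnbhs_neq.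
  have hr : `|h| < r.
    by near: h; apply: dnbhs0_lt.
  rewrite /= scaler1 [h + x]addrC distrC.
  have -> : h^-1 *: (f (x + h) - f x) - d = h^-1 * (f (x + h) - f x - h * d).
    by rewrite /GRing.scale/=; field.
  by rewrite normrM normfV mulrC ler_pdivrMr ?normr_gt0// rP.
by apply: DeriveDef; [apply/cvg_ex; exists d|exact: cvg_lim].
Unshelve. all: by end_near. Qed.

Lemma is_derive_cont f x d : is_derive x 1 f d -> {for x, continuous f}.
Proof.
by move=> [df _]; apply: differentiable_continuous; exact/derivable1_diffP.
Qed.

Lemma isd_eq f x d1 d2 : is_derive x 1 f d1 -> d1 = d2 -> is_derive x 1 f d2.
Proof. by move=> ? <-. Qed.

Lemma isd_cst c x : is_derive x 1 (fun=> c) 0.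
Proof. exact: (is_derive_cst c x 1). Qed.

Lemma isd_id x : is_derive x 1 (fun y => y) 1.
Proof. exact: (is_derive_id x 1). Qed.

Lemma isd_D f g x c d : is_derive x 1 f c -> is_derive x 1 g d ->
  is_derive x 1 (fun y => f y + g y) (c + d).
Proof. by move=> df dg; exact: (is_deriveD df dg). Qed.

Lemma isd_N f x d : is_derive x 1 f d -> is_derive x 1 (fun y => - f y) (- d).
Proof. by move=> df; exact: (is_deriveN df). Qed.

Lemma isd_B f g x c d : is_derive x 1 f c -> is_derive x 1 g d ->
  is_derive x 1 (fun y => f y - g y) (c - d).
Proof. by move=> df /isd_N; exact: isd_D. Qed.

Lemma isd_M f g x c d : is_derive x 1 f c -> is_derive x 1 g d ->
  is_derive x 1 (fun y => f y * g y) (c * g x + f x * d).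
Proof.
move=> df dg; apply: (isd_eq (is_deriveM df dg)).
by rewrite /GRing.scale/= addrC mulrC.
Qed.

Lemma isd_Z a f x d : is_derive x 1 f d -> is_derive x 1 (fun y => a * f y) (a * d).
Proof. by move=> df; exact: (is_deriveZ a df). Qed.

Lemma isd_comp f g x c d : is_derive (g x) 1 f c -> is_derive x 1 g d ->
  is_derive x 1 (fun y => f (g y)) (c * d).
Proof. by move=> df dg; exact: (is_derive1_comp df dg). Qed.

Lemma isd_X f x d n : is_derive x 1 f d ->
  is_derive x 1 (fun y => f y ^+ n) (n%:R * f x ^+ n.-1 * d).
Proof.
move=> df; elim: n => [|n IH].
  by under eq_fun do rewrite expr0; rewrite !mul0r; exact: isd_cst.
under eq_fun do rewrite exprS; apply: (isd_eq (isd_M df IH)).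
case: n {IH} => [|n]; first by rewrite /= expr0; ring.
by rewrite -natr1/= exprS; ring.
Qed.

(** Carries the successive derivatives as witnesses, so that closure under sums, products and affine
    substitutions goes by induction; [smthP] translates it to [derive1n]. *)
Fixpoint smth (n : nat) f : Prop :=
  match n with
  | 0%N => True
  | n'.+1 => exists2 f', (forall x, is_derive x 1 f (f' x)) & smth n' f'
  end.

Lemma smthS n f : smth n.+1 f -> smth n f.
Proof. by elim: n f => //= n IH f [f' df] /IH sf'; exists f'. Qed.

Lemma derive1_fun f f' : (forall x, is_derive x 1 f (f' x)) -> derive1 f = f'.
Proof.
by move=> df; apply/funext => x; rewrite derive1E; exact: (@derive_val _ _ _ _ _ _ _ (df x)).
Qed.

Lemma smthP f : (forall n, smth n f) <->
  (forall (n : nat) (x : R), derivable (derive1n n f) x 1).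
Proof.
split=> [sf n x|df n].
  have : smth n.+1 f by exact: sf.
  elim: n f {sf} => [|n IH] f [f' df sf']; first by rewrite derive1n0; have [] := df x.
  by rewrite derive1Sn (derive1_fun df); exact: IH.
elim: n f df => //= n IH f df; exists (derive1 f).
  by move=> x; rewrite derive1E; apply: derivableP; exact: (df 0%N).
by apply: IH => k x; have := df k.+1 x; rewrite derive1Sn.
Qed.

Lemma smthD n f g : smth n f -> smth n g -> smth n (fun x => f x + g x).
Proof.
elim: n f g => //= n IH f g [f' df sf] [g' dg sg]; exists (fun x => f' x + g' x).
  by move=> x; exact: isd_D.
exact: IH.
Qed.

Lemma smthZ n c f : smth n f -> smth n (fun x => c * f x).
Proof.
elim: n f => //= n IH f [f' df sf]; exists (fun x => c * f' x); last exact: IH.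
by move=> x; exact: isd_Z.
Qed.

Lemma smthM n f g : smth n f -> smth n g -> smth n (fun x => f x * g x).
Proof.
elim: n f g => //= n IH f g [f' df sf] [g' dg sg].
exists (fun x => f' x * g x + f x * g' x).
  by move=> x; exact: isd_M.
apply: smthD; apply: IH => //; apply: smthS; first by exists g'.
by exists f'.
Qed.

Lemma smth_affine n a b f : smth n f -> smth n (fun x => f (a * x + b)).
Proof.
elim: n f => //= n IH f [f' df sf]; exists (fun x => a * f' (a * x + b)); last exact/smthZ/IH.
move=> x; rewrite mulrC.
have dg : is_derive x 1 (fun x => a * x + b) a.
  by apply: (isd_eq (isd_D (isd_Z a (isd_id x)) (isd_cst b x))); rewrite mulr1 addr0.
exact: (@isd_comp f (fun x => a * x + b) x _ _ (df _) dg).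
Qed.

(** The derivative of a member of this family is a combination of the next two members, so [bump 0]
    is smooth without any formula for its higher derivatives. *)
Definition bump (k : nat) x : R := if 0 < x then x^-1 ^+ k * expR (- x^-1) else 0.

Lemma bump_le0 k x : x <= 0 -> bump k x = 0.
Proof. by rewrite /bump ltNge => ->. Qed.

Lemma bump_gt0 k x : 0 < x -> bump k x = x^-1 ^+ k * expR (- x^-1).
Proof. by rewrite /bump => ->. Qed.

(** From y^(k+2) <= (k+2)! e^y at y = 1/x. Quadratic vanishing at the origin is what gives
    derivative 0 there. *)
Lemma bump_small k x : `|bump k x| <= (k.+2)`!%:R * x ^+ 2.
Proof.
have [x0|x0] := leP x 0.
  by rewrite bump_le0// normr0 mulr_ge0 ?sqr_ge0.
rewrite bump_gt0// ger0_norm ?mulr_ge0 ?expR_ge0 ?exprn_ge0 ?invr_ge0 ?(ltW x0)//.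
have : 0 < x^-1 by rewrite invr_gt0.
have -> : x ^+ 2 = x^-1^-1 ^+ 2 by rewrite invrK.
move: (x^-1) => y y0.
have f0 : 0 < (k.+2)`!%:R :> R by rewrite ltr0n fact_gt0.
have := @expR_ge1Dxn R y k.+1 (ltW y0) => E.
have {E} : y ^+ k.+2 <= (k.+2)`!%:R * expR y.
  by rewrite mulrC -ler_pdivrMr// (le_trans _ E)// lerDr.
rewrite expRN ler_pdivrMr ?expR_gt0// mulrAC => E.
by rewrite exprVn ler_pdivlMr ?exprn_gt0// -exprD addn2.
Qed.

Lemma bump_derive k x :
  is_derive x 1 (bump k) (- k%:R * bump k.+1 x + bump k.+2 x).
Proof.
have [x0|x0|->] := ltgtP x 0.
- rewrite !bump_le0 ?(ltW x0)// mulr0 addr0.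
  apply: (@near_eq_is_derive _ _ _ (cst 0)).
  by near=> y; rewrite bump_le0//; apply/ltW; near: y; exact: lt_nbhsl.
- rewrite !bump_gt0//.
  apply: (@near_eq_is_derive _ _ _ (fun x => x^-1 ^+ k * expR (- x^-1))).
    by near=> y; rewrite bump_gt0//; near: y; exact: lt_nbhsr.
  have x_neq0 : x != 0 by rewrite gt_eqF.
  have dV : is_derive x 1 (fun y : R => y^-1) (- x ^- 2).
    apply: (isd_eq (is_deriveV x_neq0 (isd_id x))).
    by rewrite /GRing.scale/= mulr1.
  have dE := @isd_comp expR (fun y => - y^-1) x _ _ (is_derive_expR (- x^-1)) (isd_N dV).
  apply: (isd_eq (isd_M (isd_X k dV) dE)).
  rewrite !exprVn; case: k => [|k]; rewrite /= ?expr0 !exprS; field => //.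
  by rewrite x_neq0 expf_neq0.
- rewrite !bump_le0// mulr0 addr0.
  apply: is_derive_eps => e e0; pose C : R := (k.+2)`!%:R.
  have C0 : 0 < C by rewrite ltr0n fact_gt0.
  exists (e / C); first exact: divr_gt0.
  move=> h hr; rewrite add0r (bump_le0 _ (lexx 0)) subr0 mulr0 subr0.
  rewrite (le_trans (bump_small _ _))// -/C -real_normK ?num_real// expr2 mulrA ler_wpM2r//.
  by rewrite mulrC -ler_pdivlMr// ltW.
Unshelve. all: by end_near. Qed.

Lemma bump_smth n k : smth n (bump k).
Proof.
elim: n k => //= n IH k; exists (fun x => - k%:R * bump k.+1 x + bump k.+2 x).
  exact: bump_derive.
by apply: smthD; [exact/smthZ/IH|exact: IH].
Qed.

Lemma bump_ge0 k x : 0 <= bump k x.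
Proof.
have [x0|x0] := leP x 0; first by rewrite bump_le0.
by rewrite bump_gt0// mulr_ge0 ?expR_ge0// exprn_ge0// invr_ge0 ltW.
Qed.

Lemma bump0_le1 x : bump 0 x <= 1.
Proof.
have [x0|x0] := leP x 0; first by rewrite bump_le0.
by rewrite bump_gt0// expr0 mul1r expRN invf_le1 ?expR_gt0// -expR0 ler_expR invr_ge0 ltW.
Qed.

(** A smooth approximation of the indicator of (a,b): supported in [a,b], with values in [0,1], and
    tending to 1 at each point of (a,b) as n grows. *)
Definition plateau a b (n : nat) x : R :=
  bump 0 (n%:R * x + - (n%:R * a)) * bump 0 (- n%:R * x + n%:R * b).

Lemma plateau_test (l : R) a b n : 0 < a -> b < l -> test_function l (plateau a b n).
Proof.
move=> a0 bl; split.
  by apply/smthP => k; apply: smthM; apply: smth_affine; exact: bump_smth.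
exists a, b; split => // x xab; rewrite /plateau.
have [xa|ax] := ltP x a.
  by rewrite bump_le0 ?mul0r// -mulrBr mulr_ge0_le0// subr_le0 ltW.
have [bx|xb] := ltP b x; last by exfalso; apply: xab; rewrite ax xb.
rewrite [X in _ * X]bump_le0 ?mulr0// mulNr addrC -mulrBr mulr_ge0_le0// subr_le0 ltW//.
Qed.

Lemma plateau_bound a b n x : 0 <= plateau a b n x <= 1.
Proof. by rewrite mulr_ge0 ?bump_ge0//= mulr_ile1 ?bump_ge0 ?bump0_le1. Qed.

Lemma plateau_out a b n x : ~ (a < x < b) -> plateau a b n x = 0.
Proof.
move=> xab; rewrite /plateau; have [xa|ax] := leP x a.
  by rewrite bump_le0 ?mul0r// -mulrBr mulr_ge0_le0// subr_le0.
have [bx|xb] := leP b x; last by exfalso; apply: xab; rewrite ax xb.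
by rewrite [X in _ * X]bump_le0 ?mulr0// mulNr addrC -mulrBr mulr_ge0_le0// subr_le0.
Qed.

Lemma bump0_cvg c : 0 < c -> bump 0 (n%:R * c) @[n --> \oo] --> (1 : R).
Proof.
move=> c0; have : expR (- ((n%:R * c)^-1)) @[n --> \oo] --> (1 : R).
  rewrite -[X in _ --> X](expR0 R); apply: continuous_cvg; first exact: continuous_expR.
  rewrite -[X in _ --> X]oppr0; apply: cvgN; apply/gtr0_cvgV0.
    by near=> n; rewrite mulr_gt0// ltr0n; near: n; exact: nbhs_infty_gt.
  under eq_fun do rewrite mulrC.
  apply/cvgryPgt => A; near=> n; rewrite -ltr_pdivrMl//; near: n.
  exact: cvgry_gt cvgr_idn _.
apply: cvg_trans; apply: near_eq_cvg; near=> n; rewrite bump_gt0 ?expr0 ?mul1r//.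
by rewrite mulr_gt0// ltr0n; near: n; exact: nbhs_infty_gt.
Unshelve. all: by end_near. Qed.

Lemma plateau_cvg a b x : a < x < b -> plateau a b n x @[n --> \oo] --> (1 : R).
Proof.
move=> /andP[ax xb]; rewrite -[X in _ --> X]mulr1; apply: cvgM.
  under eq_fun do rewrite -mulrBr.
  by apply: bump0_cvg; rewrite subr_gt0.
under eq_fun do rewrite mulNr addrC -mulrBr.
by apply: bump0_cvg; rewrite subr_gt0.
Qed.

End Derivatives.

(** * Weak derivatives and absolutely continuous primitives *)

Section WeakDerivatives.
Variables (R : realType) (l : R).
Hypothesis l_ge0 : 0 <= l.
Local Notation mu := (@lebesgue_measure R).
Local Notation D := (`]0, l[%classic : set R).
Implicit Types (f g h phi : R -> R) (a b c x y z : R).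
Local Notation intble := (intble l).
Local Notation Int := (Int l).
Local Notation aeq := (aeq l).
Local Notation ac := (ac l).
Local Hint Extern 0 (measurable _) => exact: measurable_D : core.

(** Sobolev embedding of H^1 into the bounded functions. Since (f^2)' = 2 f g, the difference f(x)^2
    - f(y)^2 is at most the squared H^1 norm; integration over y gives the bound. *)
Lemma ac_sqr_bound f g x : ac f g -> L2 l g -> 0 <= x <= l ->
  l * f x ^+ 2 <= (1 + l) * (Int (fun y => f y ^+ 2) + Int (fun y => g y ^+ 2)).
Proof.
move=> h Lg xl; have Lf := ac_L2 l_ge0 h.
have h2 := acM l_ge0 h h; have i2 := h2.1.
set k := fun y => g y * f y + f y * g y in h2 i2.
set E := Int _ + Int _.
have E0 : 0 <= E by rewrite addr_ge0// Int_ge0// => y _; rewrite sqr_ge0.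
have bnd y : 0 <= y <= l -> f x ^+ 2 - f y ^+ 2 <= E.
  move=> yl; rewrite !expr2; have /= -> := acE h2 xl; have /= -> := acE h2 yl; rewrite opprD addrACA subrr add0r.
  rewrite -IntB; [|exact: intble_chi|exact: intble_chi].
  rewrite /E -IntD; [|exact: L2_sqr|exact: L2_sqr].
  apply: le_Int => [||z _].
  - by apply: intbleB; exact: intble_chi.
  - by apply: intbleD; exact: L2_sqr.
  - have : `|2 * (f z * g z)| <= f z ^+ 2 + g z ^+ 2.
      rewrite ler_norml; have := sqr_ge0 (f z - g z); have := sqr_ge0 (f z + g z).
      by rewrite !expr2 => *; apply/andP; split; lra.
    rewrite ler_norml /k /chi => /andP[]; case: (z < x); case: (z < y) => /=; lra.
have {}bnd : Int (fun y => f x ^+ 2) <= Int (fun y => f y ^+ 2 + E).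
  apply: le_Int => [||y /itv_oo_cc/bnd]; last by lra.
  - exact: intble_cst.
  - by apply: intbleD; [exact: L2_sqr|exact: intble_cst].
move: bnd; rewrite IntD; [|exact: L2_sqr|exact: intble_cst].
rewrite !Int_cst// => bnd.
have : Int (fun y => f y ^+ 2) <= E by rewrite /E lerDl Int_ge0// => y _; rewrite sqr_ge0.
by lra.
Qed.

Lemma ac_derive_cc f f' : (forall x, 0 <= x <= l -> is_derive x 1 f (f' x)) ->
  {within `[0, l], continuous f'} -> ac f f'.
Proof.
move=> df cf'.
have [c _ fc] := continuous_bounded cf'.
have i' : intble f'.
  by apply: (intble_bound (continuous_meas cf')) => x /itv_oo_cc xl; exact: fc xl.
split => // x /andP[x0 xl].
have [x_eq0|x_neq0] := eqVneq x 0.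
  by rewrite x_eq0 set_itv_ge ?Rintegral_set0 ?addr0// bnd_simp ltxx.
have {}x0 : 0 < x by rewrite lt_neqAle eq_sym x_neq0.
have cw : {within `[0, x], continuous f'}.
  apply: continuous_subspaceW cf' => y; rewrite /= !in_itv/= => /andP[-> yx].
  exact: le_trans yx xl.
have ix : mu.-integrable `[0, x] (EFin \o f').
  by apply: continuous_compact_integrable => //; exact: segment_compact.
have cf y : 0 <= y <= l -> {for y, continuous f} by move=> yl; exact: is_derive_cont (df y yl).
have dF : derivable_oo_LRcontinuous f 0 x.
  split.
  + move=> y; rewrite in_itv/= => /andP[y0 yx]; have [] // := df y.
    by rewrite (ltW y0) (le_trans (ltW yx)).
  + by apply: cvg_at_right_filter; apply: cf; rewrite lexx.
  + by apply: cvg_at_left_filter; apply: cf; rewrite (ltW x0).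
have dE : {in `]0, x[, derive1 f =1 f'}.
  move=> y; rewrite in_itv/= => /andP[y0 yx]; rewrite derive1E.
  by apply: derive_val; apply: df; rewrite (ltW y0) (le_trans (ltW yx)).
have FT : \int[mu]_(y in `[0, x]) f' y = f x - f 0.
  by rewrite /Rintegral (continuous_FTC2 x0 cw dF dE).
rewrite Rintegral_itv_bndo_bndc; last first.
  by apply: integrableS ix; [exact: measurable_itv|exact: measurable_itv|exact: subset_itv_oo_cc].
rewrite Rintegral_itv_obnd_cbnd; last first.
  by apply: integrableS ix; [exact: measurable_itv|exact: measurable_itv|exact: subset_itv_oc_cc].
by rewrite FT addrC subrK.
Qed.

Lemma ac_derive f f' : (forall x, is_derive x 1 f (f' x)) ->
  (forall x, {for x, continuous f'}) -> ac f f'.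
Proof.
by move=> df cf'; apply: ac_derive_cc; exact: continuous_subspaceT.
Qed.

Lemma test_derive phi : test_function l phi -> forall x, is_derive x 1 phi (derive1 phi x).
Proof.
by move=> [dphi _] x; rewrite derive1E; apply: derivableP; exact: (dphi 0%N).
Qed.

Lemma test_ac phi : test_function l phi -> ac phi (derive1 phi).
Proof.
move=> tphi; apply: ac_derive; first exact: test_derive.
move=> x; have d1 : derivable (derive1 phi) x 1 by have := tphi.1 1%N x; rewrite derive1n1.
by apply: differentiable_continuous; exact/derivable1_diffP.
Qed.

Lemma test_out phi x : test_function l phi -> ~ D x -> phi x = 0.
Proof.
move=> [_ [a [b [a0 bl out]]]] nD; apply: out => /andP[ax xb]; apply: nD.
by rewrite /= in_itv/= (lt_le_trans a0 ax) (le_lt_trans xb bl).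
Qed.

Lemma test_0 phi : test_function l phi -> phi 0 = 0.
Proof. by move=> tphi; apply: test_out => //; rewrite /= in_itv/= ltxx. Qed.

Lemma test_l phi : test_function l phi -> phi l = 0.
Proof. by move=> tphi; apply: test_out => //; rewrite /= in_itv/= ltxx andbF. Qed.

Lemma intble_test h phi : intble h -> test_function l phi -> intble (fun x => h x * phi x).
Proof.
by move=> ih /test_ac tphi; under eq_fun do rewrite mulrC; exact: ac_intbleM tphi ih.
Qed.

Lemma intble_dtest h phi : intble h -> test_function l phi ->
  intble (fun x => h x * derive1 phi x).
Proof.
move=> ih tphi; under eq_fun do rewrite mulrC.
have cw : {within `[0, l], continuous (derive1 phi)}.
  apply: continuous_subspaceT => x.
  have d1 : derivable (derive1 phi) x 1 by have := tphi.1 1%N x; rewrite derive1n1.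
  by apply: differentiable_continuous; exact/derivable1_diffP.
have [c _ fc] := continuous_bounded cw.
by apply: (intble_mulbound (continuous_meas cw)) ih => x /itv_oo_cc xl; exact: fc xl.
Qed.

Lemma ac_is_wderiv F f g : ac F g -> intble f -> aeq F f -> is_wderiv l f g.
Proof.
move=> hF if_ Ff phi tphi; have tac := test_ac tphi.
have := ac_by_parts l_ge0 hF tac; rewrite (test_0 tphi) (test_l tphi) !mulr0 subrr.
rewrite IntD; [|exact: intble_test hF.1 tphi|exact: ac_intbleM hF tac.1].
move=> /eqP; rewrite addr_eq0 => /eqP E.
rewrite [in RHS](_ : Rintegral _ _ _ = Int (fun x => g x * phi x))// E opprK.
rewrite [LHS](_ : _ = Int (fun x => f x * derive1 phi x))//.
apply: eq_Int_ae.
- exact: (intble_meas (intble_dtest if_ tphi)).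
- exact: (intble_meas (ac_intbleM l_ge0 hF tac.1)).
by apply: ae_impl Ff => x + xD => /(_ xD) ->.
Qed.

(** Lebesgue differentiation recovers [h] from its primitive at almost every point. *)
Lemma prim_zero_ae h : intble h ->
  (forall x, 0 <= x <= l -> Int (fun y => chi x y * h y) = 0) -> aeq h (cst 0).
Proof.
move=> ih H0.
pose k := h \_ D; have ik : mu.-integrable setT (EFin \o k) := intble_patch ih.
have kS (A : set R) : measurable A -> mu.-integrable A (EFin \o k).
  by move=> mA; apply: integrableS ik.
have F1 := @FTC1Ny R k (fun y => kS _ (measurable_itv _)) (integrable_locally (measurable_D l) ih).
have F0 y : 0 <= y <= l -> \int[mu]_(t in `]-oo, y]) k t = 0.
  move=> yl; rewrite -Rintegral_itv_bndo_bndc; last by apply: kS; exact: measurable_itv.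
  rewrite -(H0 y yl) /Int Rintegral_mkcond [RHS]Rintegral_mkcond; apply: eq_Rintegral => t _.
  rewrite /k /patch !mem_setE !in_itv/= /chi.
  by case: ltP => _; case: (_ && _) => //; rewrite ?mul1r ?mul0r.
apply: ae_impl F1 => x /= [_ Fk] xD.
have -> : h x = k x by rewrite /k /patch mem_setE xD.
rewrite -Fk.
have cst0 : is_derive x 1 (fun y => \int[mu]_(t in `]-oo, y]) k t) 0.
  apply: (@near_eq_is_derive _ _ _ (cst 0)).
  move: xD; rewrite in_itv/= => /andP[x0 xl].
  near=> y; rewrite F0//; apply/andP; split; apply/ltW; near: y.
    exact: lt_nbhsr.
  exact: lt_nbhsl.
by rewrite derive1E; exact: derive_val.
Unshelve. all: by end_near. Qed.

(** Testing with [plateau a b n], dominated convergence shows that [h] has integral zero over every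
    (a,b) strictly inside (0,l). So its primitive is constant inside, and the constant is 0 by
    continuity at 0. *)
Lemma fund_lemma h : intble h -> (forall phi, test_function l phi -> Int (fun x => h x * phi x) = 0) ->
  aeq h (cst 0).
Proof.
move=> ih H; apply: prim_zero_ae => //.
pose A x := Int (fun y => chi x y * h y).
have acA : ac A h.
  apply: acP => // x xl; rewrite /A [X in _ = X + _](_ : _ = 0) ?add0r//.
  rewrite -[RHS](Int0 l); apply: eq_Int => y; rewrite /= in_itv/= => /andP[/ltW y0 _].
  by rewrite chi0// mul0r.
have Acc a b : 0 < a -> a < b -> b < l -> A a = A b.
  move=> a0 ab bl; apply/eqP; rewrite eq_sym -subr_eq0 /A -IntB; [|exact: intble_chi|exact: intble_chi].
  pose w x := chi b x * h x - chi a x * h x.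
  have iw : intble w by apply: intbleB; exact: intble_chi.
  have cv : {ae mu, forall x, D x -> (h x * plateau a b n x)%:E @[n --> \oo] --> (w x)%:E}.
    have : {ae mu, forall x, x != a}.
      exists [set a]; split => //; first exact: lebesgue_measure_set1.
      by move=> x /= /negP; rewrite negbK => /eqP.
    apply: ae_impl => x xa Dx; apply: cvg_EFin; first by near=> n.
    rewrite /w/=; have [bx|xb] := leP b x.
      rewrite !chi0 ?(le_trans (ltW ab))// !mul0r subrr.
      under eq_fun do rewrite plateau_out ?mulr0 ?ltNge ?bx ?andbF//.
      exact: cvg_cst.
    have [xa'|ax] := ltP x a.
      rewrite !chi1// subrr.
      under eq_fun do rewrite plateau_out ?mulr0 ?ltNge ?(ltW xa')//.
      exact: cvg_cst.
    rewrite chi1// chi0// mul1r mul0r subr0 -[X in _ --> X]mulr1.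
    apply: (@cvgM _ _ _ _ (fun=> h x) (fun n => plateau a b n x)); first exact: cvg_cst.
    by apply: plateau_cvg; rewrite xb andbT lt_neqAle ax eq_sym xa.
  have tn n : test_function l (plateau a b n) by exact: plateau_test.
  have [] := @dominated_convergence _ _ _ mu D (measurable_D l)
    (fun n x => (h x * plateau a b n x)%:E) (EFin \o w) (EFin \o (fun x => `|h x|)).
  - by move=> n; apply/measurable_EFinP; exact: (intble_meas (intble_test ih (tn n))).
  - by apply/measurable_EFinP; exact: intble_meas iw.
  - exact: cv.
  - exact: intble_abs.
  - apply: aeW => x n Dx /=; rewrite lee_fin normrM ler_piMr//.
    by rewrite ger0_norm; have /andP[] := plateau_bound a b n x.
  move=> _ _; rewrite (_ : (fun n => _) = cst 0%E); last first.
    apply/funext => n /=; rewrite (_ : integral _ _ _ = (Int (fun x => h x * plateau a b n x))%:E).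
      by rewrite H.
    by rewrite -EFin_Int//; exact: intble_test.
  move=> c0; have c1 : (fun _ : nat => 0%E : \bar R) @ \oo --> (0%E : \bar R) by exact: cvg_cst.
  have := @cvg_unique _ (@ereal_hausdorff R) _ (fmap_proper_filter _ _) _ _ c0 c1.
  rewrite (_ : integral _ _ _ = (Int w)%:E); last by rewrite -EFin_Int.
  by move=> E; apply/eqP; apply: EFin_inj; exact: E.
have cA := ac_continuous l_ge0 acA.
have A0 : A 0 = 0.
  rewrite -[RHS](Int0 l); apply: eq_Int => y; rewrite /= in_itv/= => /andP[/ltW y0 _].
  by rewrite chi0// mul0r.
have [l0|l_neq0] := eqVneq l 0.
  by move=> x /andP[x0]; rewrite {1}l0 => xl; have -> : x = 0 by lra.
have l_gt0 : 0 < l by rewrite lt_neqAle eq_sym l_neq0.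
have [_ cA0 cAl] := (continuous_within_itvP _ l_gt0).1 cA.
pose c := A (l / 2).
have Ac x : 0 < x < l -> A x = c.
  move=> /andP[x0 xl]; rewrite /c; case: (ltgtP x (l / 2)) => [xl2|xl2|-> //].
    by apply: Acc => //; lra.
  by apply/esym/Acc => //; lra.
have c0 : c = 0.
  rewrite -A0; apply: (@cvg_unique _ (@Rhausdorff R) (A x @[x --> 0^'+])) => //.
  apply: cvg_near_cst; near=> x; rewrite Ac//.
  by apply/andP; split; near: x; [exact: nbhs_right_gt|exact: nbhs_right_lt].
move=> x /andP[]; rewrite le_eqVlt => /predU1P[<- //|x0].
rewrite le_eqVlt => /predU1P[->|xl]; last by rewrite -/(A x) Ac ?x0.
rewrite -/(A l) -c0; apply: (@cvg_unique _ (@Rhausdorff R) (A x @[x --> l^'-])) => //.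
apply: cvg_near_cst; near=> y; rewrite Ac//.
by apply/andP; split; near: y; [exact: nbhs_left_gt|exact: nbhs_left_lt].
Unshelve. all: by end_near. Qed.

(** The zero integral makes the primitive vanish also to the right of the support of [k]. *)
Lemma test_prim k : test_function l k -> Int k = 0 ->
  exists2 phi, test_function l phi & derive1 phi = k.
Proof.
move=> tk k0; have ack := test_ac tk; have ik := L2_intble (ac_L2 l_ge0 ack).
have kD : k \_ D = k.
  apply/funext => x; rewrite /patch; case: ifPn => // /negP xD.
  by rewrite (test_out tk)// => Dx; apply: xD; rewrite inE.
have iT : mu.-integrable setT (EFin \o k) by rewrite -kD; exact: intble_patch.
have kS (A : set R) : measurable A -> mu.-integrable A (EFin \o k).
  by move=> mA; apply: integrableS iT.
pose phi x := \int[mu]_(t in `]-oo, x]) k t.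
have dphi x : is_derive x 1 phi (k x).
  have x1 : x < x + 1 by rewrite ltrDl.
  have ck : {for x, continuous k} := is_derive_cont (test_derive tk x).
  have [d1 <-] := @continuous_FTC1 R k -oo%O x _ x1 (kS _ (measurable_itv _)) (ltNyr x) ck.
  by rewrite derive1E; exact: derivableP.
exists phi; last exact: derive1_fun.
have [dk [a [b [a0 bl out]]]] := tk.
split.
  apply/smthP; case=> [//|n]; exists k => //; exact: (smthP k).2 dk n.
exists a, b; split => // x /negP; rewrite negb_and -!ltNge => /orP[xa|bx].
  rewrite /phi Rintegral_mkcond -[RHS](@Rintegral_set0 _ _ _ mu k) [RHS]Rintegral_mkcond.
  apply: eq_Rintegral => t _; rewrite /patch in_set0 mem_setE in_itv/=.
  case: ifPn => // tx; rewrite out// => /andP[at_ _].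
  by have := le_lt_trans (le_trans at_ tx) xa; rewrite ltxx.
rewrite -k0 /phi /Int Rintegral_mkcond [RHS]Rintegral_mkcond kD.
apply: eq_Rintegral => t _; rewrite /patch mem_setE in_itv/=.
case: ifPn => //; rewrite -ltNge => xt; rewrite out// => /andP[_ tb].
by have := lt_le_trans (lt_trans bx xt) tb; rewrite ltxx.
Qed.

Lemma test_unit : 0 < l -> exists2 rho, test_function l rho & Int rho = 1.
Proof.
move=> l_gt0; pose p := plateau (l / 3) (2 * l / 3) 1.
have tp : test_function l p by apply: plateau_test; lra.
have ip := L2_intble (ac_L2 l_ge0 (test_ac tp)).
have p0 x : 0 <= p x by have /andP[] := plateau_bound (l / 3) (2 * l / 3) 1 x.
have Ip : Int p != 0.
  apply/eqP => Ip0; have := Int_eq0_ae ip (fun x _ => p0 x) Ip0.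
  move=> [N [mN N0 sub]].
  (* On this interval [p] is positive, so it would lie in the null set where [p] differs from 0. *)
  pose J : set R := `]l / 3, 2 * l / 3[%classic.
  have : (mu J <= mu N)%E.
    apply: le_measure; [by rewrite inE; exact: measurable_itv|by rewrite inE|].
    move=> x; rewrite /J /= in_itv/= => /andP[lx xl]; apply: sub => /=.
    rewrite in_itv/= => /(_ _); have -> : (0 < x < l) by apply/andP; split; lra.
    move=> /(_ isT) /eqP; rewrite /p /plateau !mul1r mulN1r mulf_eq0 !bump_gt0 ?expr0 ?mul1r; [|lra|lra].
    by rewrite !gt_eqF ?expR_gt0.
  rewrite N0 /J lebesgue_measure_itv/= lte_fin; case: ifPn => [_|]; last by rewrite -leNgt => ?; exfalso; lra.
  by rewrite -EFinD lee_fin; lra.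
exists (fun x => (Int p)^-1 * p x); last by rewrite IntZ// mulVf.
have [dp [a [b [a0 bl out]]]] := tp; split; last first.
  by exists a, b; split => // x /out ->; rewrite mulr0.
by apply/smthP => n; apply: smthZ; exact: (smthP p).2 dp n.
Qed.

Lemma testZD phi psi c : test_function l phi -> test_function l psi ->
  test_function l (fun x => phi x - c * psi x).
Proof.
move=> [d1 [a1 [b1 [a10 b1l out1]]]] [d2 [a2 [b2 [a20 b2l out2]]]]; split.
  have -> : (fun x => phi x - c * psi x) = (fun x => phi x + (- c) * psi x).
    by apply/funext => x; rewrite mulNr.
  by apply/smthP => n; apply: smthD; [exact: (smthP _).2 d1 n|apply: smthZ; exact: (smthP _).2 d2 n].
exists (Num.min a1 a2), (Num.max b1 b2); split; [by rewrite lt_min a10|by rewrite gt_max b1l|].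
move=> x; rewrite ge_min le_max => nx; rewrite out1 ?out2 ?mulr0 ?subrr//.
  by move=> /andP[h1 h2]; apply: nx; rewrite h1 h2 !orbT.
by move=> /andP[h1 h2]; apply: nx; rewrite h1 h2.
Qed.

(** Du Bois-Reymond: subtracting the primitive [G] of [g] leaves [h] with zero weak derivative. Any
    test function minus its integral times [rho] is the derivative of a test function, hence
    orthogonal to [h]; so [h - c] is orthogonal to all test functions. *)
Lemma wderiv_ac f g : 0 < l -> intble f -> intble g -> is_wderiv l f g ->
  exists2 F, ac F g & aeq F f.
Proof.
move=> l_gt0 if_ ig wd; pose G x := Int (fun y => chi x y * g y).
have acG : ac G g.
  apply: acP => // x xl; rewrite /G [X in _ = X + _](_ : _ = 0) ?add0r//.
  rewrite -[RHS](Int0 l); apply: eq_Int => y; rewrite /= in_itv/= => /andP[/ltW y0 _].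
  by rewrite chi0// mul0r.
have iG : intble G := L2_intble (ac_L2 l_ge0 acG).
pose h x := f x - G x; have ih : intble h by exact: intbleB.
have Gw : is_wderiv l G g by apply: (ac_is_wderiv acG iG); exact: aeW.
have hd phi : test_function l phi -> Int (fun x => h x * derive1 phi x) = 0.
  move=> tphi; rewrite /h; under eq_Int do rewrite mulrBl.
  rewrite IntB; [|exact: intble_dtest|exact: intble_dtest].
  by rewrite /Int wd// Gw// subrr.
have [rho trho rho1] := test_unit l_gt0.
have irho := L2_intble (ac_L2 l_ge0 (test_ac trho)).
pose c := Int (fun x => h x * rho x).
have hc0 : aeq (fun x => h x - c) (cst 0).
  apply: fund_lemma => [|psi tpsi]; first by apply: intbleB => //; exact: intble_cst.
  have ipsi := L2_intble (ac_L2 l_ge0 (test_ac tpsi)).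
  have [phi tphi dphi] : exists2 phi, test_function l phi & derive1 phi = fun x => psi x - Int psi * rho x.
    by apply: test_prim; [exact: testZD|rewrite IntB ?IntZ ?rho1 ?mulr1 ?subrr//; exact: intbleZ].
  have := hd phi tphi; rewrite dphi; under eq_Int do rewrite mulrBr mulrCA.
  rewrite IntB; [|exact: intble_test|by apply: intbleZ; exact: intble_test].
  rewrite IntZ; last exact: intble_test.
  move=> E; under eq_Int do rewrite mulrBl.
  rewrite IntB; [|exact: intble_test|exact: intbleZ].
  by rewrite IntZ// mulrC.
exists (fun x => G x + c).
  have := acD acG (ac_cst l c).
  by under [X in ac _ X -> _]eq_fun do rewrite addr0.
by apply: ae_impl hc0 => x + xD => /(_ xD)/=; rewrite /h; lra.
Qed.

End WeakDerivatives.

(** * Continuous representatives and differentiable curves in H^1 *)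

Section SobolevRepresentatives.
Variables (R : realType) (l : R).
Hypothesis l_gt0 : 0 < l.
Let l_ge0 : 0 <= l := ltW l_gt0.
Local Notation mu := (@lebesgue_measure R).
Local Notation D := (`]0, l[%classic : set R).
Implicit Types (f g h phi : R -> R) (a b c x y z : R).
Local Notation intble := (intble l).
Local Notation Int := (Int l).
Local Notation aeq := (aeq l).
Local Notation ac := (ac l).
Local Hint Extern 0 (measurable _) => exact: measurable_D : core.

Lemma wderivE f g phi : is_wderiv l f g -> test_function l phi ->
  Int (fun x => f x * derive1 phi x) = - Int (fun x => g x * phi x).
Proof. by move=> /[apply]. Qed.

Lemma wderiv_uniq f g1 g2 : intble g1 -> intble g2 ->
  is_wderiv l f g1 -> is_wderiv l f g2 -> aeq g1 g2.
Proof.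
move=> i1 i2 w1 w2.
suff : aeq (fun x => g1 x - g2 x) (cst 0).
  by apply: ae_impl => x + xD => /(_ xD)/= /eqP; rewrite subr_eq0 => /eqP.
apply: fund_lemma => // [|phi tphi]; first exact: intbleB.
under eq_Int do rewrite mulrBl.
rewrite IntB; [|exact: intble_test|exact: intble_test].
by rewrite -[X in X - _]opprK -(wderivE w1 tphi) (wderivE w2 tphi) opprK subrr.
Qed.

Lemma is_wderiv_ae f1 f2 g : intble f1 -> intble f2 -> aeq f1 f2 ->
  is_wderiv l f1 g -> is_wderiv l f2 g.
Proof.
move=> i1 i2 f12 w phi tphi; rewrite -[RHS](wderivE w tphi); apply: eq_Int_ae.
- by apply: (@intble_meas _ l); exact: intble_dtest.
- by apply: (@intble_meas _ l); exact: intble_dtest.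
by apply: ae_impl f12 => x + xD => /(_ xD) ->.
Qed.

(** The value that [xget] chooses is determined only almost everywhere; this is how a concrete weak
    derivative is substituted for it. *)
Lemma wderivP f g : L2 l g -> is_wderiv l f g ->
  [/\ L2 l (wderiv l f), is_wderiv l f (wderiv l f) & aeq (wderiv l f) g].
Proof.
move=> Lg wg; have [L w] : [set g | L2 l g /\ is_wderiv l f g] (wderiv l f).
  by apply: xgetPex; exists g.
by split => //; apply: wderiv_uniq w wg; exact: L2_intble.
Qed.

Lemma Hk1P f : Hk l 1 f ->
  [/\ L2 l f, L2 l (wderiv l f) & is_wderiv l f (wderiv l f)].
Proof. by move=> [Lf [g [wg Lg]]]; have [] := wderivP Lg wg. Qed.

Lemma Hk1_intro f g : L2 l f -> L2 l g -> is_wderiv l f g -> Hk l 1 f.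
Proof. by move=> Lf Lg wg; split => //; exists g. Qed.

Lemma Hk1_ae f1 f2 : Hk l 1 f1 -> L2 l f2 -> aeq f1 f2 ->
  Hk l 1 f2 /\ aeq (wderiv l f1) (wderiv l f2).
Proof.
move=> /Hk1P[L1 Lg w1] L2f f12; have w2 := is_wderiv_ae (L2_intble L1) (L2_intble L2f) f12 w1.
split; first exact: Hk1_intro Lg w2.
by have [_ _ /aeq_sym] := wderivP Lg w2.
Qed.

Lemma Hk2P f : Hk l 2 f -> Hk l 1 f /\ Hk l 1 (wderiv l f).
Proof.
move=> [Lf [g [wg Hg]]]; have [Lg _ _] := Hk1P Hg.
have H1 := Hk1_intro Lf Lg wg; split => //.
have [_ Ld _] := Hk1P H1; have [_ _ e] := wderivP Lg wg.
by have [] := Hk1_ae Hg Ld (aeq_sym e).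
Qed.

(** If the functions differ at one point of [0,l], endpoints included, they differ on an interval of
    positive length inside (0,l). *)
Lemma within_ae_eq h1 h2 : {within `[0, l], continuous h1} ->
  {within `[0, l], continuous h2} -> aeq h1 h2 -> forall x, 0 <= x <= l -> h1 x = h2 x.
Proof.
move=> c1 c2 [N [mN N0 sub]] x /andP[x0 xl]; apply/eqP; rewrite -subr_eq0; apply/negP => /negP hx.
pose h y := h1 y - h2 y.
have ch : {within `[0, l], continuous h} by exact: within_continuousB.
have [r r0 rP] : exists2 r : R, 0 < r & forall y, 0 <= y <= l -> `|y - x| < r -> h y != 0.
  have /cvgrPdist_lt/(_ `|h x|) := ch x; rewrite normr_gt0 => /(_ hx).
  rewrite /nbhs/= /nbhs_subspace/=; case: ifPn => [_|]; last by rewrite notin_setE/= in_itv/= x0 xl.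
  rewrite /within/= => /nbhs_ballP[r /= r0 H]; exists r => // y yl yx.
  have := H y; rewrite /ball/= distrC => /(_ yx); rewrite in_itv/= => /(_ yl).
  by rewrite /from_subspace; apply: contraTneq => ->; rewrite subr0 ltxx.
pose a := Num.max 0 (x - r); pose b := Num.min l (x + r).
have ab : a < b.
  by rewrite /a /b gt_max !lt_min l_gt0/=; apply/and3P; split; try lra; apply/andP; split; lra.
pose J : set R := `]a, b[%classic.
have : (mu J <= mu N)%E.
  apply: le_measure; [by rewrite inE; exact: measurable_itv|by rewrite inE|].
  move=> y; rewrite /J /= in_itv/= /a /b gt_max lt_min => /andP[/andP[y0 xy] /andP[yl yx]].
  apply: sub => /= /(_ _)/eqP; rewrite in_itv/= y0 yl => /(_ isT); rewrite -subr_eq0; apply/negP.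
  by apply: rP; [rewrite !ltW|rewrite ltr_norml; apply/andP; split; lra].
rewrite N0 /J lebesgue_measure_itv/= lte_fin ab -EFinD lee_fin; lra.
Qed.

Lemma cont_repE f F g : ac F g -> aeq F f ->
  (forall x, 0 <= x <= l -> cont_rep l f x = F x) /\ ac (cont_rep l f) g.
Proof.
move=> hF Ff; have cF := ac_continuous l_ge0 hF.
have [c e] : [set g | {within `[0, l], continuous g} /\ aeq g f] (cont_rep l f).
  by apply: xgetPex; exists F.
have E x : 0 <= x <= l -> cont_rep l f x = F x.
  by apply: within_ae_eq => //; exact: aeq_trans e (aeq_sym Ff).
by split => //; apply: (ac_eq hF l_ge0) => // x xl; rewrite E.
Qed.

Lemma H1_rep f : Hk l 1 f -> ac (cont_rep l f) (wderiv l f) /\ aeq (cont_rep l f) f.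
Proof.
move=> /Hk1P[Lf Lg wg].
have [F hF Ff] := wderiv_ac l_ge0 l_gt0 (L2_intble Lf) (L2_intble Lg) wg.
have [E hc] := cont_repE hF Ff; split => //.
by apply: ae_impl Ff => x + xD => /(_ xD) <-; rewrite E// itv_oo_cc.
Qed.

Definition H1sq f := Int (fun x => f x ^+ 2) + Int (fun x => wderiv l f x ^+ 2).

Lemma H1sq_ge0 f : 0 <= H1sq f.
Proof. by rewrite addr_ge0// Int_ge0// => x _; rewrite sqr_ge0. Qed.

Lemma Hk_norm1E f : Hk l 1 f -> Hk_norm l 1 f = (Num.sqrt (H1sq f))%:E.
Proof.
move=> /Hk1P[Lf Lg _]; rewrite /Hk_norm /Hk_normsq big_ord_recl big_ord1/=.
rewrite (EFin_Int (L2_sqr Lf)) (EFin_Int (L2_sqr Lg)) -EFinD poweR_EFin.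
by rewrite powR12_sqrt// H1sq_ge0.
Qed.

Lemma H1_lin a b f g (k := fun x => a * f x + b * g x) : Hk l 1 f -> Hk l 1 g ->
  Hk l 1 k /\ aeq (wderiv l k) (fun x => a * wderiv l f x + b * wderiv l g x).
Proof.
move=> /Hk1P[Lf Lf' wf] /Hk1P[Lg Lg' wg].
have Lk : L2 l k by apply: L2D; exact: L2Z.
have Lk' : L2 l (fun x => a * wderiv l f x + b * wderiv l g x) by apply: L2D; exact: L2Z.
suff wk : is_wderiv l k (fun x => a * wderiv l f x + b * wderiv l g x).
  by split; [exact: Hk1_intro Lk' wk|have [] := wderivP Lk' wk].
move=> phi tphi.
have [if_ ig] := (L2_intble Lf, L2_intble Lg); have [if' ig'] := (L2_intble Lf', L2_intble Lg').
rewrite [LHS](_ : _ = Int (fun x => a * (f x * derive1 phi x) + b * (g x * derive1 phi x))); last first.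
  by apply: eq_Int => x _; rewrite /k mulrDl !mulrA.
rewrite [X in _ = - X](_ : _ = Int (fun x => a * (wderiv l f x * phi x) + b * (wderiv l g x * phi x))); last first.
  by apply: eq_Int => x _; rewrite mulrDl !mulrA.
rewrite !IntD; try by apply: intbleZ; first [exact: intble_dtest | exact: intble_test].
rewrite !IntZ; try by first [exact: intble_dtest | exact: intble_test].
by rewrite (wderivE wf tphi) (wderivE wg tphi) opprD !mulrN.
Qed.

Section TimeDerivative.
Variables u ut : R -> R -> R.
Hypothesis u_H1 : forall t : R, 0 <= t -> Hk l 1 (u t).
Hypothesis ut_H1 : forall t : R, 0 <= t -> Hk l 1 (ut t).
Hypothesis u_ut : is_time_deriv l u ut.

Lemma time_deriv_H1sq (t e : R) : 0 < t -> 0 < e ->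
  exists2 r : R, 0 < r & forall k : R, `|k| < r -> k != 0 -> 0 < t + k /\
    H1sq (fun x => (u (t + k) x - u t x) / k - ut t x) <= e.
Proof.
move=> t0 e0; have /fine_cvgP[_ /cvgrPdist_lt/(_ (Num.sqrt e))] := u_ut (ltW t0).
rewrite sqrtr_gt0 => /(_ e0); rewrite /within/= /dnbhs => /nbhs_ballP[r /= r0 H].
exists (Num.min r t); first by rewrite lt_min r0.
move=> k; rewrite lt_min => /andP[kr]; rewrite ltr_norml => /andP[kt _] k0.
have tk : 0 < t + k by rewrite addrC -ltrBlDr sub0r.
split => //; have := H (t + k); rewrite /ball/= opprD addNKr normrN => /(_ kr).
have -> : t + k != t by rewrite -subr_eq0 addrC addKr.
move=> /(_ isT (ltW tk)); rewrite [t + k - t]addrC addKr.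
rewrite Hk_norm1E/=; last first.
  have [H1 _] := @H1_lin 1 (-1) _ _ (u_H1 (ltW tk)) (u_H1 (ltW t0)).
  have [H2 _] := @H1_lin k^-1 (-1) _ _ H1 (ut_H1 (ltW t0)).
  have -> : (fun x => (u (t + k) x - u t x) / k - ut t x) =
      (fun x => k^-1 * (1 * u (t + k) x + -1 * u t x) + -1 * ut t x).
    by apply/funext => x; ring.
  by [].
rewrite sub0r normrN ger0_norm ?sqrtr_ge0// ltr_sqrt// => /ltW.
by [].
Qed.

(** All differentiability in time enters here. The Sobolev bound makes the remainder small uniformly
    in x for the representatives, while for u_x it is small in L^2 only. The two conclusions serve
    [ud] and [L2_sqr_derive] respectively. *)
Lemma time_deriv_eps (t e : R) : 0 < t -> 0 < e ->
  exists2 r : R, 0 < r & forall k : R, `|k| < r ->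
  (forall x, 0 <= x <= l ->
    `|cont_rep l (u (t + k)) x - cont_rep l (u t) x - k * cont_rep l (ut t) x| <= e * `|k|)
  /\ Int (fun x => (wderiv l (u (t + k)) x - wderiv l (u t) x - k * wderiv l (ut t) x) ^+ 2)
    <= e ^+ 2 * k ^+ 2.
Proof.
move=> t0 e0.
(* Covers the factor (1 + l) / l lost in [ac_sqr_bound] for the uniform estimate, and the factor 1
   of the L^2 estimate. *)
pose M := 1 + l^-1 * (1 + l).
have li0 : 0 < l^-1 by rewrite invr_gt0.
have M1 : 1 <= M by rewrite lerDl mulr_ge0 ?invr_ge0// addr_ge0.
have M0 : 0 < M by rewrite (lt_le_trans ltr01).
have e1 : 0 < e ^+ 2 / M by rewrite divr_gt0// exprn_gt0.
have [r r0 rP] := time_deriv_H1sq t0 e1; exists r => // k kr.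
have [->|k0] := eqVneq k 0.
  split; last first.
    rewrite addr0 expr0n mulr0 le_eqVlt; apply/orP; left; apply/eqP.
    rewrite -[RHS](Int0 l); apply: eq_Int => x _.
    by rewrite mul0r subrr subr0 expr0n.
  by move=> x _; rewrite addr0 mul0r subrr subr0 normr0 mulr0.
have [tk dle] := rP k kr k0; set d := fun x => _ in dle.
have [H1 w1] := @H1_lin 1 (-1) _ _ (u_H1 (ltW tk)) (u_H1 (ltW t0)).
have [H2 w2] := @H1_lin k^-1 (-1) _ _ H1 (ut_H1 (ltW t0)).
have dE : d = (fun x => k^-1 * (1 * u (t + k) x + -1 * u t x) + -1 * ut t x).
  by apply/funext => x; rewrite /d; ring.
pose q x := wderiv l (u (t + k)) x - wderiv l (u t) x - k * wderiv l (ut t) x.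
have wq : aeq (wderiv l d) (fun x => k^-1 * q x).
  rewrite dE; apply: ae_impl2 w1 w2 => x w1 w2 xD; rewrite w2// w1// /q; field.
  exact: k0.
have [a1 e1'] := H1_rep (u_H1 (ltW tk)); have [a2 e2'] := H1_rep (u_H1 (ltW t0)).
have [a3 e3'] := H1_rep (ut_H1 (ltW t0)).
pose Q x := cont_rep l (u (t + k)) x - cont_rep l (u t) x - k * cont_rep l (ut t) x.
have aQ : ac Q q by exact: acB (acB a1 a2) (acZ k a3).
have Qd : aeq d (fun x => k^-1 * Q x).
  have Q1 : aeq (fun x => u (t + k) x - u t x) (fun x => cont_rep l (u (t + k)) x - cont_rep l (u t) x).
    by apply: ae_impl2 e1' e2' => x E1 E2 xD; rewrite E1// E2.
  apply: ae_impl2 Q1 e3' => x E1 E2 xD; rewrite /d /Q E1// -E2//; field.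
  exact: k0.
have Lq : L2 l q.
  have [_ L1 _] := Hk1P (u_H1 (ltW tk)); have [_ L_2 _] := Hk1P (u_H1 (ltW t0)).
  have [_ L3 _] := Hk1P (ut_H1 (ltW t0)).
  by apply: L2B; [exact: L2B|exact: L2Z].
have Hd : Hk l 1 d by rewrite dE.
have [Ld Lwd _] := Hk1P Hd.
have aQ' := acZ k^-1 aQ; have Lq' := L2Z k^-1 Lq; have LQ' := ac_L2 l_ge0 aQ'.
have HQ : H1sq d = Int (fun x => (k^-1 * Q x) ^+ 2) + Int (fun x => (k^-1 * q x) ^+ 2).
  rewrite /H1sq; congr (_ + _); apply: eq_Int_ae.
  - exact: intble_meas (L2_sqr Ld).
  - exact: intble_meas (L2_sqr LQ').
  - by apply: ae_impl Qd => x + xD => /(_ xD) ->.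
  - exact: intble_meas (L2_sqr Lwd).
  - exact: intble_meas (L2_sqr Lq').
  - by apply: ae_impl wq => x + xD => /(_ xD) ->.
have k20 : 0 < k ^+ 2 by rewrite exprn_even_gt0.
split => [x xl|].
  have B := ac_sqr_bound l_ge0 aQ' Lq' xl; rewrite -HQ in B.
  rewrite -/(Q x) -(@ler_pXn2r _ 2)//= ?nnegrE ?mulr_ge0// ?(ltW e0)//.
  rewrite exprMn !real_normK ?num_real//.
  have -> : Q x ^+ 2 = k ^+ 2 * (k^-1 * Q x) ^+ 2 by rewrite exprMn exprVn mulVKf// gt_eqF.
  rewrite mulrC ler_wpM2r ?(ltW k20)//.
  have {}B : (k^-1 * Q x) ^+ 2 <= l^-1 * (1 + l) * H1sq d.
    by rewrite -mulrA ler_pdivlMl.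
  rewrite (le_trans B)//.
  have l1 : 0 <= l^-1 * (1 + l) by rewrite mulr_ge0 ?(ltW li0)// addr_ge0.
  rewrite (le_trans (ler_wpM2l l1 dle))// mulrCA ler_piMr ?exprn_ge0 ?(ltW e0)//.
  by rewrite ler_pdivrMr// mul1r /M lerDr.
have E2 : Int (fun x => (k^-1 * q x) ^+ 2) <= e ^+ 2.
  rewrite (le_trans _ (le_trans dle _))//.
    by rewrite HQ lerDr Int_ge0// => x _; rewrite sqr_ge0.
  by rewrite ler_pdivrMr// ler_peMr// exprn_ge0// ltW.
rewrite [leLHS](_ : _ = k ^+ 2 * Int (fun x => (k^-1 * q x) ^+ 2)).
  by rewrite mulrC ler_wpM2r// ltW.
rewrite -IntZ; last exact: L2_sqr.
by apply: eq_Int => x _; rewrite exprMn exprVn mulVKf// gt_eqF.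
Qed.
End TimeDerivative.

End SobolevRepresentatives.

(** * Lyapunov functional and uniform decay *)

Section UniformTimeDerivative.
Variables (R : realType) (l : R).
Hypothesis l_gt0 : 0 < l.
Let l_ge0 : 0 <= l := ltW l_gt0.
Local Notation D := (`]0, l[%classic : set R).
Implicit Types (f g h d : R -> R) (v w : R -> R -> R) (a b c x y t s e k : R).
Local Notation intble := (intble l).
Local Notation Int := (Int l).
Local Notation ac := (ac l).
Local Notation cont f := ({within `[0, l], continuous f}).

Lemma cont_D f g : cont f -> cont g -> cont (fun x => f x + g x).
Proof. by move=> cf cg x; apply: cvgD; [exact: cf|exact: cg]. Qed.

Lemma cont_M f g : cont f -> cont g -> cont (fun x => f x * g x).
Proof. by move=> cf cg x; apply: cvgM; [exact: cf|exact: cg]. Qed.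

Lemma cont_cst c : cont (fun=> c).
Proof. by move=> x; exact: cvg_cst. Qed.

Lemma cont_intble f : cont f -> intble f.
Proof.
move=> cf; have [c _ fc] := continuous_bounded cf.
by apply: (intble_bound (continuous_meas cf)) => x /itv_oo_cc; exact: fc.
Qed.

Lemma cont_L2 f : cont f -> L2 l f.
Proof.
move=> cf; have [c _ fc] := continuous_bounded cf.
by apply: (L2_bound (continuous_meas cf)) => x /itv_oo_cc; exact: fc.
Qed.

(** Differentiability in time at [t], uniform over x in [0,l]: it is stable under products and
    compatible with integration in x. Continuity in x is asked at positive times only, which is
    where the remainders are expanded. *)
Definition ud t v d := [/\ forall s, 0 < s -> cont (v s), cont d &
  forall e, 0 < e -> exists2 r : R, 0 < r & forall k, `|k| < r ->
    forall x, 0 <= x <= l -> `|v (t + k) x - v t x - k * d x| <= e * `|k| ].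

Lemma ud_cst t f : cont f -> ud t (fun=> f) (fun=> 0).
Proof.
move=> cf; split => //; first exact: cont_cst.
move=> e e0; exists 1 => // k _ x _.
by rewrite subrr mulr0 subr0 normr0 mulr_ge0// ltW.
Qed.

Lemma ud_D t v w d1 d2 : ud t v d1 -> ud t w d2 ->
  ud t (fun s x => v s x + w s x) (fun x => d1 x + d2 x).
Proof.
move=> [cv cd1 dv] [cw cd2 dw]; split.
- by move=> s s0; apply: cont_D; [exact: cv|exact: cw].
- exact: cont_D.
move=> e e0; have e20 : 0 < e / 2 by rewrite divr_gt0.
have [r1 r10 h1] := dv _ e20; have [r2 r20 h2] := dw _ e20.
exists (Num.min r1 r2); first by rewrite lt_min r10.
move=> k; rewrite lt_min => /andP[k1 k2] x xl.
have := lerD (h1 k k1 x xl) (h2 k k2 x xl); rewrite -mulrDl -splitr; apply: le_trans.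
have -> : v (t + k) x + w (t + k) x - (v t x + w t x) - k * (d1 x + d2 x) =
  (v (t + k) x - v t x - k * d1 x) + (w (t + k) x - w t x - k * d2 x) by ring.
exact: ler_normD.
Qed.

Lemma ud_M t v w d1 d2 : 0 < t -> ud t v d1 -> ud t w d2 ->
  ud t (fun s x => v s x * w s x) (fun x => d1 x * w t x + v t x * d2 x).
Proof.
move=> t0 [cv cd1 dv] [cw cd2 dw]; split.
- by move=> s s0; apply: cont_M; [exact: cv|exact: cw].
- by apply: cont_D; apply: cont_M => //; [exact: cw|exact: cv].
have [A A0 hA] := continuous_bounded (cv t t0).
have [B B0 hB] := continuous_bounded (cw t t0).
have [A' A'0 hA'] := continuous_bounded cd1.
have [B' B'0 hB'] := continuous_bounded cd2.
move=> e e0.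
(* The error consists of a part at most e1 (A + B) |k| and a part at most (A' + 1) (B' + 1) |k|^2.
   [M] bounds both coefficients, and each part receives half of [e]. *)
pose M := A + B + (A' + 1) * (B' + 1) + 1.
have AB0 : 0 < (A' + 1) * (B' + 1) by rewrite mulr_gt0// ltr_wpDl.
have M0 : 0 < M by rewrite /M; lra.
pose e1 := Num.min 1 (e / (2 * M)).
have e10 : 0 < e1 by rewrite /e1 lt_min ltr01 divr_gt0// mulr_gt0.
have e11 : e1 <= 1 by rewrite /e1 ge_min lexx.
have e1M : e1 * M <= e / 2.
  have : e1 <= e / (2 * M) by rewrite /e1 ge_min lexx orbT.
  by rewrite ler_pdivlMr ?mulr_gt0// ler_pdivlMr//; lra.
have [r1 r10 h1] := dv _ e10; have [r2 r20 h2] := dw _ e10.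
exists (Num.min (e / (2 * M)) (Num.min r1 r2)).
  by rewrite !lt_min r10 r20 divr_gt0// mulr_gt0.
move=> k; rewrite !lt_min => /and3P[k0 k1 k2] x xl.
have {}h1 := h1 k k1 x xl; have {}h2 := h2 k k2 x xl.
have {}hA := hA x xl; have {}hB := hB x xl; have {}hA' := hA' x xl; have {}hB' := hB' x xl.
set p := v (t + k) x - v t x - k * d1 x in h1.
set q := w (t + k) x - w t x - k * d2 x in h2.
have kM : `|k| * M <= e / 2.
  by move: k0; rewrite ltr_pdivlMr ?mulr_gt0// ler_pdivlMr//; lra.
have -> : v (t + k) x * w (t + k) x - v t x * w t x - k * (d1 x * w t x + v t x * d2 x) =
    (v t x * q + p * w t x) + (k * d1 x + p) * (k * d2 x + q) by rewrite /p /q; ring.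
have n1 : `|k * d1 x + p| <= `|k| * (A' + 1).
  rewrite (le_trans (ler_normD _ _))// normrM mulrDr mulr1 lerD ?ler_wpM2l//.
  by rewrite (le_trans h1)// ler_piMl.
have n2 : `|k * d2 x + q| <= `|k| * (B' + 1).
  rewrite (le_trans (ler_normD _ _))// normrM mulrDr mulr1 lerD ?ler_wpM2l//.
  by rewrite (le_trans h2)// ler_piMl.
have T1 : `|v t x * q| <= A * (e1 * `|k|) by rewrite normrM ler_pM.
have T2 : `|p * w t x| <= e1 * `|k| * B by rewrite normrM ler_pM.
have T3 : `|(k * d1 x + p) * (k * d2 x + q)| <= `|k| * (A' + 1) * (`|k| * (B' + 1)).
  by rewrite normrM ler_pM.
rewrite (le_trans (ler_normD _ _))// (le_trans (lerD (ler_normD _ _) T3))//.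
rewrite (le_trans (lerD (lerD T1 T2) (lexx _)))//.
have -> : A * (e1 * `|k|) + e1 * `|k| * B + `|k| * (A' + 1) * (`|k| * (B' + 1)) =
  (e1 * (A + B) + `|k| * ((A' + 1) * (B' + 1))) * `|k| by ring.
rewrite ler_wpM2r// [leRHS]splitr lerD//.
  by rewrite (le_trans _ e1M)// ler_wpM2l ?(ltW e10)// /M; lra.
by rewrite (le_trans _ kM)// ler_wpM2l// /M; lra.
Qed.

Lemma ud_eq t v w d1 d2 : 0 < t -> ud t v d1 -> (forall s x, v s x = w s x) ->
  (forall x, d1 x = d2 x) -> ud t w d2.
Proof.
move=> _ dv vw d12; have -> : w = v by apply/funext => s; apply/funext => x; rewrite vw.
by have -> : d2 = d1 by apply/funext.
Qed.

Lemma ud_Z t a v d : 0 < t -> ud t v d -> ud t (fun s x => a * v s x) (fun x => a * d x).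
Proof.
move=> t0 dv; have H := ud_M t0 (ud_cst t (@cont_cst a)) dv.
by apply: (ud_eq t0 H) => // x; rewrite mul0r add0r.
Qed.

Lemma ud_pt t v d x : ud t v d -> 0 <= x <= l -> is_derive t 1 (fun s => v s x) (d x).
Proof.
move=> [_ _ dv] xl; apply: is_derive_eps => e e0; have [r r0 h] := dv e e0.
by exists r => // k kr; exact: h.
Qed.

Lemma ud_Int t v d : 0 < t -> ud t v d -> is_derive t 1 (fun s => Int (v s)) (Int d).
Proof.
move=> t0 [cv cd dv]; apply: is_derive_eps => e e0.
have [r r0 h] := dv (e / l) (divr_gt0 e0 l_gt0).
exists (Num.min r t); first by rewrite lt_min r0.
move=> k; rewrite lt_min ltr_norml => /andP[/andP[kr kr']]; rewrite ltr_norml => /andP[kt _].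
have kr2 : `|k| < r by rewrite ltr_norml kr.
have tk : 0 < t + k by lra.
have i1 := cont_intble (cv _ tk); have i2 := cont_intble (cv _ t0); have i3 := cont_intble cd.
rewrite -IntZ// -IntB// -IntB//; [|exact: intbleB|exact: intbleZ].
have i4 : intble (fun x => v (t + k) x - v t x - k * d x).
  by apply: intbleB; [exact: intbleB|exact: intbleZ].
rewrite (le_trans (le_abs_Int i4))//.
apply: (@le_trans _ _ (Int (fun=> e / l * `|k|))).
  by apply: le_Int => [||x /itv_oo_cc]; [exact: intble_abs|exact: intble_cst|exact: h].
by rewrite Int_cst// mulrAC divfK// gt_eqF.
Qed.

(** Meant for u_x, whose remainder [p] is small in L^2 only: the square is expanded around v + k d,
    and the terms linear in [p] are bounded by Cauchy-Schwarz. *)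
Lemma L2_sqr_derive t (v : R -> R -> R) d : 0 < t -> (forall s, 0 < s -> L2 l (v s)) -> L2 l d ->
  (forall e, 0 < e -> exists2 r : R, 0 < r & forall k, `|k| < r ->
    Int (fun x => (v (t + k) x - v t x - k * d x) ^+ 2) <= e ^+ 2 * k ^+ 2) ->
  is_derive t 1 (fun s => Int (fun x => v s x ^+ 2)) (2 * Int (fun x => v t x * d x)).
Proof.
move=> t0 Lv Ld H; apply: is_derive_eps => e e0.
pose A := Int (fun x => v t x ^+ 2); pose B := Int (fun x => d x ^+ 2).
have A0 : 0 <= A by apply: Int_ge0 => x _; exact: sqr_ge0.
have B0 : 0 <= B by apply: Int_ge0 => x _; exact: sqr_ge0.
pose M := 2 * (A + 1) + 2 * (B + 1) + 1 + B.
have M0 : 0 < M by rewrite /M; lra.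
pose e1 := Num.min 1 (e / (2 * M)).
have e10 : 0 < e1 by rewrite /e1 lt_min ltr01 divr_gt0// mulr_gt0.
have e11 : e1 <= 1 by rewrite /e1 ge_min lexx.
have e1M : e1 * M <= e / 2.
  have : e1 <= e / (2 * M) by rewrite /e1 ge_min lexx orbT.
  by rewrite ler_pdivlMr ?mulr_gt0// ler_pdivlMr//; lra.
have [r r0 h] := H _ e10; clearbody e1.
exists (Num.min e1 (Num.min r t)); first by rewrite !lt_min e10 r0.
move=> k; rewrite !lt_min => /and3P[ke kr]; rewrite ltr_norml => /andP[kt _].
have tk : 0 < t + k by lra.
have {}h := h k kr; set q := fun x => _ in h.
have L1 := Lv _ tk; have L2' := Lv _ t0.
pose p x := v (t + k) x - v t x - k * d x.
have Lp : L2 l p by apply: L2B; [exact: L2B|exact: L2Z].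
have {q}h : Int (fun x => p x ^+ 2) <= e1 ^+ 2 * k ^+ 2 by exact: h.
have cs f : L2 l f -> `|Int (fun x => f x * p x)| <= (Int (fun x => f x ^+ 2) + 1) * (e1 * `|k|).
  move=> Lf; have c := CauchySchwarz Lf Lp; set a := Int (fun x => f x ^+ 2) in c *.
  have a0 : 0 <= a by apply: Int_ge0 => x _; exact: sqr_ge0.
  have ek : 0 <= e1 * `|k| by rewrite mulr_ge0// ltW.
  apply: norm_le_sqr; first by rewrite mulr_ge0// addr_ge0.
  rewrite (le_trans c)// (le_trans (ler_wpM2l a0 h))//.
  rewrite !exprMn real_normK ?num_real//.
  have aa : a <= (a + 1) ^+ 2 by have := mulr_ge0 a0 a0; rewrite expr2; lra.
  by rewrite ler_wpM2r// mulr_ge0 ?sqr_ge0.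
rewrite [X in `|X - _ - _|](_ : _ = A + (k * (2 * Int (fun x => v t x * d x))
   + (k ^+ 2 * B + (Int (fun x => p x ^+ 2) + (2 * Int (fun x => v t x * p x) + 2 * k * Int (fun x => d x * p x)))))); last first.
  rewrite /A /B -!IntZ; try (exact: L2M || exact: L2_sqr || (apply: intbleZ; exact: L2M)).
  rewrite -!IntD; try (repeat first [exact: L2M | exact: L2_sqr | apply: intbleZ | apply: intbleD]).
  by apply: eq_Int => x _; rewrite /p; ring.
rewrite -/A; set c0 := Int (fun x => v t x * d x).
rewrite [X in `|X|](_ : _ = k ^+ 2 * B + (Int (fun x => p x ^+ 2) +
  (2 * Int (fun x => v t x * p x) + 2 * k * Int (fun x => d x * p x)))); last by ring.
have c1 := cs _ L2'; have c2 := cs _ Ld; rewrite -/A in c1; rewrite -/B in c2.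
have k1 : `|k| <= 1 by rewrite (le_trans (ltW ke)).
have p0 : 0 <= Int (fun x => p x ^+ 2) by apply: Int_ge0 => x _; exact: sqr_ge0.
rewrite (le_trans (ler_normD _ _))// (le_trans (lerD (lexx _) (ler_normD _ _)))//.
rewrite (le_trans (lerD (lexx _) (lerD (lexx _) (ler_normD _ _))))//.
rewrite !normrM (ger0_norm B0) (ger0_norm p0) (ger0_norm (ler0n _ 2)).
move: h; rewrite -[k ^+ 2]real_normK ?num_real// => h.
set K := `|k| in ke kr c1 c2 k1 h *; have K0 : 0 <= K by exact: normr_ge0.
have b1 : K * K * B <= e1 * B * K.
  by have := ler_wpM2r (mulr_ge0 B0 K0) (ltW ke); lra.
have b2 : Int (fun x => p x ^+ 2) <= e1 * K.
  by rewrite (le_trans h)// -exprMn expr2 ler_piMl ?mulr_ge0 ?(ltW e10)// mulr_ile1// ltW.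
have b3 : 2 * K * `|Int (fun x => d x * p x)| <= 2 * ((B + 1) * (e1 * K)).
  rewrite -mulrA ler_wpM2l// (le_trans (ler_wpM2l K0 c2))// ler_piMl// mulr_ge0 ?addr_ge0//.
  by rewrite mulr_ge0// ltW.
have : e1 * M * K <= e / 2 * K by rewrite ler_wpM2r.
have : e / 2 * K <= e * K by rewrite ler_wpM2r//; lra.
rewrite /M; lra.
Qed.

End UniformTimeDerivative.

Ltac pos := repeat first
  [ done | exact: ltW | exact: sqr_ge0 | by rewrite ltr0n | by rewrite ler0n
  | apply: exprn_gt0 | apply: exprn_ge0 | apply: addr_gt0 | apply: mulr_gt0
  | rewrite invr_gt0 | apply: addr_ge0 | apply: mulr_ge0 | rewrite invr_ge0 ].

(** * Monotone and integrable quantities of a scalar time variable *)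

Section ScalarDynamics.
Variable R : realType.
Implicit Types (f g Phi : R -> R) (s t e c : R).

Lemma derive_nondecr f f' (T : R) : (forall t, T <= t -> is_derive t 1 f (f' t)) ->
  (forall t, T <= t -> 0 <= f' t) -> forall s t, T <= s -> s <= t -> f s <= f t.
Proof.
move=> df f'0 s t Ts st.
have [||c] := @MVT_segment R f f' s t st.
- by move=> x; rewrite in_itv/= => /andP[sx _]; apply: df; rewrite (le_trans Ts)// ltW.
- apply: derivable_within_continuous => x; rewrite in_itv/= => /andP[sx _].
  by have [] := df x (le_trans Ts sx).
rewrite in_itv/= => /andP[sc _] E; rewrite -subr_ge0 E mulr_ge0 ?subr_ge0//.
by apply: f'0; exact: le_trans sc.
Qed.

(* [Phi + f^3 / 3] and [Phi - f^3 / 3] are both nondecreasing, so that an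
   increase of [f^3] costs an increase of the bounded function [Phi]. *)
Lemma barbalat f f' Phi Phi' (T L B : R) : 0 <= L ->
  (forall t, T <= t -> is_derive t 1 f (f' t)) ->
  (forall t, T <= t -> is_derive t 1 Phi (Phi' t)) ->
  (forall t, T <= t -> 0 <= f t) -> (forall t, T <= t -> `|f' t| <= L) ->
  (forall t, T <= t -> f t ^+ 2 <= Phi' t) -> (forall t, T <= t -> `|Phi t| <= B) ->
  forall e, 0 < e -> exists2 T', T <= T' & forall t, T' <= t -> f t <= e.
Proof.
move=> L0 df dP f0 fL fP PB e e0.
have P'0 t : T <= t -> 0 <= Phi' t by move=> Tt; rewrite (le_trans _ (fP t Tt))// sqr_ge0.
have Pmono s t : T <= s -> s <= t -> Phi s <= Phi t by exact: derive_nondecr dP P'0 s t.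
have f3 s t : T <= s -> s <= t -> f t ^+ 3 - f s ^+ 3 <= 3 * L * (Phi t - Phi s).
  move=> Ts st; pose h t := 3 * L * Phi t - f t ^+ 3.
  suff : h s <= h t by rewrite /h; lra.
  apply: (@derive_nondecr h (fun t => 3 * L * Phi' t - 3 * f t ^+ 2 * f' t) T) => //.
    move=> r Tr; apply: isd_B; first exact/isd_Z/dP.
    exact: (isd_X 3 (df r Tr)).
  move=> r Tr.
  have h1 : f r ^+ 2 * f' r <= f r ^+ 2 * L.
    by rewrite ler_wpM2l ?sqr_ge0// (le_trans (ler_norm _)) ?fL.
  by have := ler_wpM2r L0 (fP r Tr); lra.
pose S := [set Phi t | t in [set t | T <= t]].
have hS : has_sup S.
  split; first by exists (Phi T), T => //=.
  by exists B => _ [t Tt <-]; rewrite (le_trans (ler_norm _)) ?PB.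
(* Once [Phi] is within [eta] of its supremum, f^3 can increase by at most 3 L eta <= (e/2)^3. *)
pose eta := (e / 2) ^+ 3 / (3 * L + 1).
have L1 : 0 < 3 * L + 1 by rewrite ltr_wpDl// mulr_ge0.
have eta0 : 0 < eta by rewrite divr_gt0// exprn_gt0// divr_gt0.
have [_ [T0 /= TT0 <-] T0S] := sup_adherent eta0 hS.
have Peta t : T0 <= t -> Phi t - Phi T0 <= eta.
  move=> T0t; have : Phi t <= sup S by apply: sup_upper_bound => //; exists t => //=; exact: le_trans T0t.
  by move: T0S; lra.
(* Otherwise f stays above e/2 and [Phi] grows at least linearly, which violates its bound after a
   time [D]. *)
have [t1 T0t1 ft1] : exists2 t, T0 <= t & f t <= e / 2.
  apply: contrapT => nex.
  have fe t : T0 <= t -> e / 2 <= f t.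
    by move=> T0t; rewrite leNgt; apply/negP => lt; apply: nex; exists t => //; exact: ltW.
  pose h t := Phi t - (e / 2) ^+ 2 * t.
  have hm : forall s t, T0 <= s -> s <= t -> h s <= h t.
    apply: (@derive_nondecr h (fun t => Phi' t - (e / 2) ^+ 2 * 1)).
      by move=> t T0t; exact: (isd_B (dP t (le_trans TT0 T0t)) (isd_Z _ (isd_id t))).
    move=> t T0t; rewrite mulr1 subr_ge0 (le_trans _ (fP t (le_trans TT0 T0t)))//.
    have fet := fe t T0t; have e2 : 0 <= e / 2 by rewrite divr_ge0// ltW.
    by rewrite ler_pXn2r// nnegrE// (le_trans e2).
  pose D := (2 * B + 1) / (e / 2) ^+ 2.
  have B0 : 0 <= B by rewrite (le_trans _ (PB T0 TT0)).
  have e2 : 0 < (e / 2) ^+ 2 by rewrite exprn_gt0// divr_gt0.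
  have D0 : 0 <= D by rewrite /D divr_ge0 ?(ltW e2)//; lra.
  have T0D : T0 <= T0 + D by rewrite lerDl.
  have := hm T0 (T0 + D) (lexx _) T0D.
  have := PB _ TT0; have := PB _ (le_trans TT0 T0D); rewrite !ler_norml => /andP[_ h1] /andP[h2 _].
  rewrite /h mulrDr /D [_ * (_ / _)]mulrC divfK ?gt_eqF//; lra.
exists t1 => [|t t1t]; first exact: le_trans T0t1.
have Tt1 := le_trans TT0 T0t1.
have c1 := f3 t1 t Tt1 t1t.
have c2 : Phi t - Phi t1 <= eta.
  by have := Peta t (le_trans T0t1 t1t); have := Pmono T0 t1 TT0 T0t1; lra.
have c3 : 3 * L * (Phi t - Phi t1) <= (e / 2) ^+ 3.
  have l3 : 0 <= 3 * L by rewrite mulr_ge0.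
  rewrite (le_trans (ler_wpM2l l3 c2))// /eta mulrCA ler_piMr ?exprn_ge0 ?divr_ge0 ?(ltW e0)//.
  by rewrite ler_pdivrMr// mul1r lerDl.
have c4 : f t1 ^+ 3 <= (e / 2) ^+ 3.
  by rewrite ler_pXn2r ?nnegrE ?f0 ?divr_ge0 ?(ltW e0).
have ft0 : 0 <= f t by apply: f0; exact: le_trans t1t.
have : f t ^+ 3 <= e ^+ 3.
  have -> : e ^+ 3 = 8 * (e / 2) ^+ 3 by field.
  have : 0 < (e / 2) ^+ 3 by rewrite exprn_gt0// divr_gt0.
  by lra.
by rewrite ler_pXn2r ?nnegrE// ltW.
Qed.

End ScalarDynamics.

(** * Energy, Lyapunov functional and uniform decay of the solution *)

Section Dynamics.
Variables (R : realType) (l mu0 mul : R).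
Hypotheses (l_gt0 : 0 < l) (mu0_gt : 2^-1 < mu0) (mul_lt : mul < 2^-1).
Let l_ge0 : 0 <= l := ltW l_gt0.
Local Notation D := (`]0, l[%classic : set R).
Local Notation intble := (intble l).
Local Notation Int := (Int l).
Local Notation ac := (ac l).
Local Notation aeq := (aeq l).
Local Notation ud := (ud l).
Implicit Types (t x : R).

(* U, W and V are the continuous representatives of u, u_t and u_tx, while
   G = u_x and X = u_txx are defined almost everywhere. *)
Variables U G W V X : R -> R -> R.
Hypothesis aU : forall t, 0 < t -> ac (U t) (G t).
Hypothesis LG : forall t, 0 < t -> L2 l (G t).
Hypothesis aW : forall t, 0 < t -> ac (W t) (V t).
Hypothesis aV : forall t, 0 < t -> ac (V t) (X t).
Hypothesis pde : forall t, 0 < t -> aeq (fun x => X t x - (G t x + U t x * G t x)) (W t).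
Hypothesis bc0 : forall t, 0 < t -> V t 0 = mu0 * U t 0 + 3^-1 * U t 0 ^+ 2.
Hypothesis bcl : forall t, 0 < t -> V t l = mul * U t l + 3^-1 * U t l ^+ 2.
Hypothesis dU : forall t, 0 < t -> ud t U (W t).
Hypothesis dG : forall t, 0 < t -> forall e, 0 < e -> exists2 r : R, 0 < r & forall k : R, `|k| < r ->
    Int (fun x => (G (t + k) x - G t x - k * V t x) ^+ 2) <= e ^+ 2 * k ^+ 2.

Let b0 : 0 <= (0 : R) <= l. Proof. by rewrite lexx. Qed.
Let bl : 0 <= l <= l. Proof. by rewrite lexx l_ge0. Qed.

Definition flux t x := U t x + 2^-1 * U t x ^+ 2.
Definition Z t x := V t x - flux t x.

Lemma ac_flux t : 0 < t -> ac (flux t) (fun x => G t x + U t x * G t x).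
Proof.
move=> t0; have h := acD (aU t0) (acZ 2^-1 (acM l_ge0 (aU t0) (aU t0))).
by apply: (ac_eq h l_ge0) => x _; rewrite /flux; field.
Qed.

Lemma ac_Z t : 0 < t -> ac (Z t) (W t).
Proof.
move=> t0; have h := acB (aV t0) (ac_flux t0).
by apply: (ac_ae h); [exact: ac_meas (aW t0)|exact: pde].
Qed.

Definition energy t := Int (fun x => U t x ^+ 2) + Int (fun x => G t x ^+ 2).

Definition denergy t := - 2 * ((2^-1 - mul) * U t l ^+ 2 + (mu0 - 2^-1) * U t 0 ^+ 2).

(** By parts, the integral of U X cancels that of G V, and only boundary terms remain. Their cubic
    parts cancel, because the coefficient 1/3 of the boundary conditions is also that of U^3 in [P],
    the primitive of U F'. *)
Lemma energy_derive t : 0 < t -> is_derive t 1 energy (denergy t).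
Proof.
move=> t0; have d1 := ud_Int l_gt0 t0 (ud_M t0 (dU t0) (dU t0)).
have d2 := L2_sqr_derive t0 LG (ac_L2 l_ge0 (aV t0)) (dG t0).
apply: (isd_eq (isd_D d1 d2)).
have [[u0 w0] v0] := (aU t0, aW t0, aV t0).
have p1 := ac_by_parts l_ge0 u0 v0.
pose P x := 2^-1 * U t x ^+ 2 + 3^-1 * U t x ^+ 3.
have u2 := acM l_ge0 u0 u0.
have aP : ac P (fun x => U t x * (G t x + U t x * G t x)).
  have h := acD (acZ 2^-1 u2) (acZ 3^-1 (acM l_ge0 u0 u2)).
  by apply: (ac_eq h l_ge0) => x _; rewrite /P; field.
have p2 := ac_endpoints l_ge0 aP.
have iUX := ac_intbleM l_ge0 u0 v0.1.
have iUW := ac_intbleM l_ge0 u0 (L2_intble (ac_L2 l_ge0 w0)).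
have iGV : intble (fun x => G t x * V t x).
  by apply: L2M; [exact: LG|exact: ac_L2 v0].
have e1 : Int (fun x => U t x * W t x) = Int (fun x => U t x * X t x) - (P l - P 0).
  rewrite p2 -IntB//; last exact: aP.1.
  apply: eq_Int_ae; [exact: intble_meas iUW|by apply: (@intble_meas _ l); apply: intbleB => //; exact: aP.1|].
  by apply: ae_impl (pde t0) => x + xD => /(_ xD) <-; ring.
rewrite [X in X + _](_ : _ = 2 * Int (fun x => U t x * W t x)); last first.
  by rewrite -IntZ//; apply: eq_Int => x _; ring.
rewrite IntD// in p1; rewrite e1.
have -> : Int (fun x => U t x * X t x) = U t l * V t l - U t 0 * V t 0 - Int (fun x => G t x * V t x).
  by rewrite -p1; ring.
by rewrite bc0// bcl// /P /denergy; field.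
Qed.

(** Time 1 is an arbitrary positive base point: the derivatives used here are two-sided, whereas at
    time 0 [is_time_deriv] is one-sided. *)
Lemma energy_le t : 1 <= t -> energy t <= energy 1.
Proof.
move=> t1; rewrite -lerN2.
apply: (@derive_nondecr R (fun t => - energy t) (fun t => - denergy t) 1) => //.
  by move=> s s1; apply/isd_N/energy_derive; rewrite (lt_le_trans _ s1).
move=> s s1; rewrite /denergy -mulNr opprK mulr_ge0// addr_ge0// mulr_ge0 ?sqr_ge0// subr_ge0 ltW//.
Qed.

Lemma U_bounded : exists2 c, 0 < c & forall t x, 1 <= t -> 0 <= x <= l -> `|U t x| <= c.
Proof.
have E0 : 0 <= energy 1 by rewrite addr_ge0// Int_ge0// => x _; rewrite sqr_ge0.
pose K := l^-1 * (1 + l) * energy 1.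
have K0 : 0 <= K by rewrite !mulr_ge0 ?invr_ge0// addr_ge0.
exists (K + 1); first by rewrite ltr_wpDl.
move=> t x t1 xl; have t0 : 0 < t by rewrite (lt_le_trans _ t1).
have := ac_sqr_bound l_ge0 (aU t0) (LG t0) xl; rewrite -/(energy t) => h.
have {}h : U t x ^+ 2 <= K.
  rewrite /K -mulrA ler_pdivlMl// (le_trans h)// ler_wpM2l ?addr_ge0//.
  exact: energy_le.
by apply: norm_le_sqr; [rewrite addr_ge0|rewrite (le_trans h)// expr2; nra].
Qed.

(** Testing the equation with W expresses [S], the squared H^1 norm of u_t, through W V at the
    endpoints and the integral of W F'. At the endpoints V is bounded by the boundary conditions,
    and W^2 by k S, so Young's inequality absorbs W into [S]. *)
Lemma W_bounded : exists2 C, 0 < C & forall t, 1 <= t ->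
  Int (fun x => W t x ^+ 2) <= C /\ forall x, 0 <= x <= l -> W t x ^+ 2 <= C.
Proof.
have [c c0 Uc] := U_bounded.
have E0 : 0 <= energy 1 by rewrite addr_ge0// Int_ge0// => x _; rewrite sqr_ge0.
pose k := l^-1 * (1 + l).
have k0 : 0 < k by rewrite mulr_gt0 ?invr_gt0 ?addr_gt0.
pose B := ((`|mu0| + `|mul|) * c + c ^+ 2) ^+ 2.
have B0 : 0 <= B by rewrite sqr_ge0.
pose C := 2 * (4 * k * B + (1 + c) ^+ 2 * energy 1) + 1.
have C0 : 0 < C.
  have h1 : 0 <= 4 * k * B by apply: mulr_ge0 => //; apply: mulr_ge0 => //; exact: ltW.
  have h2 : 0 <= (1 + c) ^+ 2 * energy 1 by rewrite mulr_ge0// sqr_ge0.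
  by rewrite /C; lra.
exists (C + k * C); first by rewrite addr_gt0// mulr_gt0.
move=> t t1; have t0 : 0 < t by rewrite (lt_le_trans _ t1).
have [[u0 w0] v0] := (aU t0, aW t0, aV t0).
have LW := ac_L2 l_ge0 w0; have LV := ac_L2 l_ge0 v0.
set S := Int (fun x => W t x ^+ 2) + Int (fun x => V t x ^+ 2).
have W0 : 0 <= Int (fun x => W t x ^+ 2) by apply: Int_ge0 => x _; rewrite sqr_ge0.
have V0 : 0 <= Int (fun x => V t x ^+ 2) by apply: Int_ge0 => x _; rewrite sqr_ge0.
have G0 : Int (fun x => G t x ^+ 2) <= energy 1.
  rewrite (le_trans _ (energy_le t1))// lerDr Int_ge0// => x _; exact: sqr_ge0.
have Wx x : 0 <= x <= l -> W t x ^+ 2 <= k * S.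
  by move=> xl; have := ac_sqr_bound l_ge0 w0 LV xl; rewrite /k -mulrA ler_pdivlMl.
have Vb m y : `|y| <= c -> `|m| <= `|mu0| + `|mul| -> (m * y + 3^-1 * y ^+ 2) ^+ 2 <= B.
  move=> yc mm; rewrite -[leLHS]real_normK ?num_real// ler_pXn2r ?nnegrE//.
    rewrite (le_trans (ler_normD _ _))// lerD//; first by rewrite normrM ler_pM.
    rewrite normrM normrX ger0_norm// (@le_trans _ _ (1 * `|y| ^+ 2))//.
      by rewrite ler_wpM2r ?exprn_ge0//; lra.
    by rewrite mul1r ler_pXn2r ?nnegrE// ltW.
  by rewrite addr_ge0 ?sqr_ge0// mulr_ge0 ?(ltW c0)// addr_ge0.
have V0B : V t 0 ^+ 2 <= B by rewrite bc0//; apply: Vb; [exact: Uc|rewrite lerDl].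
have VlB : V t l ^+ 2 <= B by rewrite bcl//; apply: Vb; [exact: Uc|rewrite lerDr].
have p := ac_by_parts l_ge0 w0 v0.
have iWX := ac_intbleM l_ge0 w0 v0.1.
have iWW := L2_sqr LW; have iVV := L2_sqr LV.
have LH : L2 l (fun x => G t x + U t x * G t x).
  by apply: L2D; [exact: LG|exact: ac_L2M l_ge0 u0 (LG t0)].
have iWH := L2M LW LH.
have e1 : Int (fun x => W t x * X t x) = Int (fun x => W t x ^+ 2) + Int (fun x => W t x * (G t x + U t x * G t x)).
  rewrite -IntD//; apply: eq_Int_ae; [exact: intble_meas iWX|by apply: (@intble_meas _ l); exact: intbleD|].
  by apply: ae_impl (pde t0) => x + xD => /(_ xD) <-; ring.
rewrite IntD// e1 in p.
have e2 : - Int (fun x => W t x * (G t x + U t x * G t x)) <=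
    4^-1 * Int (fun x => W t x ^+ 2) + (1 + c) ^+ 2 * Int (fun x => G t x ^+ 2).
  have iGG := L2_sqr (LG t0).
  rewrite -IntN// -!IntZ// -IntD; [|exact: intbleZ|exact: intbleZ].
  apply: le_Int => [||x /itv_oo_cc xl]; [exact: intbleN|by apply: intbleD; exact: intbleZ|].
  have := Uc t x t1 xl; rewrite ler_norml => /andP[u1 u2].
  have : (1 + U t x) ^+ 2 * G t x ^+ 2 <= (1 + c) ^+ 2 * G t x ^+ 2.
    by rewrite ler_wpM2r ?sqr_ge0// !expr2; nra.
  have := sqr_ge0 (2^-1 * W t x + (1 + U t x) * G t x); rewrite !expr2; lra.
(* The two endpoints cost S/4 and the bulk term at most another S/4. Half of [S] survives, whence
   the factor 2 in [C]. *)
have e3 x : 0 <= x <= l -> V t x ^+ 2 <= B -> `|W t x * V t x| <= S / 8 + 2 * k * B.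
  move=> xl VB; have := Wx x xl => wS.
  have w8 : W t x ^+ 2 / (8 * k) <= S / 8.
    have k8' : 0 <= (8 * k)^-1 by pos.
    by rewrite (le_trans (ler_wpM2r k8' wS))// le_eqVlt; apply/orP; left; apply/eqP; field; exact: lt0r_neq0.
  have kV : 2 * k * V t x ^+ 2 <= 2 * k * B by rewrite ler_wpM2l// mulr_ge0// ltW.
  have k8 : 0 < (8 * k)^-1 by rewrite invr_gt0 mulr_gt0.
  have q1 := mulr_ge0 (ltW k8) (sqr_ge0 (W t x - 4 * k * V t x)).
  have q2 := mulr_ge0 (ltW k8) (sqr_ge0 (W t x + 4 * k * V t x)).
  have r1 : (8 * k)^-1 * (W t x - 4 * k * V t x) ^+ 2 = W t x ^+ 2 / (8 * k) + 2 * k * V t x ^+ 2 - W t x * V t x by field; exact: lt0r_neq0.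
  have r2 : (8 * k)^-1 * (W t x + 4 * k * V t x) ^+ 2 = W t x ^+ 2 / (8 * k) + 2 * k * V t x ^+ 2 + W t x * V t x by field; exact: lt0r_neq0.
  by rewrite ler_norml; apply/andP; split; lra.
have := e3 _ bl VlB; have := e3 _ b0 V0B; rewrite !ler_norml => /andP[f1 f2] /andP[f3 f4].
have e4 : (1 + c) ^+ 2 * Int (fun x => G t x ^+ 2) <= (1 + c) ^+ 2 * energy 1 by rewrite ler_wpM2l// sqr_ge0.
have SC : S <= C.
  by rewrite /C; move: p e2 e4 f1 f2 f3 f4 W0 V0; rewrite /S => *; lra.
have WS : Int (fun x => W t x ^+ 2) <= S by rewrite /S lerDl.
split; first by rewrite (le_trans WS)// (le_trans SC)// lerDl mulr_ge0// ltW.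
move=> x xl; rewrite (le_trans (Wx x xl))// (@le_trans _ _ (k * C))//.
  by rewrite ler_wpM2l// ltW.
by rewrite lerDr ltW.
Qed.

Lemma Int_abs_le f c : (forall x, 0 <= x <= l -> `|f x| <= c) -> intble f -> `|Int f| <= c * l.
Proof.
move=> fc i_f; rewrite (le_trans (le_abs_Int i_f))// -(Int_cst c l_ge0).
by apply: le_Int => [||x /itv_oo_cc]; [exact: intble_abs|exact: intble_cst|exact: fc].
Qed.

(** At an endpoint Z equals (m - 1 - U/6) U, with m the boundary coefficient there, so it is
    controlled by U. *)
Lemma Z_boundary : exists2 C, 0 < C & forall t, 1 <= t ->
  Z t 0 ^+ 2 <= C * U t 0 ^+ 2 /\ Z t l ^+ 2 <= C * U t l ^+ 2.
Proof.
have [c c0 Uc] := U_bounded.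
pose M := `|mu0| + `|mul| + 1 + c.
have M0 : 0 < M by rewrite /M; have := normr_ge0 mu0; have := normr_ge0 mul; lra.
exists (M ^+ 2); first by rewrite exprn_gt0.
have H m y : `|y| <= c -> `|m| <= `|mu0| + `|mul| ->
    (m * y + 3^-1 * y ^+ 2 - (y + 2^-1 * y ^+ 2)) ^+ 2 <= M ^+ 2 * y ^+ 2.
  move=> yc mm; have -> : m * y + 3^-1 * y ^+ 2 - (y + 2^-1 * y ^+ 2) = (m - 1 - 6^-1 * y) * y by field.
  rewrite exprMn ler_wpM2r ?sqr_ge0// -[leLHS]real_normK ?num_real//.
  rewrite ler_pXn2r ?nnegrE ?(ltW M0)// ler_norml /M.
  by move: yc mm; rewrite !ler_norml => /andP[? ?] /andP[? ?]; apply/andP; split; lra.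
move=> t t1; have t0 : 0 < t by rewrite (lt_le_trans _ t1).
rewrite /Z /flux bc0// bcl//; split; apply: H; rewrite ?Uc//.
- by rewrite lerDl.
- by rewrite lerDr.
Qed.

(** The rate 4 serves [Nf_coercive]: a rate a produces the form (a/2) (W^2 + Z^2) - 2 W Z, which is
    positive definite as soon as a > 2. *)
Definition ew x : R := expR (- (4 * x)).

Lemma ac_ew : ac ew (fun x => - 4 * ew x).
Proof.
have dew x : is_derive x 1 ew (- 4 * ew x).
  have h := isd_N (isd_Z 4 (isd_id x)).
  apply: (isd_eq (@isd_comp _ expR (fun x => - (4 * x)) x _ _ (is_derive_expR _) h)).
  by rewrite /ew; ring.
apply: ac_derive => // x; apply: is_derive_cont; exact: isd_Z (dew x).
Qed.

Lemma ew_gt0 x : 0 < ew x. Proof. exact: expR_gt0. Qed.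

Lemma ew0 : ew 0 = 1. Proof. by rewrite /ew mulr0 oppr0 expR0. Qed.

Lemma ew_itv x : 0 <= x <= l -> ew l <= ew x <= 1.
Proof.
by move=> /andP[x0 xl]; rewrite -ew0 /ew !ler_expR; apply/andP; split; lra.
Qed.

Lemma Z_weighted t : 0 < t ->
  Int (fun x => - 4 * ew x * (Z t x * Z t x) + ew x * (W t x * Z t x + Z t x * W t x)) =
  ew l * Z t l ^+ 2 - Z t 0 ^+ 2.
Proof.
move=> t0; have z := ac_Z t0.
by rewrite (ac_by_parts l_ge0 ac_ew (acM l_ge0 z z)) ew0 mul1r.
Qed.

Lemma Z_weighted_intble t : 0 < t ->
  intble (fun x => - 4 * ew x * (Z t x * Z t x) + ew x * (W t x * Z t x + Z t x * W t x)).
Proof. by move=> t0; have z := ac_Z t0; exact: (acM l_ge0 ac_ew (acM l_ge0 z z)).1. Qed.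

(** Z is recovered from Z(0) and from Z' = W; in the weighted identity the boundary term at l has
    the favourable sign and is dropped. *)
Lemma Z_L2 t : 0 < t ->
  2 * ew l * Int (fun x => Z t x ^+ 2) <= Z t 0 ^+ 2 + 2^-1 * Int (fun x => W t x ^+ 2).
Proof.
move=> t0; have z := ac_Z t0; have p := Z_weighted t0; have i := Z_weighted_intble t0.
set k := fun x => _ in p i.
have iZ := L2_sqr (ac_L2 l_ge0 z); have iW := L2_sqr (ac_L2 l_ge0 (aW t0)).
have : 2 * ew l * Int (fun x => Z t x ^+ 2) <= - Int k + 2^-1 * Int (fun x => W t x ^+ 2).
  rewrite -IntN// -!IntZ// -IntD; [|exact: intbleN|exact: intbleZ].
  apply: le_Int => [||x /itv_oo_cc/ew_itv/andP[e1 e2]]; first exact: intbleZ.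
    by apply: intbleD; [exact: intbleN|exact: intbleZ].
  rewrite /k; have e0 := ew_gt0 x.
  have h1 := mulr_ge0 (ltW e0) (sqr_ge0 (Z t x - 2^-1 * W t x)).
  have h2 : ew l * Z t x ^+ 2 <= ew x * Z t x ^+ 2 by rewrite ler_wpM2r ?sqr_ge0.
  have h3 : ew x * W t x ^+ 2 <= 1 * W t x ^+ 2 by rewrite ler_wpM2r ?sqr_ge0.
  by move: h1 h2 h3; rewrite !expr2; lra.
have := mulr_ge0 (ltW (ew_gt0 l)) (sqr_ge0 (Z t l)).
by rewrite p; lra.
Qed.

Definition rho x := ew x - ew l.

Lemma ac_rho : ac rho (fun x => - 4 * ew x).
Proof. by apply: (ac_eq (acB ac_ew (ac_cst l (ew l))) l_ge0) => // x _; rewrite subr0. Qed.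

Definition Nf t := Int (fun x => rho x * (2^-1 * U t x ^+ 2 + 6^-1 * U t x ^+ 3)).
Definition dNf t := Int (fun x => rho x * (flux t x * W t x)).

Lemma Nf_derive t : 0 < t -> is_derive t 1 Nf (dNf t).
Proof.
move=> t0; have u := dU t0; have u2 := ud_M t0 u u; have u3 := ud_M t0 u u2.
have r := ud_cst t (ac_continuous l_ge0 ac_rho).
have h := ud_M t0 r (ud_D (ud_Z 2^-1 t0 u2) (ud_Z 6^-1 t0 u3)).
apply: (ud_Int l_gt0 t0); apply: (ud_eq t0 h) => x; rewrite /flux; last by field.
by move=> y; ring.
Qed.

(** The derivative of (W^2 - Z^2)/2 is W F. Weighted by [rho] and combined with [Z_weighted], it
    leaves 2 ew (W^2 - W Z + Z^2) in the integrand, which is at least 3/2 ew W^2. As [rho] vanishes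
    at l, no W(l) appears. *)
Lemma Nf_coercive t : 0 < t ->
  3 / 2 * ew l * Int (fun x => W t x ^+ 2) <= dNf t + 2^-1 * rho 0 * W t 0 ^+ 2 + Z t 0 ^+ 2.
Proof.
move=> t0; have [w z] := (aW t0, ac_Z t0).
have y := acB (acZ 2^-1 (acM l_ge0 w w)) (acZ 2^-1 (acM l_ge0 z z)).
have p1 := ac_by_parts l_ge0 ac_rho y; have i1 := (acM l_ge0 ac_rho y).1.
have p2 := Z_weighted t0; have i2 := Z_weighted_intble t0.
set k1 := fun x => _ in i1; rewrite -/k1 in p1; set k2 := fun x => _ in p2 i2.
have iW := L2_sqr (ac_L2 l_ge0 w).
have iF : intble (fun x => rho x * (flux t x * W t x)).
  apply: (ac_intbleM l_ge0 ac_rho); apply: (ac_intbleM l_ge0 (ac_flux t0)).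
  exact: L2_intble (ac_L2 l_ge0 w).
have : 3 / 2 * ew l * Int (fun x => W t x ^+ 2) <= dNf t - Int k1 - Int k2.
  rewrite -IntB// -IntB//; last exact: intbleB.
  rewrite -IntZ//; apply: le_Int => [||x /itv_oo_cc/ew_itv/andP[e1 e2]]; first exact: intbleZ.
    by apply: intbleB => //; exact: intbleB.
  rewrite /k1 /k2; have e0 := ew_gt0 x.
  have h1 := mulr_ge0 (ltW e0) (sqr_ge0 (Z t x - 2^-1 * W t x)).
  have h2 : ew l * W t x ^+ 2 <= ew x * W t x ^+ 2 by rewrite ler_wpM2r ?sqr_ge0.
  have -> : V t x = Z t x + flux t x by rewrite /Z subrK.
  by move: h1 h2; rewrite !expr2; lra.
rewrite p1 p2 {1}/rho subrr mul0r sub0r.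
have := mulr_ge0 (ltW (ew_gt0 l)) (sqr_ge0 (Z t l)).
have r0 : 0 <= rho 0 by rewrite subr_ge0; have /andP[] := ew_itv b0.
have := mulr_ge0 r0 (sqr_ge0 (Z t 0)); rewrite !expr2; lra.
Qed.

(** [gk] and [gp] are twice sinh(l - x) and cosh(l - x), for which (gk W + gp Z)' = gk F. Since
    [gk l = 0], the value W(l) stays out of [qf_eq]. *)
Definition gk x : R := expR (l - x) - expR (x - l).
Definition gp x : R := expR (l - x) + expR (x - l).

Lemma gk_gp_derive x : is_derive x 1 gk (- gp x) /\ is_derive x 1 gp (- gk x).
Proof.
have h1 := isd_B (isd_cst l x) (isd_id x); have h2 := isd_B (isd_id x) (isd_cst l x).
have d1 := @isd_comp _ expR (fun x => l - x) x _ _ (is_derive_expR _) h1.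
have d2 := @isd_comp _ expR (fun x => x - l) x _ _ (is_derive_expR _) h2.
split; [apply: (isd_eq (isd_B d1 d2))|apply: (isd_eq (isd_D d1 d2))]; rewrite /gp /gk; ring.
Qed.

Lemma ac_gk : ac gk (fun x => - gp x).
Proof.
apply: ac_derive => // x; first by have [] := gk_gp_derive x.
by have [_ /isd_N/is_derive_cont] := gk_gp_derive x.
Qed.

Lemma ac_gp : ac gp (fun x => - gk x).
Proof.
apply: ac_derive => // x; first by have [] := gk_gp_derive x.
by have [/isd_N/is_derive_cont] := gk_gp_derive x.
Qed.

Definition qf t := Int (fun x => gk x * flux t x).
Definition dqf t := Int (fun x => gk x * (W t x + U t x * W t x)).

Lemma qf_derive t : 0 < t -> is_derive t 1 qf (dqf t).
Proof.
move=> t0; have u := dU t0; have u2 := ud_M t0 u u.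
have r := ud_cst t (ac_continuous l_ge0 ac_gk).
have h := ud_M t0 r (ud_D u (ud_Z 2^-1 t0 u2)).
by apply: (ud_Int l_gt0 t0); apply: (ud_eq t0 h) => x //=; field.
Qed.

Lemma qf_eq t : 0 < t -> qf t = gp l * Z t l - gk 0 * W t 0 - gp 0 * Z t 0.
Proof.
move=> t0; have [w z] := (aW t0, ac_Z t0).
have p1 := ac_by_parts l_ge0 ac_gk w; have p2 := ac_by_parts l_ge0 ac_gp z.
have gkl : gk l = 0 by rewrite /gk subrr.
rewrite gkl mul0r sub0r in p1.
have -> : gp l * Z t l - gk 0 * W t 0 - gp 0 * Z t 0 =
  - (gk 0 * W t 0) + (gp l * Z t l - gp 0 * Z t 0) by ring.
rewrite -p1 -p2 -IntD; [|exact: (acM l_ge0 ac_gk w).1|exact: (acM l_ge0 ac_gp z).1].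
by apply: eq_Int => x _; rewrite /Z; ring.
Qed.

Lemma dqf_bound : exists2 C, 0 < C & forall t, 1 <= t -> dqf t ^+ 2 <= C * Int (fun x => W t x ^+ 2).
Proof.
have [c c0 Uc] := U_bounded; have [g g0 gb] := ac_bounded l_ge0 ac_gk.
pose M := (g * (1 + c)) ^+ 2 * l; have M0 : 0 <= M by rewrite mulr_ge0// sqr_ge0.
exists (M + 1); first by rewrite ltr_wpDl.
move=> t t1; have t0 : 0 < t by rewrite (lt_le_trans _ t1).
have W0 : 0 <= Int (fun x => W t x ^+ 2) by apply: Int_ge0 => x _; rewrite sqr_ge0.
have ag := acM l_ge0 ac_gk (acD (ac_cst l 1) (aU t0)).
have Lg := ac_L2 l_ge0 ag; have LW := ac_L2 l_ge0 (aW t0).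
have -> : dqf t = Int (fun x => gk x * (1 + U t x) * W t x) by apply: eq_Int => x _; ring.
rewrite (le_trans (CauchySchwarz Lg LW))// ler_wpM2r// (@le_trans _ _ M) ?lerDl//.
rewrite (le_trans (ler_norm _))//; apply: Int_abs_le; last exact: L2_sqr.
move=> x xl; rewrite normrX ler_pXn2r ?nnegrE ?mulr_ge0 ?addr_ge0 ?(ltW c0)//.
rewrite normrM ler_pM ?gb// (le_trans (ler_normD _ _))// normr1 lerD2l; exact: Uc.
Qed.

Lemma boundary_dissipation : exists2 k, 0 < k & forall t, U t 0 ^+ 2 + U t l ^+ 2 <= - k * denergy t.
Proof.
pose k0 := Num.min (2^-1 - mul) (mu0 - 2^-1).
have k00 : 0 < k0 by rewrite lt_min !subr_gt0 mul_lt.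
exists (2 * k0)^-1; first by rewrite invr_gt0 mulr_gt0.
move=> t; rewrite /denergy.
have -> : - (2 * k0)^-1 * (- 2 * ((2^-1 - mul) * U t l ^+ 2 + (mu0 - 2^-1) * U t 0 ^+ 2)) =
  ((2^-1 - mul) * U t l ^+ 2 + (mu0 - 2^-1) * U t 0 ^+ 2) / k0 by field; exact: lt0r_neq0.
rewrite ler_pdivlMr// mulrDl addrC lerD//.
  by rewrite mulrC ler_wpM2r ?sqr_ge0// ge_min lexx.
by rewrite mulrC ler_wpM2r ?sqr_ge0// ge_min lexx orbT.
Qed.

Lemma norm_coefX (k y c : R) n : 0 <= k -> `|y| <= c -> `|k * y ^+ n| <= k * c ^+ n.
Proof.
move=> k0 yc; rewrite normrM normrX ger0_norm// ler_wpM2l// lerXn2r ?nnegrE//.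
exact: le_trans yc.
Qed.

Definition dissipation t := Int (fun x => W t x ^+ 2) + (U t 0 ^+ 2 + U t l ^+ 2).

Lemma dissipation_bounded : exists Phi Phi' : R -> R, exists B m : R, [/\ 0 < m,
  forall t, 1 <= t -> is_derive t 1 Phi (Phi' t),
  forall t, 1 <= t -> `|Phi t| <= B &
  forall t, 1 <= t -> m * dissipation t <= Phi' t].
Proof.
have [c c0 Uc] := U_bounded; have [CZ CZ0 Zb] := Z_boundary.
have [Cq Cq0 qb] := dqf_bound; have [kd kd0 dis] := boundary_dissipation.
have E0 : 0 <= energy 1 by rewrite addr_ge0// Int_ge0// => x _; rewrite sqr_ge0.
have [g g0 gb] := ac_bounded l_ge0 ac_gk.
pose S := gk 0.
have S0 : 0 < S by rewrite /S /gk subr_gt0 ltr_expR sub0r subr0 (@lt_trans _ _ 0)// oppr_lt0.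
have r0 : 0 < rho 0 by rewrite /rho subr_gt0 /ew ltr_expR mulr0 oppr0 oppr_lt0 mulr_gt0.
(* The functional gains ka S W(0)^2. Half of it cancels the term rho(0)/2 W(0)^2 of [Nf_coercive],
   and the other half absorbs W(0) r, where [r] is the part of q that comes from Z. *)
pose ka := rho 0 / S; have ka0 : 0 < ka by rewrite divr_gt0.
pose m := 3 / 2 * ew l; have m0 : 0 < m by rewrite mulr_gt0 ?ew_gt0// divr_gt0.
(* The Young weight for which the term U(0) q' uses up only half of the coercivity [m]. *)
pose eta := m / (2 * ka * Cq).
have eta0 : 0 < eta by rewrite /eta; pos.
pose C1 := 2 * (gp l ^+ 2 + gp 0 ^+ 2) * CZ.
have C10 : 0 <= C1 by rewrite !mulr_ge0 ?addr_ge0 ?sqr_ge0// ltW.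
(* Collects all errors bounded by U(0)^2 + U(l)^2. With [C3] the energy pays for them and leaves one
   more multiple of this sum. *)
pose C2 := ka * (C1 / (2 * S)) + ka / (4 * eta) + CZ.
have C20 : 0 <= C2.
  by rewrite /C2; pos.
pose C3 := (C2 + 1) * kd.
pose Phi t := Nf t - ka * (U t 0 * qf t) - C3 * energy t.
pose Phi' t := dNf t - ka * (W t 0 * qf t + U t 0 * dqf t) - C3 * denergy t.
pose BN := (1 * (2^-1 * c ^+ 2 + 6^-1 * c ^+ 3)) * l.
pose Bq := (g * (c + 2^-1 * c ^+ 2)) * l.
exists Phi, Phi', (BN + ka * (c * Bq) + C3 * energy 1), (Num.min (m / 2) 1); split.
- by rewrite lt_min ltr01 andbT divr_gt0.
- move=> t t1; have t0 : 0 < t by rewrite (lt_le_trans _ t1).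
  apply: isd_B; last exact/isd_Z/energy_derive.
  apply: isd_B; first exact: Nf_derive.
  by apply: isd_Z; apply: isd_M; [exact: ud_pt (dU t0) b0|exact: qf_derive].
- move=> t t1; have t0 : 0 < t by rewrite (lt_le_trans _ t1).
  have n1 : `|Nf t| <= BN.
    apply: Int_abs_le => [x xl|]; last first.
      apply: (ac_intbleM l_ge0 ac_rho).
      have u2 := acM l_ge0 (aU t0) (aU t0); have u3 := acM l_ge0 (aU t0) u2.
      have := L2_intble (ac_L2 l_ge0 (acD (acZ 2^-1 u2) (acZ 6^-1 u3))).
      by congr intble; apply/funext => x; rewrite -!exprS.
    rewrite normrM ler_pM//.
      have /andP[e1 e2] := ew_itv xl; have := ew_gt0 l.
      by rewrite ger0_norm /rho; lra.
    have uc := Uc t x t1 xl.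
    by rewrite (le_trans (ler_normD _ _))//; apply: lerD; apply: norm_coefX; rewrite ?invr_ge0.
  have n2 : `|qf t| <= Bq.
    apply: Int_abs_le => [x xl|]; last first.
      by apply: (ac_intbleM l_ge0 ac_gk); exact: L2_intble (ac_L2 l_ge0 (ac_flux t0)).
    rewrite normrM ler_pM ?gb//.
    have uc := Uc t x t1 xl.
    by rewrite (le_trans (ler_normD _ _))//; apply: lerD => //; apply: norm_coefX; rewrite ?invr_ge0.
  have n3 : `|energy t| <= energy 1.
    rewrite ger0_norm; first exact: energy_le.
    by rewrite addr_ge0// Int_ge0// => x _; rewrite sqr_ge0.
  have C30 : 0 <= C3 by rewrite /C3; pos.
  rewrite (le_trans (ler_normB _ _))// lerD//; last first.
    by rewrite normrM ger0_norm// ler_wpM2l.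
  rewrite (le_trans (ler_normB _ _))// lerD// normrM (ger0_norm (ltW ka0)) ler_wpM2l ?(ltW ka0)//.
  by rewrite normrM ler_pM// Uc.
move=> t t1; have t0 : 0 < t by rewrite (lt_le_trans _ t1).
set w2 := Int (fun x => W t x ^+ 2); have w20 : 0 <= w2 by apply: Int_ge0 => x _; rewrite sqr_ge0.
have co := Nf_coercive t0; have [Z0 Zl] := Zb t t1; have qe := qf_eq t0.
have qd := qb t t1; have di := dis t; rewrite -/w2 -/m -/S in co qd qe.
set a := U t 0 in Z0 di *; set b := U t l in Zl di *; set a' := W t 0 in co qe *.
set s := a ^+ 2 + b ^+ 2 in di *.
pose r := gp l * Z t l - gp 0 * Z t 0.
have rb : r ^+ 2 <= C1 * s.
  have h1 : gp l ^+ 2 * Z t l ^+ 2 <= gp l ^+ 2 * (CZ * b ^+ 2) by rewrite ler_wpM2l ?sqr_ge0.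
  have h2 : gp 0 ^+ 2 * Z t 0 ^+ 2 <= gp 0 ^+ 2 * (CZ * a ^+ 2) by rewrite ler_wpM2l ?sqr_ge0.
  have h3 : 0 <= gp l ^+ 2 * (CZ * a ^+ 2) by pos.
  have h4 : 0 <= gp 0 ^+ 2 * (CZ * b ^+ 2) by pos.
  have h5 : r ^+ 2 <= 2 * (gp l ^+ 2 * Z t l ^+ 2) + 2 * (gp 0 ^+ 2 * Z t 0 ^+ 2).
    by have := sqr_ge0 (gp l * Z t l + gp 0 * Z t 0); rewrite /r !expr2; lra.
  by rewrite (le_trans h5)// /C1 /s; lra.
have i1 : a' * r <= S / 2 * a' ^+ 2 + r ^+ 2 / (2 * S).
  have h := mulr_ge0 (ltW S0) (sqr_ge0 (a' - r / S)).
  have e : S * (a' - r / S) ^+ 2 = 2 * (S / 2 * a' ^+ 2 + r ^+ 2 / (2 * S) - a' * r) by field; exact: lt0r_neq0.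
  by move: h; rewrite e; lra.
have i2 : a * dqf t <= eta * dqf t ^+ 2 + a ^+ 2 / (4 * eta).
  have h := mulr_ge0 (ltW eta0) (sqr_ge0 (dqf t - a / (2 * eta))).
  have e : eta * (dqf t - a / (2 * eta)) ^+ 2 = eta * dqf t ^+ 2 + a ^+ 2 / (4 * eta) - a * dqf t by field; exact: lt0r_neq0.
  by move: h; rewrite e; lra.
have i3 : S / 2 * a' ^+ 2 <= r ^+ 2 / (2 * S) - (a' * qf t + a * dqf t) + (eta * dqf t ^+ 2 + a ^+ 2 / (4 * eta)).
  have e : a' * qf t = a' * r - S * a' ^+ 2 by rewrite qe /r; ring.
  by rewrite e; lra.
have i4 : ka * (eta * dqf t ^+ 2) <= m / 2 * w2.
  have h : ka * eta * dqf t ^+ 2 <= ka * eta * (Cq * w2) by rewrite ler_wpM2l// mulr_ge0// ltW.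
  rewrite mulrA (le_trans h)// le_eqVlt; apply/orP; left; apply/eqP; rewrite /eta; field.
  by rewrite (lt0r_neq0 ka0) (lt0r_neq0 Cq0).
have i5 : ka * (r ^+ 2 / (2 * S)) <= ka * (C1 / (2 * S)) * s.
  by rewrite -mulrA ler_wpM2l ?(ltW ka0)// [C1 / _ * s]mulrAC ler_wpM2r//; pos.
have s1 : a ^+ 2 <= s by rewrite lerDl sqr_ge0.
have i6 : ka * (a ^+ 2 / (4 * eta)) <= ka / (4 * eta) * s.
  rewrite (_ : ka * (a ^+ 2 / (4 * eta)) = ka / (4 * eta) * a ^+ 2); last by ring.
  by rewrite ler_wpM2l//; pos.
have i7 : CZ * a ^+ 2 <= CZ * s by rewrite ler_wpM2l// ltW.
have i8 : 2^-1 * rho 0 * a' ^+ 2 = ka * (S / 2 * a' ^+ 2) by rewrite /ka; field; exact: lt0r_neq0.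
have i9 := ler_wpM2l (ltW ka0) i3.
have i10 : m / 2 * w2 <= dNf t - ka * (a' * qf t + a * dqf t) + C2 * s.
  by move: co i9; rewrite i8 /C2; lra.
have i11 : (C2 + 1) * s <= - C3 * denergy t.
  have C21 : 0 <= C2 + 1 by rewrite addr_ge0.
  by have := ler_wpM2l C21 di; rewrite /C3; lra.
have j1 : Num.min (m / 2) 1 * w2 <= m / 2 * w2 by rewrite ler_wpM2r// ge_min lexx.
have j2 : Num.min (m / 2) 1 * s <= 1 * s.
  by rewrite ler_wpM2r ?addr_ge0 ?sqr_ge0// ge_min lexx orbT.
rewrite /dissipation -/w2 -/a -/b -/s mulrDr /Phi' -/a -/a'; lra.
Qed.

Definition Ff t := Int (fun x => flux t x ^+ 2) + U t 0 ^+ 2.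
Definition dFf t := Int (fun x => 2 * flux t x * (W t x + U t x * W t x)) + 2 * U t 0 * W t 0.

Lemma Ff_derive t : 0 < t -> is_derive t 1 Ff (dFf t).
Proof.
move=> t0; have u := dU t0; have u2 := ud_M t0 u u.
have f := ud_D u (ud_Z 2^-1 t0 u2); have f2 := ud_M t0 f f.
have a2 := isd_X 2 (ud_pt u b0).
apply: (isd_D _ a2); apply: (ud_Int l_gt0 t0); apply: (ud_eq t0 f2) => x; first by move=> y; rewrite /flux; ring.
by rewrite /flux; field.
Qed.

Lemma flux_factor t x c : `|U t x| <= c -> flux t x ^+ 2 <= (1 + c) ^+ 2 * U t x ^+ 2.
Proof.
move=> uc; have -> : flux t x = (1 + 2^-1 * U t x) * U t x by rewrite /flux; ring.
rewrite exprMn ler_wpM2r ?sqr_ge0//.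
by move: uc; rewrite ler_norml => /andP[? ?]; rewrite -subr_ge0 subr_sqr mulr_ge0//; lra.
Qed.

Lemma flux_derive_bound : exists2 K, 0 <= K & forall t, 1 <= t ->
  L2 l (fun x => G t x + U t x * G t x) /\
  Int (fun x => (G t x + U t x * G t x) ^+ 2) <= K.
Proof.
have [c c0 Uc] := U_bounded.
have E0 : 0 <= energy 1 by rewrite addr_ge0// Int_ge0// => x _; rewrite sqr_ge0.
exists ((1 + c) ^+ 2 * energy 1); first by rewrite mulr_ge0// sqr_ge0.
move=> t t1; have t0 : 0 < t by rewrite (lt_le_trans _ t1).
have LH : L2 l (fun x => G t x + U t x * G t x).
  by apply: L2D; [exact: LG|exact: ac_L2M l_ge0 (aU t0) (LG t0)].
split => //; have iG := L2_sqr (LG t0).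
apply: (@le_trans _ _ ((1 + c) ^+ 2 * Int (fun x => G t x ^+ 2))); last first.
  rewrite ler_wpM2l ?sqr_ge0// (le_trans _ (energy_le t1))// lerDr Int_ge0// => x _; exact: sqr_ge0.
rewrite -IntZ//; apply: le_Int => [||x /itv_oo_cc xl]; [exact: L2_sqr|exact: intbleZ|].
have -> : G t x + U t x * G t x = (1 + U t x) * G t x by ring.
rewrite exprMn ler_wpM2r ?sqr_ge0//.
have := Uc t x t1 xl; rewrite ler_norml => /andP[? ?].
by rewrite -subr_ge0 subr_sqr mulr_ge0//; lra.
Qed.

Lemma sqr_sum4 (p1 p2 p3 p4 : R) : (p1 + p2 + p3 + p4) ^+ 2 <= 4 * (p1 ^+ 2 + p2 ^+ 2 + p3 ^+ 2 + p4 ^+ 2).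
Proof.
have := sqr_ge0 (p1 - p2); have := sqr_ge0 (p1 - p3); have := sqr_ge0 (p1 - p4).
have := sqr_ge0 (p2 - p3); have := sqr_ge0 (p2 - p4); have := sqr_ge0 (p3 - p4).
rewrite !expr2; lra.
Qed.

(** Integrating (F W)' expresses the integral of F^2 through F W at the ends and the integrals of F'
    W and F Z. The first two are only of the order of the square root of the dissipation, since W is
    merely bounded at the ends and F' merely bounded in L^2; hence the square of [Ff]. The part in Z
    is linear in the dissipation, and its square is again linear because u_t and U(0) are
    bounded. *)
Lemma Ff_sqr_bound : exists2 C, 0 < C & forall t, 1 <= t -> Ff t ^+ 2 <= C * dissipation t.
Proof.
have [c c0 Uc] := U_bounded; have [CZ CZ0 Zb] := Z_boundary.
have [CW CW0 Wb] := W_bounded; have [K K0 HK] := flux_derive_bound.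
have e0 := ew_gt0 l.
pose k1 := (CZ + 1) / (2 * ew l).
have k10 : 0 <= k1 by rewrite divr_ge0 ?mulr_ge0 ?(ltW e0)// addr_ge0// ltW.
pose k2 := CW + c ^+ 2.
have k20 : 0 <= k2 by rewrite addr_ge0 ?sqr_ge0// ltW.
pose Cf := 4 * (1 + c) ^+ 2 * CW.
have Cf0 : 0 <= Cf by rewrite mulr_ge0 ?(ltW CW0)// mulr_ge0 ?sqr_ge0.
pose C := 8 * (2 * Cf + 4 * K + k1 ^+ 2 * k2) + 2 * c ^+ 2.
have C0 : 0 <= C.
  by rewrite /C; pos.
exists (C + 1); first by rewrite ltr_wpDl.
move=> t t1; have t0 : 0 < t by rewrite (lt_le_trans _ t1).
have [w f] := (aW t0, ac_flux t0); have [LH HH] := HK t t1.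
have [W2 Wx] := Wb t t1; have [Z0 _] := Zb t t1; have zl := Z_L2 t0.
have LW := ac_L2 l_ge0 w; have LF := ac_L2 l_ge0 f; have LZ := ac_L2 l_ge0 (ac_Z t0).
have p := ac_by_parts l_ge0 f w.
have iHW := L2M LH LW; have iFZ := L2M LF LZ; have iF2 := L2_sqr LF; have iZ2 := L2_sqr LZ.
rewrite /dissipation; set w2 := Int (fun x => W t x ^+ 2) in W2 zl *.
set A := Int (fun x => flux t x ^+ 2).
set Z2 := Int (fun x => Z t x ^+ 2) in zl.
set hw := Int (fun x => (G t x + U t x * G t x) * W t x).
have w20 : 0 <= w2 by apply: Int_ge0 => x _; rewrite sqr_ge0.
have Z20 : 0 <= Z2 by apply: Int_ge0 => x _; rewrite sqr_ge0.
have A0 : 0 <= A by apply: Int_ge0 => x _; rewrite sqr_ge0.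
have p' : hw + (A + Int (fun x => flux t x * Z t x)) = flux t l * W t l - flux t 0 * W t 0.
  rewrite -p IntD//; last by exact: ac_intbleM l_ge0 f (L2_intble (ac_L2 l_ge0 (aV t0))).
  rewrite /A -IntD//; congr (_ + _); apply: eq_Int => x _; rewrite /Z; ring.
have fz : - Int (fun x => flux t x * Z t x) <= 2^-1 * A + 2^-1 * Z2.
  rewrite -IntN// -!IntZ// -IntD; [|exact: intbleZ|exact: intbleZ].
  apply: le_Int => [||x _]; [exact: intbleN|by apply: intbleD; exact: intbleZ|].
  have := sqr_ge0 (flux t x + Z t x); rewrite !expr2; lra.
have hw2 : hw ^+ 2 <= K * w2 by rewrite (le_trans (CauchySchwarz LH LW))// ler_wpM2r.
set a := U t 0 in Z0 *; set b := U t l.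
have a2 : a ^+ 2 <= c ^+ 2 by rewrite -[leLHS]real_normK ?num_real// ler_pXn2r ?nnegrE ?(ltW c0)// Uc.
have z2 : Z2 <= k1 * (w2 + a ^+ 2).
  rewrite /k1 mulrAC ler_pdivlMr ?mulr_gt0// mulrC (le_trans zl)//.
  have h1 : 0 <= CZ * w2 by rewrite mulr_ge0// ltW.
  have := sqr_ge0 a; lra.
have z4 : Z2 ^+ 2 <= k1 ^+ 2 * k2 * (w2 + a ^+ 2).
  have wa0 : 0 <= w2 + a ^+ 2 by rewrite addr_ge0 ?sqr_ge0.
  have wa : w2 + a ^+ 2 <= k2 by rewrite lerD.
  have : Z2 ^+ 2 <= (k1 * (w2 + a ^+ 2)) ^+ 2 by rewrite ler_pXn2r ?nnegrE// mulr_ge0.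
  move/le_trans; apply; rewrite exprMn -mulrA ler_wpM2l ?sqr_ge0// expr2 ler_wpM2r//.
have fw x : 0 <= x <= l -> (2 * (flux t x * W t x)) ^+ 2 <= Cf * U t x ^+ 2.
  move=> xl; have h := flux_factor (Uc t x t1 xl).
  have -> : (2 * (flux t x * W t x)) ^+ 2 = 4 * (flux t x ^+ 2 * W t x ^+ 2) by ring.
  have -> : Cf * U t x ^+ 2 = 4 * ((1 + c) ^+ 2 * U t x ^+ 2 * CW) by rewrite /Cf; ring.
  by rewrite ler_wpM2l// ler_pM ?sqr_ge0// Wx.
have A1 : A <= 2 * (flux t l * W t l) + - (2 * (flux t 0 * W t 0)) + - (2 * hw) + Z2.
  by move: p' fz; lra.
have A2 : A ^+ 2 <= 4 * (Cf * b ^+ 2 + Cf * a ^+ 2 + 4 * (K * w2) + k1 ^+ 2 * k2 * (w2 + a ^+ 2)).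
  have h1 : A ^+ 2 <= (2 * (flux t l * W t l) + - (2 * (flux t 0 * W t 0)) + - (2 * hw) + Z2) ^+ 2.
    by rewrite ler_pXn2r ?nnegrE// (le_trans A0).
  rewrite (le_trans h1)// (le_trans (sqr_sum4 _ _ _ _))// ler_wpM2l// !sqrrN.
  rewrite lerD// lerD//; first by rewrite lerD//; apply: fw.
  by rewrite (_ : (2 * hw) ^+ 2 = 4 * hw ^+ 2); [rewrite ler_wpM2l|ring].
have a4 : (a ^+ 2) ^+ 2 <= c ^+ 2 * a ^+ 2 by rewrite expr2 ler_wpM2r ?sqr_ge0.
have f2 : Ff t ^+ 2 <= 2 * A ^+ 2 + 2 * (a ^+ 2) ^+ 2.
  by have := sqr_ge0 (A - a ^+ 2); rewrite /Ff -/A -/a !expr2; lra.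
have b20 := sqr_ge0 b; have a20 := sqr_ge0 a.
pose k3 := k1 ^+ 2 * k2; have k30 : 0 <= k3 by rewrite mulr_ge0 ?sqr_ge0.
have c20 := sqr_ge0 c.
have q1 := mulr_ge0 Cf0 w20; have q2 := mulr_ge0 K0 a20; have q3 := mulr_ge0 K0 b20.
have q4 := mulr_ge0 k30 b20; have q5 := mulr_ge0 c20 w20; have q6 := mulr_ge0 c20 b20.
have q7 := mulr_ge0 Cf0 a20; have q8 := mulr_ge0 Cf0 b20.
rewrite /C -/k3; rewrite -/k3 in A2.
move: (Cf) (k3) (K) (c ^+ 2) (a ^+ 2) (b ^+ 2) A2 a4 f2 b20 a20 q1 q2 q3 q4 q5 q6 q7 q8 => ? ? ? ? ? ?.
by move=> *; lra.
Qed.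

Lemma Ff_cvg0 e : 0 < e -> exists2 T, 1 <= T & forall t, T <= t -> Ff t <= e.
Proof.
have [c c0 Uc] := U_bounded; have [CW CW0 Wb] := W_bounded.
have [C C0 FC] := Ff_sqr_bound.
have [Phi [Phi' [B [m [m0 dP PB mP]]]]] := dissipation_bounded.
pose fm := c + 2^-1 * c ^+ 2.
have fm0 : 0 <= fm by rewrite addr_ge0 ?(ltW c0)// mulr_ge0 ?invr_ge0 ?sqr_ge0.
pose L := 2 * fm * (1 + c) * (CW + 1) * l + 2 * c * (CW + 1).
have L0 : 0 <= L.
  by rewrite /L; pos.
have k0 : 0 <= C / m by rewrite divr_ge0// ltW.
have Wn t x : 1 <= t -> 0 <= x <= l -> `|W t x| <= CW + 1.
  move=> t1 xl; apply: norm_le_sqr; first by rewrite addr_ge0// ltW.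
  have [_ /(_ x xl) h] := Wb t t1; rewrite (le_trans h)//.
  by have := sqr_ge0 CW; rewrite !expr2; lra.
apply: (@barbalat R Ff dFf (fun t => C / m * Phi t) (fun t => C / m * Phi' t) 1 L (C / m * B)) => // t t1;
  have t0 : 0 < t by rewrite (lt_le_trans _ t1).
- exact: Ff_derive.
- exact/isd_Z/dP.
- by rewrite addr_ge0 ?sqr_ge0// Int_ge0// => x _; rewrite sqr_ge0.
- have un := Uc t _ t1.
  rewrite (le_trans (ler_normD _ _))// lerD//; last first.
    by rewrite !normrM ger0_norm// ler_pM ?mulr_ge0 ?Wn// ler_wpM2l// un.
  apply: Int_abs_le => [x xl|].
    rewrite !normrM ger0_norm// -!mulrA ler_wpM2l// ler_pM//.
      rewrite (le_trans (ler_normD _ _))// lerD ?un// normrM ger0_norm ?invr_ge0// ler_wpM2l ?invr_ge0//.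
      by rewrite normrX ler_pXn2r ?nnegrE ?(ltW c0) ?un.
    have -> : W t x + U t x * W t x = (1 + U t x) * W t x by ring.
    by rewrite normrM ler_pM ?Wn// (le_trans (ler_normD _ _))// normr1 lerD2l un.
  have aw := acD (aW t0) (acM l_ge0 (aU t0) (aW t0)).
  by have := L2_intble (ac_L2 l_ge0 (acM l_ge0 (acZ 2 (ac_flux t0)) aw)).
- rewrite (le_trans (FC t t1))// -mulrA ler_wpM2l ?(ltW C0)//.
  by rewrite ler_pdivlMl// mP.
- by rewrite normrM ger0_norm// ler_wpM2l// PB.
Qed.

(** F(x)^2 is F(0)^2 plus an integral of 2 F F'. In Young's inequality the small weight [la] goes to
    F', bounded in L^2, and the large weight to F, whose L^2 norm tends to 0. *)
Lemma flux_cvg0 e : 0 < e -> exists2 T, 1 <= T & forall t, T <= t ->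
  U t 0 ^+ 2 <= e /\ forall x, 0 <= x <= l -> flux t x ^+ 2 <= e.
Proof.
move=> e0; have [c c0 Uc] := U_bounded; have [K K0 HK] := flux_derive_bound.
pose la := e / (2 * (K + 1)).
have K1 : 0 < K + 1 by rewrite ltr_wpDl.
have la0 : 0 < la by rewrite divr_gt0// mulr_gt0.
pose M := (1 + c) ^+ 2 + la^-1 + 1.
have M0 : 0 < M by rewrite /M; pos.
pose d := e / (2 * M).
have d0 : 0 < d by rewrite divr_gt0// mulr_gt0.
have dM : d * M = e / 2 by rewrite /d; field; exact: lt0r_neq0.
have [T T1 FT] := Ff_cvg0 d0; exists T => // t Tt.
have t1 := le_trans T1 Tt; have t0 : 0 < t by rewrite (lt_le_trans _ t1).
have := FT t Tt; rewrite /Ff; set A := Int _; set a2 := _ ^+ 2 => Fd.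
have A0 : 0 <= A by apply: Int_ge0 => x _; rewrite sqr_ge0.
have a20 : 0 <= a2 by exact: sqr_ge0.
have li0 : 0 < la^-1 by rewrite invr_gt0.
have c20 := sqr_ge0 (1 + c).
have dle : d <= e / 2 by rewrite -dM ler_peMr ?(ltW d0)// /M; lra.
split; first by lra.
move=> x xl; have f := ac_flux t0; have [LH HH] := HK t t1.
have LF := ac_L2 l_ge0 f; have f2 := acM l_ge0 f f; have i2 := f2.1.
have := acE f2 xl; rewrite -!expr2 => ->.
have fa : flux t 0 ^+ 2 <= (1 + c) ^+ 2 * a2 by apply: flux_factor; exact: Uc.
set H := fun x => G t x + U t x * G t x in LH HH *.
have iF := L2_sqr LF; have iH := L2_sqr LH.
have b : Int (fun y => chi x y * (H y * flux t y + flux t y * H y)) <= la^-1 * A + la * Int (fun y => H y ^+ 2).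
  rewrite -!IntZ// -IntD; [|exact: intbleZ|exact: intbleZ].
  apply: le_Int => [||y _]; [exact: intble_chi|by apply: intbleD; exact: intbleZ|].
  have q1 := mulr_ge0 (ltW li0) (sqr_ge0 (flux t y - la * H y)).
  have q2 := mulr_ge0 (ltW li0) (sqr_ge0 (flux t y + la * H y)).
  have e1 : la^-1 * (flux t y - la * H y) ^+ 2 = la^-1 * flux t y ^+ 2 + la * H y ^+ 2 - 2 * (H y * flux t y) by field; exact: lt0r_neq0.
  have e2 : la^-1 * (flux t y + la * H y) ^+ 2 = la^-1 * flux t y ^+ 2 + la * H y ^+ 2 + 2 * (H y * flux t y) by field; exact: lt0r_neq0.
  by rewrite /chi; case: (y < x) => /=; lra.
have hb : la * Int (fun y => H y ^+ 2) <= e / 2.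
  rewrite (le_trans (ler_wpM2l (ltW la0) HH))// /la mulrAC ler_pdivrMr ?mulr_gt0//.
  by rewrite mulrA divfK// ler_wpM2l ?(ltW e0)// lerDl.
have g1 : (1 + c) ^+ 2 * a2 + la^-1 * A <= M * d.
  have h1 : (1 + c) ^+ 2 * a2 <= (1 + c) ^+ 2 * d by rewrite ler_wpM2l//; lra.
  have h2 : la^-1 * A <= la^-1 * d by rewrite ler_wpM2l ?(ltW li0)//; lra.
  by rewrite /M; lra.
by rewrite [M * d]mulrC dM in g1; lra.
Qed.

Lemma U_cvg0 e : 0 < e -> exists2 T, 1 <= T & forall t x, T <= t -> 0 <= x <= l -> `|U t x| <= e.
Proof.
(* At U = -1 one has |F| = 1/2 > 1/4, so U cannot reach -1. Above -1 the factor 1 + U/2 exceeds 1/2,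
   and then |U| <= 2 |F| <= e. *)
move=> e0; pose d := Num.min (e / 2) 4^-1.
have d0 : 0 < d by rewrite lt_min; apply/andP; split; pos.
have [T T1 FT] := flux_cvg0 (exprn_gt0 2 d0); exists T => // t x Tt xl.
have t1 := le_trans T1 Tt; have t0 : 0 < t by rewrite (lt_le_trans _ t1).
have [u0 fx] := FT t Tt.
have d4 : d <= 4^-1 by rewrite ge_min lexx orbT.
have de : d <= e / 2 by rewrite ge_min lexx.
have fn y : 0 <= y <= l -> `|flux t y| <= d.
  by move=> yl; apply: norm_le_sqr; [exact: ltW|exact: fx].
have un : `|U t 0| <= d by apply: norm_le_sqr; [exact: ltW|exact: u0].
have U1 : -1 < U t x.
  rewrite ltNge; apply/negP => Ux.
  move: xl => /andP[x0 xl].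
  have cU : {within `[0, x], continuous (U t)}.
    apply: continuous_subspaceW (ac_continuous l_ge0 (aU t0)).
    by move=> y; rewrite /= !in_itv/= => /andP[-> /le_trans]; exact.
  have u1 : -1 <= U t 0 by move: un; rewrite ler_norml => /andP[]; lra.
  have [|y] := @IVT R (U t) 0 x (-1) x0 cU.
    by rewrite ge_min le_max Ux u1 orbT.
  rewrite in_itv/= => /andP[y0 yx] Uy.
  have := fn y; rewrite y0 (le_trans yx xl) => /(_ isT).
  by rewrite /flux Uy ler_norml => /andP[]; lra.
have := fn x xl.
have -> : flux t x = (1 + 2^-1 * U t x) * U t x by rewrite /flux; ring.
rewrite normrM ger0_norm; last by lra.
have : 2^-1 * `|U t x| <= (1 + 2^-1 * U t x) * `|U t x| by rewrite ler_wpM2r//; lra.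
by lra.
Qed.

Lemma G_bounded : exists2 K, 0 <= K & forall t, 1 <= t -> Int (fun x => G t x ^+ 2) <= K.
Proof.
exists (energy 1); first by rewrite addr_ge0// Int_ge0// => x _; rewrite sqr_ge0.
move=> t t1; rewrite (le_trans _ (energy_le t1))// lerDr Int_ge0// => x _; exact: sqr_ge0.
Qed.

End Dynamics.

(** Converse of [is_derive_eps]; it gives the convergence of the averages of a continuous
    function. *)
Lemma is_derive_diff (R : realType) (f : R -> R) (x d e : R) : is_derive x 1 f d -> 0 < e ->
  exists2 r : R, 0 < r & forall h : R, `|h| < r -> `|f (x + h) - f x - h * d| <= e * `|h|.
Proof.
move=> [df dE] e0; have : (fun h : R => h^-1 *: ((f \o shift x) (h *: 1) - f x)) @ 0^' --> d.
  by rewrite -dE.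
move=> /cvgrPdist_le/(_ e e0); rewrite /dnbhs/within/= => /nbhs_ballP[r /= r0 H].
exists r => // h hr; have [->|h0] := eqVneq h 0.
  by rewrite addr0 subrr mul0r subr0 normr0 mulr0.
have := H h; rewrite /ball/= sub0r normrN => /(_ hr h0).
rewrite scaler1 [h + x]addrC distrC => E.
have -> : f (x + h) - f x - h * d = h * (h^-1 *: (f (x + h) - f x) - d).
  by rewrite /GRing.scale/=; field.
by rewrite normrM mulrC ler_wpM2r.
Qed.

(** * Passage from a solution to its continuous representatives *)

Section SolutionDecay.
Variables (R : realType) (l mu0 mul : R) (u0 : R -> R) (u : R -> R -> R).
Hypotheses (l_gt0 : 0 < l) (mu0_gt : 2^-1 < mu0) (mul_lt : mul < 2^-1).
Hypothesis u_sol : bbm_solution l mu0 mul u0 u.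
Let l_ge0 : 0 <= l := ltW l_gt0.
Local Notation Int := (Int l).

Lemma bbm_decay :
  (forall e, 0 < e -> exists2 T : R, 1 <= T &
    forall t x, T <= t -> 0 <= x <= l -> `|cont_rep l (u t) x| <= e) /\
  (exists2 K : R, 0 <= K & forall t, 1 <= t -> Int (fun x => wderiv l (u t) x ^+ 2) <= K).
Proof.
have [[Hu _] [ut [dut [Hut _] pde bc _]]] := u_sol.
pose U t := cont_rep l (u t); pose G t := wderiv l (u t).
pose W t := cont_rep l (ut t); pose V t := cont_rep l (wderiv l (ut t)).
pose X t := wderiv l (wderiv l (ut t)).
have Hut1 t : 0 <= t -> Hk l 1 (ut t) by move=> /Hut/(Hk2P l_gt0)[].
have aU t : 0 < t -> ac l (U t) (G t) by move=> /ltW/Hu/(H1_rep l_gt0)[].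
have LG t : 0 < t -> L2 l (G t) by move=> /ltW/Hu/(Hk1P l_gt0)[].
have aV t : 0 < t -> ac l (V t) (X t).
  by move=> /ltW/Hut/(Hk2P l_gt0)[_ /(H1_rep l_gt0)[]].
have eV t : 0 < t -> aeq l (V t) (wderiv l (ut t)).
  by move=> /ltW/Hut/(Hk2P l_gt0)[_ /(H1_rep l_gt0)[]].
have aW t : 0 < t -> ac l (W t) (V t).
  move=> t0; have [h _] := H1_rep l_gt0 (Hut1 t (ltW t0)).
  by apply: (ac_ae h); [exact: ac_meas (aV t t0)|exact/aeq_sym/eV].
have pde' t : 0 < t -> aeq l (fun x => X t x - (G t x + U t x * G t x)) (W t).
  move=> t0; have [_ eU] := H1_rep l_gt0 (Hu t (ltW t0)); have [_ eW] := H1_rep l_gt0 (Hut1 t (ltW t0)).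
  have := ae_impl2 _ eU eW => /(_ (fun x => x \in `]0, l[ -> U t x = u t x /\ W t x = ut t x)).
  move=> /(_ (fun x a b xD => conj (a xD) (b xD))) eUW.
  apply: ae_impl2 eUW (pde t (ltW t0)) => x e p xD; have [-> ->] := e xD; have := p xD.
  by rewrite -/(X t x) -/(G t x) => h; lra.
have bc0 t : 0 < t -> V t 0 = mu0 * U t 0 + 3^-1 * U t 0 ^+ 2 by move=> /ltW/bc[].
have bcl t : 0 < t -> V t l = mul * U t l + 3^-1 * U t l ^+ 2 by move=> /ltW/bc[].
have dU t : 0 < t -> ud l t U (W t).
  move=> t0; split.
  - by move=> s s0; exact: ac_continuous (aU s s0).
  - exact: ac_continuous (aW t t0).
  move=> e e0; have [r r0 h] := time_deriv_eps l_gt0 Hu Hut1 dut t0 e0.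
  by exists r => // k kr; have [] := h k kr.
have dG t : 0 < t -> forall e, 0 < e -> exists2 r : R, 0 < r & forall k : R, `|k| < r ->
    Int (fun x => (G (t + k) x - G t x - k * V t x) ^+ 2) <= e ^+ 2 * k ^+ 2.
  move=> t0 e e0; have [r r0 h] := time_deriv_eps l_gt0 Hu Hut1 dut t0 e0.
  exists (Num.min r t); first by rewrite lt_min r0.
  move=> k; rewrite lt_min => /andP[kr]; rewrite ltr_norml => /andP[kt _].
  have tk : 0 < t + k by lra.
  have [_ {}h] := h k kr; rewrite (le_trans _ h)//.
  have Lw : L2 l (wderiv l (ut t)) by have [] := Hk1P l_gt0 (Hut1 t (ltW t0)).
  have LV := ac_L2 l_ge0 (aV t t0).
  rewrite le_eqVlt; apply/orP; left; apply/eqP; apply: eq_Int_ae.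
  - by apply: (@intble_meas _ l); apply: L2_sqr; apply: L2B; [apply: L2B; exact: LG|exact: L2Z].
  - by apply: (@intble_meas _ l); apply: L2_sqr; apply: L2B; [apply: L2B; exact: LG|exact: L2Z].
  by apply: ae_impl (eV t t0) => x + xD => /(_ xD) ->.
split; last exact: (G_bounded l_gt0 mu0_gt mul_lt aU LG aW aV pde' bc0 bcl dU dG).
exact: (U_cvg0 l_gt0 mu0_gt mul_lt aU LG aW aV pde' bc0 bcl dU dG).
Qed.

End SolutionDecay.

(** * Weak convergence *)

Lemma sign_mul_quarter (R : realFieldType) (a y : R) : a ^+ 2 = 1 -> `|y| <= 4^-1 -> 2 * a * y <= 2^-1.
Proof.
move=> a2 hy; have a1 : `|a| = 1 by apply/eqP; rewrite -sqrp_eq1// real_normK ?num_real// a2.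
by apply: (le_trans (ler_norm _)); rewrite !normrM a1 ger0_norm// mulr1; lra.
Qed.

Lemma sum_quarter (R : realFieldType) (a b c d n C x y : R) : a + b <= n * (C + 1) ->
  c + d <= C -> x <= 2^-1 -> y <= 2^-1 -> (c + a + x) + (d + b + y) <= (n + 1) * (C + 1).
Proof. by move=> ? ? ? ?; rewrite [leRHS]mulrDl mul1r; lra. Qed.

Section WeakConvergence.
Variables (R : realType) (l : R) (u : R -> R -> R).
Hypothesis l_gt0 : 0 < l.
Let l_ge0 : 0 <= l := ltW l_gt0.
Local Notation mu := (@lebesgue_measure R).
Local Notation D := (`]0, l[%classic : set R).
Local Notation intble := (intble l).
Local Notation Int := (Int l).
Local Notation ac := (ac l).
Implicit Types (f g h : R -> R) (a t x e c : R).
Hypothesis u_H1 : forall t, 0 <= t -> Hk l 1 (u t).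
Hypothesis U_cvg : forall e, 0 < e -> exists2 T : R, 1 <= T &
    forall t x, T <= t -> 0 <= x <= l -> `|cont_rep l (u t) x| <= e.
Variable K : R.
Hypothesis K_ge0 : 0 <= K.
Hypothesis G_bnd : forall t, 1 <= t -> Int (fun x => wderiv l (u t) x ^+ 2) <= K.
Local Notation U t := (cont_rep l (u t)).
Local Notation G t := (wderiv l (u t)).
Local Hint Extern 0 (measurable _) => exact: measurable_D : core.

Let aU t : 1 <= t -> ac (U t) (G t).
Proof. by move=> t1; have [] := H1_rep l_gt0 (u_H1 (le_trans ler01 t1)). Qed.

Let LG t : 1 <= t -> L2 l (G t).
Proof. by move=> t1; have [] := Hk1P l_gt0 (u_H1 (le_trans ler01 t1)). Qed.

(** Asymptotic orthogonality of u_x to [g]. Such functions [g] form a class closed in L^2, thanks to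
    the bound [K]; it is enlarged from absolutely continuous to continuous functions, then to all of
    L^2. *)
Definition null_against g := forall e, 0 < e ->
  exists2 T : R, 1 <= T & forall t, T <= t -> `|Int (fun x => g x * G t x)| <= e.

Lemma null_against_closure g : L2 l g ->
  (forall d : R, 0 < d -> exists h, [/\ L2 l h, null_against h & Int (fun x => (g x - h x) ^+ 2) <= d]) ->
  null_against g.
Proof.
move=> Lg H e e0.
pose d := (e / 2) ^+ 2 / (K + 1).
have K1 : 0 < K + 1 by rewrite ltr_wpDl.
have d0 : 0 < d by rewrite divr_gt0// exprn_gt0// divr_gt0.
have [h [Lh nh gh]] := H d d0; have [T T1 hT] := nh (e / 2) (divr_gt0 e0 (ltr0n _ 2)).
exists T => // t Tt; have t1 := le_trans T1 Tt; have LGt := LG t1.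
have Lgh := L2B Lg Lh.
have -> : Int (fun x => g x * G t x) = Int (fun x => (g x - h x) * G t x) + Int (fun x => h x * G t x).
  rewrite -IntD; [|exact: L2M|exact: L2M].
  by apply: eq_Int => x _; ring.
rewrite (le_trans (ler_normD _ _))// [leRHS]splitr lerD ?hT//.
apply: norm_le_sqr; first by rewrite divr_ge0// ltW.
rewrite (le_trans (CauchySchwarz Lgh LGt))//.
have -> : (e / 2) ^+ 2 = d * (K + 1) by rewrite /d divfK// gt_eqF.
apply: ler_pM => //; first by apply: Int_ge0 => x _; exact: sqr_ge0.
  by apply: Int_ge0 => x _; exact: sqr_ge0.
by rewrite (le_trans (G_bnd t1))// lerDl.
Qed.

(** By parts the derivative moves from U to [h], and every resulting term contains U, which tends to
    0 uniformly. *)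
Lemma null_against_ac h h' : ac h h' -> null_against h.
Proof.
move=> ah e e0; have [c c0 hc] := ac_bounded l_ge0 ah.
pose M := 2 * c + Int (fun x => `|h' x|) + 1.
have ih := ah.1; have I0 : 0 <= Int (fun x => `|h' x|) by exact: Int_ge0.
have M0 : 0 < M by rewrite /M; lra.
have [T T1 hT] := U_cvg (divr_gt0 e0 M0); exists T => // t Tt; have t1 := le_trans T1 Tt.
have Ut x := hT t x Tt.
have p := ac_by_parts l_ge0 ah (aU t1).
have i1 : intble (fun x => h' x * U t x).
  by under eq_fun do rewrite mulrC; exact: ac_intbleM (aU t1) ih.
have i2 : intble (fun x => h x * G t x) by exact: ac_intbleM ah (aU t1).1.
rewrite IntD// in p.
have -> : Int (fun x => h x * G t x) = h l * U t l - h 0 * U t 0 - Int (fun x => h' x * U t x).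
  by rewrite -p; ring.
have b0 : 0 <= (0 : R) <= l by rewrite lexx. have bl : 0 <= l <= l by rewrite lexx andbT.
have n1 x : 0 <= x <= l -> `|h x * U t x| <= c * (e / M).
  by move=> xl; rewrite normrM ler_pM ?hc ?Ut.
have n2 : `|Int (fun x => h' x * U t x)| <= Int (fun x => `|h' x|) * (e / M).
  rewrite (le_trans (le_abs_Int i1))// mulrC -IntZ; last exact: intble_abs.
  apply: le_Int => [||x /itv_oo_cc xl]; [exact: intble_abs|exact/intbleZ/intble_abs|].
  by rewrite normrM mulrC ler_wpM2r// Ut.
have := n1 _ b0; have := n1 _ bl; move: n2; rewrite !ler_norml.
have eM : (2 * c + Int (fun x => `|h' x|) + 1) * (e / M) = e by rewrite -/M mulrC divfK// gt_eqF.
have eM0 : 0 < e / M by rewrite divr_gt0.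
by move=> /andP[? ?] /andP[? ?] /andP[? ?]; apply/andP; split; lra.
Qed.

Lemma L2_approx (g : R -> R) (g_ : nat -> R -> R) b : L2 l g -> (forall n, L2 l (g_ n)) ->
  (forall x, D x -> g_ n x @[n --> \oo] --> g x) -> intble b ->
  (forall n x, D x -> (g x - g_ n x) ^+ 2 <= b x) ->
  forall d : R, 0 < d -> exists n, Int (fun x => (g x - g_ n x) ^+ 2) <= d.
Proof.
move=> Lg Lg_ cv ib bnd d d0.
have Ld n : intble (fun x => (g x - g_ n x) ^+ 2) by apply: L2_sqr; exact: L2B.
pose z : R -> R := fun=> 0.
have [] := @dominated_convergence _ _ _ mu D (measurable_D l)
    (fun n x => ((g x - g_ n x) ^+ 2)%:E) (EFin \o z) (EFin \o b).
- by move=> n; apply/measurable_EFinP; exact: (intble_meas (Ld n)).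
- by apply/measurable_EFinP; exact: measurable_cst.
- apply: aeW => x Dx; apply: cvg_EFin; first by near=> n.
  have h : (g x - g_ n x) ^+ 2 @[n --> \oo] --> z x.
    rewrite (_ : z x = (g x - g x) * (g x - g x)); last by rewrite subrr mulr0.
    by apply: cvgM; apply: cvgB; [exact: cvg_cst|exact: cv|exact: cvg_cst|exact: cv].
  exact: h.
- exact: ib.
- by apply: aeW => x n Dx /=; rewrite lee_fin ger0_norm ?sqr_ge0// bnd.
move=> _ _; rewrite (_ : (\int[mu]_(x in D) (EFin \o z) x)%E = (0 : R)%:E); last first.
  by rewrite (EFin_Int (intble_cst l 0)) Int0.
move=> /fine_cvgP[_ /cvgrPdist_lt/(_ d d0)][N _ HN]; exists N; have := HN N (leqnn N).
rewrite /= sub0r normrN /= => h.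
apply: (le_trans (ler_norm _)); apply: ltW; exact: h.
Unshelve. all: by end_near. Qed.

(** [h] is replaced by its averages over [x, x + 1/(n+1)], which are continuously differentiable and
    bounded independently of n. *)
Lemma null_against_continuous h : continuous h -> null_against h.
Proof.
move=> ch.
have cw (A : set R) : {within A, continuous h} by exact: continuous_subspaceT.
apply: null_against_closure; first exact: cont_L2.
(* The lower limit -1 makes [H] differentiable on a neighbourhood of [0,l], so at 0 too. *)
pose H x := \int[mu]_(y in `[-1, x]) h y.
have dH x : -1 < x -> is_derive x 1 H (h x).
  move=> x1; have xx : x < x + 1 by rewrite ltrDl.
  have ix : mu.-integrable `[-1, (x + 1)] (EFin \o h).
    by apply: continuous_compact_integrable; [exact: segment_compact|exact: cw].
  have [d1 <-] := continuous_FTC1_closed xx ix x1 (ch x).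
  by rewrite derive1E; exact: derivableP.
pose h_ (n : nat) x := n.+1%:R * (H (x + n.+1%:R^-1) - H x).
have n1 (n : nat) : 0 < n.+1%:R^-1 :> R by rewrite invr_gt0 ltr0n.
have n2 (n : nat) : n.+1%:R^-1 <= 1 :> R by rewrite invf_le1 ?ltr0n// ler1n.
have acn n : ac (h_ n) (fun x => n.+1%:R * (h (x + n.+1%:R^-1) - h x)).
  apply: ac_derive_cc => [|x /andP[x0 xl]|]; first exact: l_ge0.
    have xm1 : -1 < x by lra.
    have xn : -1 < x + n.+1%:R^-1 by rewrite (lt_le_trans xm1)// lerDl ltW// n1.
    apply: isd_Z; apply: isd_B; last exact: dH.
    have ds : is_derive x 1 (fun y => y + n.+1%:R^-1) 1.
      by apply: (isd_eq (isd_D (isd_id x) (isd_cst n.+1%:R^-1 x))); rewrite addr0.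
    by apply: (isd_eq (@isd_comp R H (fun y => y + n.+1%:R^-1) x _ _ (dH _ xn) ds)); rewrite mulr1.
  have cc : continuous (fun x => n.+1%:R * (h (x + n.+1%:R^-1) - h x)).
    move=> x; apply: cvgM; first exact: cvg_cst.
    apply: cvgB; last exact: ch.
    have cs : {for x, continuous (fun y : R => y + n.+1%:R^-1)}.
      by apply: cvgD; [exact: cvg_id|exact: cvg_cst].
    exact: (continuous_comp cs (ch _)).
  exact: continuous_subspaceT.
(* The averages look up to a distance 1 beyond l. *)
have [c c0 hc] := @continuous_bounded R (l + 1) h (cw _).
have hn n x : 0 <= x <= l -> `|h_ n x| <= c.
  move=> /andP[x0 xl]; have xx : x <= x + n.+1%:R^-1 by rewrite lerDl ltW.
  have [||y] := @MVT_segment R H h x (x + n.+1%:R^-1) xx.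
  - by move=> y; rewrite in_itv/= => /andP[xy _]; apply: dH; lra.
  - apply: derivable_within_continuous => y; rewrite in_itv/= => /andP[xy _].
    by have [] : is_derive y 1 H (h y) by apply: dH; lra.
  rewrite in_itv/= => /andP[xy yx] E.
  rewrite /h_ E addrAC subrr add0r mulrCA divff ?mulr1 ?hc// ?pnatr_eq0//.
  by rewrite (le_trans x0 xy)/= (le_trans yx)// lerD.
move=> d d0.
have [|||n hnd] := @L2_approx h h_ (fun=> (2 * c) ^+ 2) (cont_L2 (cw _)) _ _ (intble_cst _ _) _ d d0.
- by move=> n; exact: ac_L2 (acn n).
- move=> x Dx; have := itv_oo_cc Dx => /andP[x0 xl].
  have dx : is_derive x 1 H (h x) by apply: dH; lra.
  apply/cvgrPdist_le => e e0; have [r r0 hr] := is_derive_diff dx e0.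
  near=> n; have nr : n.+1%:R^-1 < r by near: n; exact: (near_infty_natSinv_lt (PosNum r0)).
  have N0 : 0 < n.+1%:R :> R by rewrite ltr0n.
  have := hr n.+1%:R^-1; rewrite gtr0_norm// => /(_ nr) hrn.
  rewrite distrC (_ : h_ n x - h x = n.+1%:R * (H (x + n.+1%:R^-1) - H x - n.+1%:R^-1 * h x)).
    by rewrite normrM gtr0_norm// [leLHS]mulrC -ler_pdivlMr.
  by rewrite /h_ [RHS]mulrBr mulVKf ?gt_eqF.
- move=> n x /itv_oo_cc xl; have := hn n x xl; have : `|h x| <= c by apply: hc; move: xl => /andP[-> ?] /=; lra.
  rewrite !ler_norml => /andP[? ?] /andP[? ?]; rewrite -subr_ge0 subr_sqr mulr_ge0//; lra.
by exists (h_ n); split => //; [exact: ac_L2 (acn n)|exact: null_against_ac (acn n)].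
Unshelve. all: by end_near. Qed.

(** Truncation at height M, then continuous approximation in L^1. Truncating the approximant as well
    bounds the squared difference by 2 M times the absolute difference, which upgrades L^1 to L^2
    closeness. *)
Lemma null_against_L2 g : L2 l g -> null_against g.
Proof.
move=> Lg; apply: null_against_closure => // d d0.
pose clip (M : R) y : R := Num.max (- M) (Num.min y M).
have clipb M y : 0 <= M -> `|clip M y| <= M.
  by move=> M0; rewrite ler_norml /clip le_max lexx/= ge_max ge_min lexx orbT andbT; lra.
have clip_id M y : `|y| <= M -> clip M y = y.
  by rewrite ler_norml /clip => /andP[h1 h2]; rewrite min_l// max_r.
have clip_lip M y z : `|clip M y - clip M z| <= `|y - z|.
  rewrite /clip !maxEle !minEle; do ! case: ifPn; rewrite -?ltNge => *;
  rewrite ler_norml; have := ler_norm (y - z); have := ler_norm (z - y); rewrite (distrC z y) => *; apply/andP; split; lra.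
have clip_le M y : 0 <= M -> (y - clip M y) ^+ 2 <= y ^+ 2.
  move=> M0; rewrite /clip maxEle minEle; do ! case: ifPn; rewrite -?ltNge => *; rewrite !expr2; nra.
have clip_meas M f : measurable_fun D f -> measurable_fun D (fun x => clip M (f x)).
  by move=> mf; apply: measurable_maxr => //; exact: measurable_minr.
have Lclip M f : 0 <= M -> measurable_fun D f -> L2 l (fun x => clip M (f x)).
  by move=> M0 mf; apply: (@L2_bound _ _ _ M) => [|x _]; [exact: clip_meas|exact: clipb].
have mg := L2_meas Lg.
have [|||n hn] := @L2_approx g (fun n x => clip n%:R (g x)) (fun x => g x ^+ 2) Lg _ _ (L2_sqr Lg) _ (d / 4) (divr_gt0 d0 (ltr0n _ 4)).
- by move=> n; exact: Lclip.
- move=> x _; apply: cvg_near_cst; near=> n; apply: clip_id; near: n.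
  exact: nbhs_infty_ger.
- by move=> n x _; exact: clip_le.
set M : R := n%:R in hn; have M0 : 0 <= M by exact: ler0n.
pose gM x := clip M (g x); have LgM : L2 l gM by exact: Lclip.
have [h_ [ch ih /fine_cvgP[_ /cvgrPdist_lt h0]]] := @approximation_continuous_integrable R D gM (measurable_D l) (mu_D_fin l) (L2_intble LgM).
(* This error is multiplied by 4 M below and then costs at most d/2; the truncation error d/4 is
   doubled and costs the other half. *)
have e1 : 0 < d / (8 * M + 1) by rewrite divr_gt0// ltr_wpDl// mulr_ge0.
have [N _ HN] := h0 _ e1; have {HN} := HN N (leqnn N).
set h := h_ N in ch *; have {ih}ih : intble h by exact: ih.
have cN : continuous h by exact: ch.
have iabs : intble (fun x => `|gM x - h x|) by apply: intble_abs; apply: intbleB => //; exact: L2_intble.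
rewrite /= sub0r normrN => hN.
have {hN}hN : Int (fun x => `|gM x - h x|) <= d / (8 * M + 1).
  by rewrite (le_trans (ler_norm _))// ltW.
have cclip : continuous (fun x => clip M (h x)).
  move=> x; apply: (@continuous_max _ _ (fun=> - M) (fun x => Num.min (h x) M)); first exact: cvg_cst.
  by apply: (@continuous_min _ _ h (fun=> M)); [exact: cN|exact: cvg_cst].
exists (fun x => clip M (h x)); split; [by apply: Lclip => //; exact: intble_meas ih|exact: null_against_continuous|].
have LhM : L2 l (fun x => clip M (h x)) by apply: Lclip => //; exact: intble_meas ih.
have i1 := L2_sqr (L2B Lg LgM).
apply: (@le_trans _ _ (2 * Int (fun x => (g x - gM x) ^+ 2) + 4 * M * Int (fun x => `|gM x - h x|))).
  rewrite -!IntZ// -IntD; [|exact: intbleZ|exact: intbleZ].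
  apply: le_Int => [||x _]; [by apply: L2_sqr; exact: L2B|by apply: intbleD; exact: intbleZ|].
  have q0 : (gM x - clip M (h x)) ^+ 2 <= 2 * M * `|gM x - h x|.
    rewrite -real_normK ?num_real// expr2 ler_pM//; last first.
      have eG : gM x = clip M (gM x) by rewrite clip_id// clipb.
      by rewrite {1}eG; exact: clip_lip.
    rewrite (le_trans (ler_normB _ _))// (_ : 2 * M = M + M); last by ring.
    by rewrite lerD// clipb.
  have := sqr_ge0 ((g x - gM x) - (gM x - clip M (h x))).
  by move: q0; rewrite !expr2; lra.
have h1 : 4 * M * Int (fun x => `|gM x - h x|) <= 4 * M * (d / (8 * M + 1)) by rewrite ler_wpM2l// mulr_ge0.
have h2 : 4 * M * (d / (8 * M + 1)) <= d / 2.
  rewrite mulrA ler_pdivrMr; last by rewrite ltr_wpDl// mulr_ge0.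
  lra.
by move: hn; rewrite -/gM; lra.
Unshelve. all: by end_near. Qed.

Lemma H1_cst0 : Hk l 1 (fun=> 0 : R) /\ H1sq l (fun=> 0) = 0.
Proof.
have a0 : ac (fun=> 0 : R) (fun=> 0) := ac_cst l 0.
have L0 : L2 l (fun=> 0 : R) := ac_L2 l_ge0 a0.
have w0 : is_wderiv l (fun=> 0 : R) (fun=> 0) by apply: (ac_is_wderiv l_ge0 a0 (L2_intble L0)); exact: aeW.
split; first exact: (Hk1_intro L0 L0 w0).
have [Lw _ e] := wderivP l_gt0 L0 w0.
rewrite /H1sq (_ : Int (fun x => wderiv l (fun=> 0) x ^+ 2) = 0); last first.
  rewrite -[RHS](Int0 l); apply: eq_Int_ae; [exact: intble_meas (L2_sqr Lw)|exact: measurable_cst|].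
  by apply: ae_impl e => x + xD => /(_ xD) ->; rewrite expr0n.
by under eq_Int do rewrite expr0n; rewrite Int0 addr0.
Qed.

Lemma Int_sqr_lin a f g : a ^+ 2 = 1 -> L2 l f -> L2 l g ->
  Int (fun x => (a * f x + g x) ^+ 2) =
  Int (fun x => f x ^+ 2) + Int (fun x => g x ^+ 2) + 2 * a * Int (fun x => g x * f x).
Proof.
move=> a2 Lf Lg; have [[i1 i2] i3] := (L2_sqr Lf, L2_sqr Lg, L2M Lg Lf).
rewrite -IntZ// -!IntD//; [|exact: intbleD|exact: intbleZ].
by apply: eq_Int => x _; rewrite sqrrD exprMn a2 !mulrA; ring.
Qed.

(** The next term u(t) is taken so late that its L^2 products with S, and of the derivatives, are at
    most 1/4. Each cross term then adds at most 1/2, whence C + 1 per term. The sign of the new term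
    makes [L] gain at least [eps]. *)
Lemma gliding_sum (C eps T0 : R) (L : (R -> R) -> R) : 1 <= T0 -> 0 < eps -> 0 <= C ->
  (forall a f g, Hk l 1 f -> Hk l 1 g -> L (fun x => a * f x + g x) = a * L f + L g) ->
  (forall t, T0 <= t -> H1sq l (u t) <= C) ->
  (forall T, exists2 t, T <= t & eps <= `|L (u t)|) ->
  forall n : nat, exists S : R -> R, [/\ Hk l 1 S, n%:R * eps <= L S & H1sq l S <= n%:R * (C + 1)].
Proof.
move=> T01 eps0 C0 linL uC big; have [H0 Z0] := H1_cst0.
elim=> [|n [S [HS LS S2]]].
  exists (fun=> 0); split; rewrite ?mul0r ?Z0//.
  have := linL (-1) _ _ H0 H0; rewrite (_ : (fun x : R => -1 * 0 + 0) = (fun=> 0)); last first.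
    by apply/funext => x; rewrite mulr0 addr0.
  by rewrite mulN1r addNr => ->.
have [LS1 LdS _] := Hk1P l_gt0 HS.
have q0 : 0 < 4^-1 :> R by [].
have [T1 T11 hT1] := null_against_L2 LdS q0.
have iS : intble (fun x => `|S x|) by apply: intble_abs; exact: L2_intble.
have I0 : 0 <= Int (fun x => `|S x|) by exact: Int_ge0.
have M0 : 0 < 4 * (Int (fun x => `|S x|) + 1) by rewrite mulr_gt0// ltr_wpDl.
have [T2 T21 hT2] : exists2 T, 1 <= T & forall t x, T <= t -> 0 <= x <= l ->
  `|cont_rep l (u t) x| <= (4 * (Int (fun x => `|S x|) + 1))^-1 by apply: U_cvg; rewrite invr_gt0.
have [t tT Lt] := big (Num.max T0 (Num.max T1 T2)).
move: tT; rewrite !ge_max => /and3P[tT0 tT1 tT2]; have t1 := le_trans T11 tT1.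
have Hu := u_H1 (le_trans ler01 t1); have [Lu LGt _] := Hk1P l_gt0 Hu.
have [aUt eU] := H1_rep l_gt0 Hu.
have X1 : `|Int (fun x => S x * u t x)| <= 4^-1.
  have i1 : intble (fun x => S x * u t x) by exact: L2M.
  have -> : Int (fun x => S x * u t x) = Int (fun x => S x * U t x).
    apply: eq_Int_ae; [exact: intble_meas i1|exact: intble_meas (L2M LS1 (ac_L2 l_ge0 aUt))|].
    by apply: ae_impl eU => x + xD => /(_ xD) ->.
  have i2 : intble (fun x => S x * U t x) by exact: L2M (ac_L2 l_ge0 aUt).
  rewrite (le_trans (le_abs_Int i2))//.
  apply: (@le_trans _ _ (Int (fun x => (4 * (Int (fun x => `|S x|) + 1))^-1 * `|S x|))).
    apply: le_Int => [||x /itv_oo_cc xl]; [exact: intble_abs|exact: intbleZ|].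
    by rewrite normrM mulrC ler_wpM2r// hT2.
  by rewrite IntZ// mulrC ler_pdivrMr// mulKf ?pnatr_eq0// lerDl ler01.
have X2 := hT1 t tT1.
have [sg [sg2 sgL]] : exists sg : R, sg ^+ 2 = 1 /\ `|L (u t)| = sg * L (u t).
  have [L0|L0] := leP 0 (L (u t)); [exists 1|exists (-1)]; rewrite ?expr1n ?sqrrN ?expr1n; split=> //.
    by rewrite ger0_norm// mul1r.
  by rewrite ltr0_norm// mulN1r.
have [Hk ek] := H1_lin l_gt0 sg 1 Hu HS.
have E : (fun x => sg * u t x + 1 * S x) = (fun x => sg * u t x + S x).
  by apply/funext => x; rewrite mul1r.
rewrite E in Hk ek.
exists (fun x => sg * u t x + S x); split => //.
  by rewrite linL// -sgL -natr1 mulrDl mul1r addrC lerD.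
have e1 := Int_sqr_lin sg2 Lu LS1; have e2 := Int_sqr_lin sg2 LGt LdS.
have Lk : L2 l (fun x => sg * G t x + wderiv l S x) by apply: L2D => //; exact: L2Z.
have e3 : Int (fun x => wderiv l (fun x => sg * u t x + S x) x ^+ 2) =
    Int (fun x => (sg * G t x + wderiv l S x) ^+ 2).
  have [_ Lw _] := Hk1P l_gt0 Hk.
  apply: eq_Int_ae; [exact: intble_meas (L2_sqr Lw)|exact: intble_meas (L2_sqr Lk)|].
  by apply: ae_impl ek => x + xD => /(_ xD) ->; rewrite mul1r.
have := uC t tT0; move: S2; rewrite /H1sq -natr1 e3 e1 e2.
move=> S2' uCt; exact: sum_quarter S2' uCt (sign_mul_quarter sg2 X1) (sign_mul_quarter sg2 X2).
Qed.

Lemma weak_cvg0 : H1_weak_cvg l u (cst 0).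
Proof.
move=> L [linL [C LC]]; have [H0 Z0] := H1_cst0.
have L0 : L (cst 0) = 0.
  have := linL (-1) _ _ H0 H0; rewrite (_ : (fun x : R => -1 * 0 + 0) = (fun=> 0)); last first.
    by apply/funext => x; rewrite mulr0 addr0.
  by rewrite mulN1r addNr.
rewrite L0; apply/cvgrPdist_le => e e0.
have [T hT] : exists T, forall t, T <= t -> `|L (u t)| < e.
  apply: contrapT => nT.
  have big T : exists2 t, T <= t & e <= `|L (u t)|.
    apply: contrapT => nt; apply: nT; exists T => t Tt; rewrite ltNge; apply/negP => et.
    by apply: nt; exists t.
  have [T1 T11 hT1] := U_cvg ltr01.
  (* Past [T1] the bound |U| <= 1 holds, so the L^2 part of the norm contributes at most l. *)
  have uC t : T1 <= t -> H1sq l (u t) <= l + K.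
    move=> tT1; have t1 := le_trans T11 tT1.
    have [aUt eU] := H1_rep l_gt0 (u_H1 (le_trans ler01 t1)).
    have [Lu _ _] := Hk1P l_gt0 (u_H1 (le_trans ler01 t1)).
    apply: lerD; last exact: G_bnd.
    have LU := L2_sqr (ac_L2 l_ge0 aUt).
    have -> : Int (fun x => u t x ^+ 2) = Int (fun x => U t x ^+ 2).
      apply: eq_Int_ae; [exact: intble_meas (L2_sqr Lu)|exact: intble_meas LU|].
      by apply: ae_impl eU => x + xD => /(_ xD) ->.
    rewrite -[leRHS]mul1r -(Int_cst 1 l_ge0); apply: le_Int => // [|x /itv_oo_cc xl].
      exact: intble_cst.
    by rewrite -real_normK ?num_real// expr_le1// hT1.
  have C'0 : 0 <= l + K + 1 by rewrite !addr_ge0.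
  have key (n : nat) : n%:R * e ^+ 2 <= C ^+ 2 * (l + K + 1).
    case: n => [|n]; first by rewrite mul0r mulr_ge0// sqr_ge0.
    have [S [HS LS S2]] := gliding_sum T11 e0 (addr_ge0 l_ge0 K_ge0) linL uC big n.+1.
    have := LC S HS; rewrite Hk_norm1E// -EFinM lee_fin => LSC.
    have n0 : 0 <= n.+1%:R * e by rewrite mulr_ge0// ltW.
    have : (n.+1%:R * e) ^+ 2 <= (C * Num.sqrt (H1sq l S)) ^+ 2.
      rewrite ler_pXn2r ?nnegrE//; last by rewrite (le_trans _ LSC).
      by rewrite (le_trans LS)// (le_trans _ LSC)// ler_norm.
    rewrite !exprMn sqr_sqrtr ?H1sq_ge0// => h.
    have {}h := le_trans h (ler_wpM2l (sqr_ge0 C) S2).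
    have N0 : 0 < n.+1%:R :> R by rewrite ltr0n.
    by rewrite -(ler_pM2l N0) mulrA -expr2 (le_trans h)// mulrCA.
  have := key (Num.truncn (C ^+ 2 * (l + K + 1) / e ^+ 2)).+1.
  by rewrite leNgt -ltr_pdivrMr ?exprn_gt0// truncnS_gt.
exists T; split; first exact: num_real.
by move=> t Tt; rewrite sub0r normrN ltW// hT// ltW.
Qed.

End WeakConvergence.

(** * Fractional norms *)

Section DoubleIntegrals.
Variables (R : realType) (l : R).
Local Notation mu := (@lebesgue_measure R).
Local Notation D := (`]0, l[%classic : set R).
Local Notation RR := (measurableTypeR R * measurableTypeR R)%type.
Implicit Types (f g : R -> R) (h k : R -> R -> R) (x y z : R).
Local Hint Extern 0 (measurable _) => exact: measurable_D : core.

(** Measurability is known on D only, so joint measurability is stated through a measurable function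
    on the whole plane that agrees with [h] on the square. *)
Definition meas2 h := exists H : RR -> R,
  measurable_fun setT H /\ forall x y, D x -> D y -> h x y = H (x, y).

Lemma meas2_l f : measurable_fun D f -> meas2 (fun x _ => f x).
Proof.
move=> /(measurable_restrictT _ (measurable_D l)) mf; exists (fun p => (f \_ D) p.1); split.
  exact: (measurableT_comp mf measurable_fst).
by move=> x y Dx _; rewrite /patch mem_set.
Qed.

Lemma meas2_r f : measurable_fun D f -> meas2 (fun _ y => f y).
Proof.
move=> /(measurable_restrictT _ (measurable_D l)) mf; exists (fun p => (f \_ D) p.2); split.
  exact: (measurableT_comp mf measurable_snd).
by move=> x y _ Dy; rewrite /patch mem_set.
Qed.

Lemma meas2_B h k : meas2 h -> meas2 k -> meas2 (fun x y => h x y - k x y).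
Proof.
move=> [H [mH hH]] [K [mK kK]]; exists (fun p => H p - K p); split.
  exact: measurable_funB.
by move=> x y Dx Dy; rewrite hH// kK.
Qed.

Lemma meas2_M h k : meas2 h -> meas2 k -> meas2 (fun x y => h x y * k x y).
Proof.
move=> [H [mH hH]] [K [mK kK]]; exists (fun p => H p * K p); split.
  exact: measurable_funM.
by move=> x y Dx Dy; rewrite hH// kK.
Qed.

Lemma meas2_comp f h : measurable_fun setT f -> meas2 h -> meas2 (fun x y => f (h x y)).
Proof.
move=> mf [H [mH hH]]; exists (fun p => f (H p)); split; first exact: measurableT_comp.
by move=> x y Dx Dy; rewrite hH.
Qed.

Lemma meas2_section h x : meas2 h -> D x -> measurable_fun D (h x).
Proof.
move=> [H [mH hH]] Dx; apply: (@eq_measurable_fun _ _ _ _ _ (fun y => H (x, y))).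
  by move=> y /set_mem Dy; rewrite hH.
by apply: measurable_funTS; apply: measurableT_comp mH _; exact: pair1_measurable.
Qed.

Lemma meas2_tonelli h : meas2 h -> (forall x y, D x -> D y -> 0 <= h x y) ->
  measurable_fun D (fun x => \int[mu]_(y in D) (h x y)%:E)%E /\
  (\int[mu]_(x in D) \int[mu]_(y in D) (h x y)%:E = \int[mu]_(y in D) \int[mu]_(x in D) (h x y)%:E)%E.
Proof.
move=> [H [mH hH]] h0.
pose i (x : R) : R := \1_D x.
have mi : measurable_fun setT i by exact: measurable_indic.
have i0 x : 0 <= i x by rewrite /i indicE.
(* The absolute value and the indicators make a function that is nonnegative on the whole plane,
   equal to [h] on the square and zero elsewhere. *)
pose F (p : RR) := (`|H p| * (i p.1 * i p.2))%:E.
have mF : measurable_fun setT F.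
  apply/measurable_EFinP; apply: measurable_funM; first exact: measurableT_comp.
  by apply: measurable_funM; [exact: (measurableT_comp mi measurable_fst)|exact: (measurableT_comp mi measurable_snd)].
have F0 p : (0 <= F p)%E by rewrite lee_fin mulr_ge0// mulr_ge0.
have F1 x y : D x -> D y -> F (x, y) = (h x y)%:E.
  by move=> Dx Dy; rewrite /F /i !indicE !mem_set// !mulr1 -hH// ger0_norm// h0.
have F2 x y : ~ D x \/ ~ D y -> F (x, y) = 0%E.
  by move=> [Dx|Dy]; rewrite /F /i !indicE /= ?(memNset Dx) ?(memNset Dy) ?mul0r ?mulr0.
have E1 x : D x -> (\int[mu]_(y in D) (h x y)%:E = \int[mu]_y F (x, y))%E.
  move=> Dx; rewrite integral_mkcond; apply: eq_integral => y _; rewrite /patch.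
  by case: ifPn => [/set_mem|/negP yD]; [move=> ?; rewrite F1|rewrite F2//; right; move=> /mem_set].
have E2 y : D y -> (\int[mu]_(x in D) (h x y)%:E = \int[mu]_x F (x, y))%E.
  move=> Dy; rewrite integral_mkcond; apply: eq_integral => x _; rewrite /patch.
  by case: ifPn => [/set_mem|/negP xD]; [move=> ?; rewrite F1|rewrite F2//; left; move=> /mem_set].
split.
  apply: (@eq_measurable_fun _ _ _ _ _ (fubini_F mu F)).
    by move=> x /set_mem Dx; rewrite E1.
  by apply: measurable_funTS; exact: measurable_fun_fubini_tonelli_F.
rewrite integral_mkcond [RHS]integral_mkcond.
transitivity (\int[mu]_x \int[mu]_y F (x, y))%E.
  apply: eq_integral => x _; rewrite /patch; case: ifPn => [/set_mem /E1 //|/negP xD].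
  by rewrite integral0_eq// => y _; rewrite F2//; left; move=> /mem_set.
rewrite fubini_tonelli//.
apply: eq_integral => y _; rewrite /patch; case: ifPn => [/set_mem /E2 //|/negP yD].
by rewrite integral0_eq// => x _; rewrite F2//; right; move=> /mem_set.
Qed.

(** A uniform bound on the mass of the kernel bounds its action on nonnegative functions in L^1. It
    is applied once for each variable of the Slobodeckij integral. *)
Lemma kernel_tonelli (k p : R -> R) (B : R) : 0 <= B -> measurable_fun setT k -> (forall r, 0 <= k r) ->
  measurable_fun D p -> (forall z, D z -> 0 <= p z) ->
  (forall z, D z -> \int[mu]_(y in D) (k (y - z))%:E <= B%:E)%E ->
  measurable_fun D (fun y => \int[mu]_(z in D) (k (y - z) * p z)%:E)%E /\
  (\int[mu]_(y in D) \int[mu]_(z in D) (k (y - z) * p z)%:E <= B%:E * \int[mu]_(z in D) (p z)%:E)%E.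
Proof.
move=> B0 mk k0 mp p0 kB.
have mkz z : measurable_fun D (fun y => (k (y - z))%:E).
  apply/measurable_EFinP; apply: measurable_funTS; apply: measurableT_comp => //.
  exact: measurable_funB.
have m2 : meas2 (fun y z => k (y - z) * p z).
  apply: meas2_M; last exact: meas2_r.
  by apply: meas2_comp => //; apply: meas2_B; [exact: meas2_l|exact: meas2_r].
have [|m ->] := meas2_tonelli m2; first by move=> y z Dy Dz; rewrite mulr_ge0// p0.
split => //; have -> : (B%:E * \int[mu]_(z in D) (p z)%:E = \int[mu]_(z in D) (B%:E * (p z)%:E))%E.
  by rewrite ge0_integralZl//; exact/measurable_EFinP.
apply: ge0_le_integral => //.
- by move=> z Dz; apply: integral_ge0 => y Dy; rewrite lee_fin mulr_ge0// p0.
- have m2' : meas2 (fun z y => k (y - z) * p z).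
    apply: meas2_M; last exact: meas2_l.
    by apply: meas2_comp => //; apply: meas2_B; [exact: meas2_r|exact: meas2_l].
  by have [|] := meas2_tonelli m2' => // z y Dz Dy; rewrite mulr_ge0// p0.
- by apply/measurable_EFinP; exact: measurable_funM.
move=> z Dz; under eq_integral do rewrite mulrC EFinM.
have k0' y : D y -> (0 <= (k (y - z))%:E)%E by rewrite lee_fin.
rewrite (ge0_integralZl mu (measurable_D l) (mkz z) k0'); last by rewrite lee_fin p0.
by rewrite muleC lee_wpmul2r ?lee_fin ?p0// kB.
Qed.

End DoubleIntegrals.

(** * Singular kernels and the Slobodeckij integral *)

Section Slobodeckij.
Variables (R : realType) (l : R).
Hypothesis l_gt0 : 0 < l.
Let l_ge0 : 0 <= l := ltW l_gt0.
Local Notation mu := (@lebesgue_measure R).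
Local Notation D := (`]0, l[%classic : set R).
Local Notation intble := (intble l).
Local Notation Int := (Int l).
Local Notation ac := (ac l).
Implicit Types (f g h U G : R -> R) (a t x y z e c s r : R).
Local Hint Extern 0 (measurable _) => exact: measurable_D : core.

Lemma meas_norm_powR r : measurable_fun setT (fun t => `|t| `^ r).
Proof. by apply: (measurableT_comp (measurable_powR r)). Qed.

Lemma meas2_slobodeckij f r : measurable_fun D f ->
  meas2 l (fun x y => (f x - f y) ^+ 2 / (`|x - y| `^ r)).
Proof.
move=> mf; apply: meas2_M.
  have m2 : meas2 l (fun x y => f x - f y) by apply: meas2_B; [exact: meas2_l|exact: meas2_r].
  by apply: (meas2_comp (f := fun t => t ^+ 2)) m2; exact: measurable_funX.
have m2 : meas2 l (fun x y : R => x - y) by apply: meas2_B; [exact: meas2_l|exact: meas2_r].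
apply: (meas2_comp (f := fun t => (`|t| `^ r)^-1)) m2.
by under eq_fun do rewrite -powRN; exact: meas_norm_powR.
Qed.

Lemma slobodeckij_ge0 f x y r : 0 <= (f x - f y) ^+ 2 / (`|x - y| `^ r).
Proof. by rewrite divr_ge0 ?sqr_ge0 ?powR_ge0. Qed.

Lemma slobodeckij_ae f g s : measurable_fun D f -> measurable_fun D g -> aeq l f g ->
  slobodeckij l s f = slobodeckij l s g.
Proof.
move=> mf mg fg.
have [mf2 mg2] := (meas2_slobodeckij (1 + 2 * s) mf, meas2_slobodeckij (1 + 2 * s) mg).
have [|m1 _] := meas2_tonelli mf2; first by move=> *; exact: slobodeckij_ge0.
have [|m2 _] := meas2_tonelli mg2; first by move=> *; exact: slobodeckij_ge0.
apply: ae_eq_integral => //; apply: ae_impl (fg) => x + Dx => /(_ Dx) fgx.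
apply: ae_eq_integral => //.
- by apply/measurable_EFinP; exact: (meas2_section mf2).
- by apply/measurable_EFinP; exact: (meas2_section mg2).
by apply: ae_impl fg => y + Dy => /(_ Dy) ->; rewrite fgx.
Qed.

Lemma powRD_gt0 (t p r : R) : 0 < t -> t `^ (p + r) = t `^ p * t `^ r.
Proof. by move=> t0; rewrite powRD//; apply/implyP => _; rewrite gt_eqF. Qed.

Lemma powRN_le (p s t : R) : 0 <= p -> 0 < s -> s <= t -> t `^ (- p) <= s `^ (- p).
Proof.
move=> p0 s0 st; have t0 := lt_le_trans s0 st.
by rewrite !powRN lef_pV2 ?posrE ?powR_gt0//; apply: ge0_ler_powR; rewrite ?nnegrE// ltW.
Qed.

Lemma shift_continuous f c : continuous f -> continuous (fun y => f (y - c)).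
Proof.
move=> cf y; have cs : {for y, continuous (fun y : R => y - c)}.
  by apply: cvgB; [exact: cvg_id|exact: cvg_cst].
exact: (continuous_comp cs (cf _)).
Qed.

Section Kernel.
Variables (a e : R).
Hypotheses (a_gt0 : 0 < a) (a_lt1 : a < 1) (e_gt0 : 0 < e).
Let Q p r := (r ^+ 2 + e) `^ p.

Let base_gt0 r : 0 < r ^+ 2 + e.
Proof. by rewrite ltr_wpDl// sqr_ge0. Qed.

Let Q_derive p r : is_derive r 1 (Q p) (p * Q (p - 1) r * (2 * r)).
Proof.
have d1 : is_derive r 1 (fun r => r ^+ 2 + e) (2 * r).
  by apply: (isd_eq (isd_D (isd_X 2 (isd_id r)) (isd_cst e r))); rewrite addr0 mulr1 expr1 mulr_natl.
exact: (@isd_comp R (fun t => t `^ p) _ r _ _ (is_derive1_powR p (base_gt0 r)) d1).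
Qed.

Let Q_continuous p : continuous (Q p).
Proof. by move=> r; exact: is_derive_cont (Q_derive p r). Qed.

(** Modelled on r |r|^(-a) / (1 - a), the primitive of |r|^(-a). *)
Let P r := (1 - a)^-1 * (r * Q (- (a / 2)) r).
Let P' r := (1 - a)^-1 * (Q (- (a / 2)) r + r * (- (a / 2) * Q (- (a / 2) - 1) r * (2 * r))).

Let P_derive r : is_derive r 1 P (P' r).
Proof.
apply: isd_Z; apply: (isd_eq (isd_M (isd_id r) (Q_derive _ r))).
by rewrite mul1r addrC.
Qed.

Let P'_continuous : continuous P'.
Proof.
move=> r; apply: cvgM; first exact: cvg_cst.
apply: cvgD; first exact: Q_continuous.
apply: cvgM; first exact: cvg_id.
apply: cvgM; first by apply: cvgM; [exact: cvg_cst|exact: Q_continuous].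
by apply: cvgM; [exact: cvg_cst|exact: cvg_id].
Qed.

(* Q has no explicit primitive, but it is dominated by the derivative of P. *)
Let Q_le_P' r : Q (- (a / 2)) r <= P' r.
Proof.
have a1 : 0 < 1 - a by rewrite subr_gt0.
rewrite /P' ler_pdivlMl// mulrBl mul1r lerD2l.
have -> : Q (- (a / 2)) r = (r ^+ 2 + e) * Q (- (a / 2) - 1) r.
  rewrite /Q -{2}(powRr1 (ltW (base_gt0 r))) -(powRD_gt0 _ _ (base_gt0 r)).
  by congr (_ `^ _); ring.
have q0 : 0 <= Q (- (a / 2) - 1) r by exact: powR_ge0.
rewrite -subr_ge0 (_ : _ - _ = a * e * Q (- (a / 2) - 1) r); last by field.
by rewrite !mulr_ge0// ltW.
Qed.

(** Since |r| <= (r^2 + e)^(1/2), only the power (1 - a)/2 of r^2 + e remains. This exponent lies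
    between 0 and 1 and the base is at most l^2 + 1. *)
Let P_bound r : e <= 1 -> `|r| <= l -> `|P r| <= (1 - a)^-1 * (l ^+ 2 + 2).
Proof.
move=> e1 rl; have a1 : 0 < 1 - a by rewrite subr_gt0.
rewrite normrM gtr0_norm ?invr_gt0// ler_pM2l ?invr_gt0// normrM (ger0_norm (powR_ge0 _ _)).
have b0 := base_gt0 r.
have h1 : `|r| <= (r ^+ 2 + e) `^ 2^-1.
  rewrite powR12_sqrt; last exact: ltW.
  by rewrite -sqrtr_sqr ler_wsqrtr// lerDl ltW.
have h2 : `|r| * Q (- (a / 2)) r <= (r ^+ 2 + e) `^ ((1 - a) / 2).
  have -> : (1 - a) / 2 = 2^-1 + - (a / 2) by field.
  by rewrite (powRD_gt0 _ _ b0) ler_wpM2r// powR_ge0.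
apply: (le_trans h2).
have h3 : r ^+ 2 <= l ^+ 2 by rewrite -[r ^+ 2]real_normK ?num_real// lerXn2r ?nnegrE.
have [b1|b1] := leP 1 (r ^+ 2 + e).
  have q1 : (1 - a) / 2 <= 1.
    by rewrite ler_pdivrMr// mul1r (@le_trans _ _ 1)// ?ler1n// gerBl ltW.
  apply: (@le_trans _ _ ((r ^+ 2 + e) `^ 1)); first exact: (ler_powR b1 q1).
  by rewrite powRr1 ?ltW//; lra.
apply: (@le_trans _ _ (1 `^ ((1 - a) / 2))).
  have q0 : 0 <= (1 - a) / 2 by rewrite divr_ge0// ltW.
  by apply: (ge0_ler_powR q0); rewrite ?nnegrE ?ltW//.
by rewrite powR1; have := sqr_ge0 l; lra.
Qed.

Lemma regular_kernel_bound z : e <= 1 -> 0 <= z <= l ->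
  (\int[mu]_(y in D) (((y - z) ^+ 2 + e) `^ (- (a / 2)))%:E <= (2 * ((1 - a)^-1 * (l ^+ 2 + 2)))%:E)%E.
Proof.
move=> e1 /andP[z0 zl].
have cP : continuous (fun y => P' (y - z)) := @shift_continuous P' z P'_continuous.
have cQ : continuous (fun y => Q (- (a / 2)) (y - z)) := @shift_continuous (Q (- (a / 2))) z (@Q_continuous _).
have acP : ac (fun y => P (y - z)) (fun y => P' (y - z)).
  apply: ac_derive_cc => [|y yl|]; first exact: l_ge0.
    have ds : is_derive y 1 (fun y => y - z) 1.
      by apply: (isd_eq (isd_B (isd_id y) (isd_cst z y))); rewrite subr0.
    by apply: (isd_eq (@isd_comp R P (fun y => y - z) y _ _ (P_derive _) ds)); rewrite mulr1.
  exact: continuous_subspaceT.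
have iQ : intble (fun y => Q (- (a / 2)) (y - z)) by apply: cont_intble => //; exact: continuous_subspaceT.
rewrite (EFin_Int iQ) lee_fin (le_trans (le_Int iQ acP.1 _))//.
rewrite -(ac_endpoints l_ge0 acP) (le_trans (ler_norm _))// (le_trans (ler_normB _ _))//.
rewrite [leRHS]mulr_natl mulr2n lerD// P_bound// ler_norml; lra.
Qed.

End Kernel.

(** Monotone convergence of the regularised kernels, whose integrals are bounded independently of
    the regularisation. *)
Lemma kernel_bound a : 0 < a < 1 -> exists2 B : R, 0 <= B &
  forall z, D z -> (\int[mu]_(y in D) (`|y - z| `^ (- a))%:E <= B%:E)%E.
Proof.
move=> /andP[a0 a1]; exists (2 * ((1 - a)^-1 * (l ^+ 2 + 2))).
  by rewrite !mulr_ge0// ?invr_ge0 ?subr_ge0 ?(ltW a1)// addr_ge0// sqr_ge0.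
move=> z /itv_oo_cc zl.
(* At y = z the power 0^(-a) is 0 by convention, whereas the regularised kernels blow up there; the
   indicator removes this point. *)
pose i (y : R) : R := \1_(~` [set z]) y.
pose q (n : nat) y := i y * ((y - z) ^+ 2 + n.+1%:R^-1) `^ (- (a / 2)).
have n0 (n : nat) : 0 < n.+1%:R^-1 :> R by rewrite invr_gt0 ltr0n.
have b0 (n : nat) y : 0 < (y - z) ^+ 2 + n.+1%:R^-1 by rewrite ltr_wpDl// sqr_ge0.
have q0 n y : 0 <= q n y by rewrite mulr_ge0 ?powR_ge0// /i indicE.
have mpw (n : nat) : measurable_fun D (fun y => ((y - z) ^+ 2 + n.+1%:R^-1) `^ (- (a / 2))).
  apply: measurable_funTS; apply: (measurableT_comp (measurable_powR _)).
  apply: measurable_funD => //; apply: measurable_funX; exact: measurable_funB.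
have mpw' (n : nat) : measurable_fun D (fun y => (((y - z) ^+ 2 + n.+1%:R^-1) `^ (- (a / 2)))%:E).
  exact/measurable_EFinP.
have mq n : measurable_fun D (EFin \o q n).
  apply/measurable_EFinP; apply: measurable_funM => //.
  by apply: measurable_indic; apply: measurableC; exact: measurable_set1.
have homo y : D y -> {homo (fun n => (q n y)%:E) : n m / (n <= m)%N >-> (n <= m)%E}.
  move=> _ n m nm; have i0 : 0 <= i y by rewrite /i indicE.
  rewrite lee_fin ler_wpM2l//; apply: powRN_le => //; first by rewrite divr_ge0// ltW.
  by rewrite lerD2l lef_pV2 ?posrE ?ltr0n// ler_nat ltnS.
have E y : D y -> (limn (fun n => (q n y)%:E) = (`|y - z| `^ (- a))%:E)%E.
  move=> _; apply/cvg_lim => //; apply: cvg_EFin; first by near=> n.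
  have [->|yz] := eqVneq y z.
    rewrite subrr normr0 powR0 ?oppr_eq0 ?gt_eqF//.
    apply: cvg_near_cst; near=> n; rewrite /= /q /i indicE memNset ?mul0r//.
    by move=> /(_ erefl).
  have yz2 : 0 < (y - z) ^+ 2 by rewrite exprn_even_gt0//= subr_eq0.
  have -> : `|y - z| `^ (- a) = ((y - z) ^+ 2) `^ (- (a / 2)).
    rewrite -[in RHS]real_normK ?num_real// -powR_mulrn// -powRrM; congr (_ `^ _); by field.
  have H : ((y - z) ^+ 2 + n.+1%:R^-1) `^ (- (a / 2)) @[n --> \oo] --> ((y - z) ^+ 2) `^ (- (a / 2)).
    apply: (@continuous_cvg _ _ _ _ _ (fun n : nat => (y - z) ^+ 2 + n.+1%:R^-1) (fun t => t `^ (- (a / 2)))).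
      exact: is_derive_cont (is_derive1_powR _ yz2).
    rewrite -[X in _ --> X]addr0; apply: cvgD; first exact: cvg_cst.
    exact: cvg_harmonic.
  have qE : (fun n => q n y) = (fun n : nat => ((y - z) ^+ 2 + n.+1%:R^-1) `^ (- (a / 2))).
    by apply/funext => n; rewrite /q /i indicE mem_set ?mul1r//; exact/eqP.
  by rewrite -qE in H.
have qB n : (\int[mu]_(y in D) (q n y)%:E <= (2 * ((1 - a)^-1 * (l ^+ 2 + 2)))%:E)%E.
  apply: (@le_trans _ _ (\int[mu]_(y in D) (((y - z) ^+ 2 + n.+1%:R^-1) `^ (- (a / 2)))%:E)%E).
    apply: ge0_le_integral; [exact: measurable_D|by move=> y _; rewrite lee_fin|exact: mq|exact: mpw'|].
    move=> y _; rewrite /= lee_fin /q ler_piMl ?powR_ge0// /i indicE.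
    by case: (y \in _).
  by apply: (regular_kernel_bound a0 a1 (n0 n) _ zl); rewrite invf_le1 ?ltr0n// ler1n.
have cv := @cvg_monotone_convergence _ _ _ mu D (measurable_D l) (fun n => EFin \o q n) mq (fun n y _ => q0 n y) homo.
have EI : (\int[mu]_(y in D) (`|y - z| `^ (- a))%:E = \int[mu]_(y in D) limn (fun n => (EFin \o q n) y))%E.
  by apply: eq_integral => y /set_mem /E <-.
rewrite EI -(cvg_lim _ cv)//.
apply: lime_le; first by apply/cvg_ex; eexists; exact: cv.
apply: nearW => n; exact: qB.
Unshelve. all: by end_near. Qed.

Lemma slobodeckij_pointwise U G r x y : 0 <= r -> ac U G -> L2 l G -> D x -> D y ->
  (((U x - U y) ^+ 2 / `|x - y| `^ (1 + 2 * r))%:E <=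
  \int[mu]_(z in D) (`|y - z| `^ (- r) * (`|x - z| `^ (- r) * G z ^+ 2))%:E)%E.
Proof.
move=> r0 aU LG Dx Dy; have [xl yl] := (itv_oo_cc Dx, itv_oo_cc Dy).
(* The signed indicator of the interval between x and y, which treats both orders at once.
   Cauchy-Schwarz is applied to |w| and w G. *)
pose w z := chi x z - chi y z.
have wcase z : [\/ w z = 0, w z = 1 | w z = -1].
  by rewrite /w /chi; do ! case: (_ < _)%R; rewrite ?subrr ?subr0 ?sub0r; [exact: Or31|exact: Or32|exact: Or33|exact: Or31].
have w1 z : `|w z| <= 1 by have [] := wcase z => ->; rewrite ?normr0 ?normrN ?normr1.
have ww z : `|w z| * w z = w z by have [] := wcase z => ->; rewrite ?mulr0 ?normrN ?normr1 ?mul1r.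
have w2 z : w z ^+ 2 = `|w z| by have [] := wcase z => ->; rewrite ?normr0 ?sqrrN ?normrN ?normr1 ?expr0n ?expr1n.
have mw : measurable_fun D w by apply: measurable_funB; exact: measurable_chi.
have Lw : L2 l (fun z => `|w z|).
  by apply: (@L2_bound _ _ _ 1) => [|z _]; [exact: measurableT_comp|rewrite normr_id].
have LwG : L2 l (fun z => w z * G z) by exact: (@L2_mulbound _ _ _ _ 1).
have iG := L2_intble LG; have i1 := intble_cst l (1 : R).
have UE : U x - U y = Int (fun z => `|w z| * (w z * G z)).
  rewrite (acE aU xl) (acE aU yl) opprD addrACA subrr add0r -IntB; [|exact: intble_chi|exact: intble_chi].
  by apply: eq_Int => z _; rewrite mulrA ww mulrBl.
have acid : ac (fun y => y) (fun=> 1).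
  apply: ac_derive_cc; first exact: l_ge0.
  by apply: continuous_subspaceT => z; exact: cvg_cst.
have iw : intble w by apply: intble_bound mw _ => z _; exact: w1.
have Iw : Int w = x - y.
  rewrite (acE acid xl) (acE acid yl) opprD addrACA subrr add0r -IntB; [|exact: intble_chi|exact: intble_chi].
  by apply: eq_Int => z _; rewrite !mulr1.
have Iaw : Int (fun z => `|w z| ^+ 2) = `|x - y|.
  rewrite -Iw; have [xy|yx] := leP x y.
    have E z : `|w z| ^+ 2 = - 1 * w z.
      rewrite real_normK ?num_real// w2 mulN1r ler0_norm//.
      rewrite /w /chi subr_le0; case: ltP => // zx; rewrite (lt_le_trans zx xy)//.
    under eq_Int do rewrite E.
    rewrite IntZ//.
    by rewrite Iw mulN1r ler0_norm// subr_le0.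
  have E z : `|w z| ^+ 2 = w z.
    rewrite real_normK ?num_real// w2 ger0_norm//.
    by rewrite /w /chi subr_ge0; case: (ltP z y) => // zy; rewrite (lt_trans zy yx).
  under eq_Int do rewrite E.
  by rewrite Iw gtr0_norm// subr_gt0.
have LwG2 : intble (fun z => (w z * G z) ^+ 2) := L2_sqr LwG.
have CS := CauchySchwarz Lw LwG; rewrite -UE Iaw in CS.
have kk0 z : 0 <= `|y - z| `^ (- r) * (`|x - z| `^ (- r) * G z ^+ 2).
  by rewrite mulr_ge0 ?powR_ge0// mulr_ge0 ?powR_ge0// sqr_ge0.
have [xy|xy] := eqVneq x y.
  rewrite [in leLHS]xy subrr expr0n/= mul0r; apply: integral_ge0 => z _; rewrite lee_fin.
  exact: kk0.
have d0 : 0 < `|x - y| by rewrite normr_gt0 subr_eq0.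
pose c := `|x - y| `^ (- r) * `|x - y| `^ (- r).
have ic : intble (fun z => c * (w z * G z) ^+ 2) by exact: intbleZ.
apply: (@le_trans _ _ (Int (fun z => c * (w z * G z) ^+ 2))%:E).
  rewrite lee_fin IntZ// ler_pdivrMr ?powR_gt0//.
  rewrite (_ : 1 + 2 * r = 1 + (r + r)); last by ring.
  rewrite !(powRD_gt0 _ _ d0) powRr1// /c !powRN.
  rewrite (le_trans CS)// le_eqVlt; apply/orP; left; apply/eqP; field.
  by rewrite gt_eqF// powR_gt0.
rewrite -(EFin_Int ic); apply: ae_ge0_le_integral => //.
- by move=> z _; rewrite lee_fin mulr_ge0 ?sqr_ge0// /c mulr_ge0 ?powR_ge0.
- by apply/measurable_EFinP; exact: intble_meas ic.
- by move=> z _; rewrite lee_fin.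
- have mk v : measurable_fun D (fun z => `|v - z| `^ (- r)).
    apply: measurable_funTS; apply: (measurableT_comp (meas_norm_powR (- r))).
    exact: measurable_funB.
  apply/measurable_EFinP; apply: measurable_funM; [exact: mk|apply: measurable_funM; [exact: mk|]].
  by apply: measurable_funX; exact: L2_meas LG.
have ne (v : R) : {ae mu, forall z, z != v}.
  exists [set v]; split => //; first exact: lebesgue_measure_set1.
  by move=> z /= /negP; rewrite negbK => /eqP.
apply: ae_impl2 (ne x) (ne y) => z zx zy _; rewrite lee_fin exprMn w2 [leLHS]mulrA [leRHS]mulrA ler_wpM2r ?sqr_ge0//.
have [w0|w0] := eqVneq (w z) 0; first by rewrite w0 normr0 mulr0 mulr_ge0 ?powR_ge0.
apply: (@le_trans _ _ c); first by rewrite ler_piMr// /c mulr_ge0 ?powR_ge0.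
have [zx0 zy0] : 0 < `|x - z| /\ 0 < `|y - z| by rewrite !normr_gt0 !subr_eq0 eq_sym zx eq_sym zy.
have [xz yz] : `|x - z| <= `|x - y| /\ `|y - z| <= `|x - y|.
  move: w0; rewrite /w /chi; case: (ltP z x) => h1; case: (ltP z y) => h2; rewrite ?subrr ?eqxx// => _.
    have xy' : 0 <= x - y by lra.
    by rewrite (ger0_norm xy') (@ger0_norm _ (x - z)) ?(@ler0_norm _ (y - z)); lra.
  have xy' : x - y <= 0 by lra.
  by rewrite (ler0_norm xy') (@ler0_norm _ (x - z)) ?(@ger0_norm _ (y - z)); lra.
by rewrite /c ler_pM ?powR_ge0// powRN_le.
Qed.

Lemma slobodeckij_le s : 0 < s < 1 -> exists2 B : R, 0 <= B &
  forall U G (d eta : R), ac U G -> L2 l G -> 0 < eta -> (forall x, 0 <= x <= l -> `|U x| <= d) ->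
  (slobodeckij l s U <= ((2 * d) ^+ 2 / eta `^ (1 + 2 * s) * l ^+ 2 +
                        eta `^ (1 - s) * (B ^+ 2 * Int (fun x => G x ^+ 2)))%:E)%E.
Proof.
(* As r < 1, the kernel |x - z|^(-r) is integrable. As 1 + 2 r = 2 + s, replacing s by r in the
   integrand costs the factor |x - y|^(1 - s), which is small in the strip. *)
move=> /andP[s0 s1]; pose r := (1 + s) / 2; have r01 : 0 < r < 1 by rewrite /r; lra.
have [B B0 kB] := kernel_bound r01; exists B => // U G d eta aU LG eta0 Ud.
have r0 : 0 <= r by rewrite /r; lra.
pose k (v : R) := `|v| `^ (- r); have mk : measurable_fun setT k by exact: meas_norm_powR.
have k0 v : 0 <= k v by exact: powR_ge0.
have mU : measurable_fun D U := ac_meas l_ge0 aU.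
have mG2 : measurable_fun D (fun z => G z ^+ 2) by apply: measurable_funX; exact: L2_meas LG.
pose A := (2 * d) ^+ 2 / eta `^ (1 + 2 * s); pose c := eta `^ (1 - s).
have A0 : 0 <= A by rewrite divr_ge0 ?sqr_ge0 ?powR_ge0.
have c0 : 0 <= c by exact: powR_ge0.
have [A0' c0'] : (0 <= A%:E)%E /\ (0 <= c%:E)%E by rewrite !lee_fin.
pose h x y := (\int[mu]_(z in D) (k (y - z) * (k (x - z) * G z ^+ 2))%:E)%E.
pose m x := (\int[mu]_(z in D) (k (x - z) * G z ^+ 2)%:E)%E.
have h0 x y : (0 <= h x y)%E.
  by apply: integral_ge0 => z _; rewrite lee_fin mulr_ge0 ?k0// mulr_ge0 ?k0// sqr_ge0.
have m0 x : (0 <= m x)%E.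
  by apply: integral_ge0 => z _; rewrite lee_fin mulr_ge0 ?k0// sqr_ge0.
have mkG x : measurable_fun D (fun z => k (x - z) * G z ^+ 2).
  apply: measurable_funM => //; apply: measurable_funTS; apply: measurableT_comp => //.
  exact: measurable_funB.
have hT x : measurable_fun D (h x) /\ (\int[mu]_(y in D) h x y <= B%:E * m x)%E.
  have [|mh hB] := @kernel_tonelli R l k (fun z => k (x - z) * G z ^+ 2) B B0 mk k0 (mkG x) _ kB.
    by move=> z _; rewrite mulr_ge0 ?k0// sqr_ge0.
  by split.
have [|mm mB] := @kernel_tonelli R l k (fun z => G z ^+ 2) B B0 mk k0 mG2 _ kB.
  by move=> z _; exact: sqr_ge0.
rewrite -/m in mm mB.
have pt x y : D x -> D y -> (((U x - U y) ^+ 2 / `|x - y| `^ (1 + 2 * s))%:E <= A%:E + c%:E * h x y)%E.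
  move=> Dx Dy.
  have [d1|d1] := leP eta `|x - y|.
    apply: (@le_trans _ _ A%:E); last by rewrite leeDl// mule_ge0.
    rewrite lee_fin ler_pM ?sqr_ge0 ?invr_ge0 ?powR_ge0//.
      rewrite -real_normK ?num_real// lerXn2r ?nnegrE//; first by rewrite mulr_ge0// (le_trans _ (Ud _ (itv_oo_cc Dx))).
      rewrite (le_trans (ler_normB _ _))// mulr_natl mulr2n lerD// Ud// itv_oo_cc//.
    rewrite -!powRN powRN_le//; lra.
  apply: (@le_trans _ _ (c%:E * h x y)%E); last by rewrite leeDr// lee_fin.
  apply: (@le_trans _ _ (c * ((U x - U y) ^+ 2 / `|x - y| `^ (1 + 2 * r)))%:E); last first.
    by rewrite EFinM lee_wpmul2l ?lee_fin//; exact: slobodeckij_pointwise.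
  have [xy|xy] := eqVneq x y; first by rewrite xy subrr expr0n !mul0r mulr0.
  have d0 : 0 < `|x - y| by rewrite normr_gt0 subr_eq0.
  rewrite lee_fin mulrCA ler_wpM2l ?sqr_ge0// -!powRN.
  rewrite (_ : - (1 + 2 * s) = 1 - s + - (1 + 2 * r)); last by rewrite /r; field.
  rewrite (powRD_gt0 _ _ d0) ler_wpM2r ?powR_ge0//; apply: ge0_ler_powR; rewrite ?nnegrE ?ltW// subr_gt0//.
have inner x : D x -> (\int[mu]_(y in D) ((U x - U y) ^+ 2 / `|x - y| `^ (1 + 2 * s))%:E <=
    (A * l)%:E + (c * B)%:E * m x)%E.
  move=> Dx; have [mh hB] := hT x.
  have mch : measurable_fun D (fun y => c%:E * h x y)%E by exact: measurable_funeM.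
  have ch0 y : D y -> (0 <= c%:E * h x y)%E by move=> _; rewrite mule_ge0.
  apply: (@le_trans _ _ (\int[mu]_(y in D) (A%:E + c%:E * h x y))%E).
    apply: ge0_le_integral => //.
    - by move=> y _; rewrite lee_fin slobodeckij_ge0.
    - by apply/measurable_EFinP; exact: meas2_section (meas2_slobodeckij _ mU) Dx.
    - by apply: emeasurable_funD.
    - by move=> y Dy; exact: pt.
  rewrite ge0_integralD// (EFin_Int (intble_cst l A)) Int_cst// leeD2l// ge0_integralZl//.
  by rewrite [in leRHS]EFinM -muleA lee_wpmul2l.
have ms := meas2_slobodeckij (1 + 2 * s) mU.
have [|mI _] := meas2_tonelli ms; first by move=> *; exact: slobodeckij_ge0.
have cB0 : 0 <= c * B by rewrite mulr_ge0.
have Al0 : 0 <= A * l by rewrite mulr_ge0.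
have [cB0' Al0'] : (0 <= (c * B)%:E)%E /\ (0 <= (A * l)%:E)%E by rewrite !lee_fin.
have mcm : measurable_fun D (fun x => (c * B)%:E * m x)%E by exact: measurable_funeM.
apply: (@le_trans _ _ (\int[mu]_(x in D) ((A * l)%:E + (c * B)%:E * m x))%E).
  apply: ge0_le_integral => //.
  - by move=> x _; apply: integral_ge0 => y _; rewrite lee_fin slobodeckij_ge0.
  - by apply: emeasurable_funD.
rewrite ge0_integralD//; last by move=> x _; rewrite mule_ge0.
rewrite (EFin_Int (intble_cst l (A * l))) Int_cst// ge0_integralZl//.
rewrite (EFin_Int (L2_sqr LG)) in mB.
rewrite EFinD leeD//; first by rewrite lee_fin -mulrA -expr2.
rewrite (le_trans (lee_wpmul2l _ mB))// -!EFinM lee_fin.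
rewrite le_eqVlt; apply/orP; left; apply/eqP; rewrite /c; ring.
Qed.

End Slobodeckij.

(** * Decay of the norms of order below 1 *)

Section SobolevDecay.
Variables (R : realType) (l : R) (u : R -> R -> R).
Hypothesis l_gt0 : 0 < l.
Let l_ge0 : 0 <= l := ltW l_gt0.
Local Notation mu := (@lebesgue_measure R).
Local Notation D := (`]0, l[%classic : set R).
Local Notation Int := (Int l).
Implicit Types (f g : R -> R) (t x e s : R).
Hypothesis u_H1 : forall t, 0 <= t -> Hk l 1 (u t).
Hypothesis U_cvg : forall e, 0 < e -> exists2 T : R, 1 <= T &
    forall t x, T <= t -> 0 <= x <= l -> `|cont_rep l (u t) x| <= e.
Variable K : R.
Hypothesis K_ge0 : 0 <= K.
Hypothesis G_bnd : forall t, 1 <= t -> Int (fun x => wderiv l (u t) x ^+ 2) <= K.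
Local Notation U t := (cont_rep l (u t)).
Local Hint Extern 0 (measurable _) => exact: measurable_D : core.

Lemma sqr_Int_rep t : 0 <= t -> Int (fun x => u t x ^+ 2) = Int (fun x => U t x ^+ 2).
Proof.
move=> t0; have [aUt eU] := H1_rep l_gt0 (u_H1 t0); have [Lu _ _] := Hk1P l_gt0 (u_H1 t0).
have LU := ac_L2 l_ge0 aUt.
apply: eq_Int_ae; [exact: intble_meas (L2_sqr Lu)|exact: intble_meas (L2_sqr LU)|].
by apply: ae_impl eU => x + xD => /(_ xD) ->.
Qed.

Lemma L2_decay e : 0 < e -> exists2 T : R, 1 <= T & forall t, T <= t -> Int (fun x => u t x ^+ 2) <= e.
Proof.
move=> e0; have l1 : 0 < l + 1 by rewrite ltr_wpDr.
have d0 : 0 < Num.sqrt (e / (l + 1)) by rewrite sqrtr_gt0 divr_gt0.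
have [T T1 hT] := U_cvg d0; exists T => // t Tt; have t0 : 0 <= t by rewrite (le_trans ler01)// (le_trans T1).
have [aUt eU] := H1_rep l_gt0 (u_H1 t0).
rewrite sqr_Int_rep//; apply: (@le_trans _ _ (e / (l + 1) * l)); last first.
  by rewrite mulrAC ler_pdivrMr// ler_pM2l// lerDl.
rewrite -(Int_cst _ l_ge0); apply: le_Int => [||x /itv_oo_cc xl].
- exact: L2_sqr (ac_L2 l_ge0 aUt).
- exact: intble_cst.
rewrite -[leRHS]sqr_sqrtr; last by rewrite ltW// divr_gt0.
by rewrite -[X in X <= _]real_normK ?num_real// lerXn2r ?nnegrE ?sqrtr_ge0// hT.
Qed.

Lemma slobodeckij_decay s e : 0 < s < 1 -> 0 < e ->
  exists2 T : R, 1 <= T & forall t, T <= t -> (slobodeckij l s (u t) <= e%:E)%E.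
Proof.
move=> s01 e0; have [B B0 hB] := slobodeckij_le l_gt0 s01.
have s1 : 0 < 1 - s by move: s01 => /andP[_]; rewrite subr_gt0.
have BK : 0 < 2 * (B ^+ 2 * K + 1) by rewrite mulr_gt0// ltr_wpDl// mulr_ge0// sqr_ge0.
(* The width [eta] comes first: the bound [K] alone makes the strip cost at most e/2. The uniform
   bound [d] on U is then chosen in terms of [eta] so that the rest costs e/2. *)
pose c := e / (2 * (B ^+ 2 * K + 1)); have c0 : 0 < c by rewrite divr_gt0.
pose eta := c `^ (1 - s)^-1; have eta0 : 0 < eta by rewrite powR_gt0.
have etac : eta `^ (1 - s) = c by rewrite /eta -powRrM mulVf ?gt_eqF// powRr1// ltW.
pose p := eta `^ (1 + 2 * s); have p0 : 0 < p by rewrite powR_gt0.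
have l2 : 0 < l ^+ 2 by rewrite exprn_gt0.
pose d := Num.sqrt (e * p / (8 * l ^+ 2)).
have q0 : 0 < e * p / (8 * l ^+ 2) by rewrite divr_gt0 ?mulr_gt0.
have d0 : 0 < d by rewrite sqrtr_gt0.
have [T T1 hT] := U_cvg d0; exists T => // t Tt; have t1 := le_trans T1 Tt.
have Hu := u_H1 (le_trans ler01 t1).
have [aUt eU] := H1_rep l_gt0 Hu; have [Lu LG _] := Hk1P l_gt0 Hu.
rewrite -(slobodeckij_ae s (ac_meas l_ge0 aUt) (L2_meas Lu) eU).
rewrite (le_trans (hB _ _ d eta aUt LG eta0 _))//; first by move=> x xl; exact: hT.
rewrite lee_fin -/p etac exprMn sqr_sqrtr; last exact: ltW.
have -> : 2 ^+ 2 * (e * p / (8 * l ^+ 2)) / p * l ^+ 2 = e / 2.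
  by field; rewrite !gt_eqF.
rewrite [leRHS]splitr lerD2l.
rewrite (@le_trans _ _ (c * (B ^+ 2 * K + 1)))//.
  rewrite ler_wpM2l ?(ltW c0)// (@le_trans _ _ (B ^+ 2 * K)) ?lerDl//.
  by rewrite ler_wpM2l ?sqr_ge0// G_bnd.
rewrite /c le_eqVlt; apply/orP; left; apply/eqP; field.
by rewrite gt_eqF// ltr_wpDl// mulr_ge0// sqr_ge0.
Qed.

Lemma Hr_norm_decay s e : 0 <= s < 1 -> 0 < e ->
  exists2 T : R, 1 <= T & forall t, T <= t -> (Hr_norm l s (u t) <= e%:E)%E.
Proof.
move=> /andP[s0 s1] e0; have e2 : 0 < e ^+ 2 / 2 by rewrite divr_gt0// exprn_gt0.
have tr0 : Num.truncn s = 0%N by apply/truncn0Pn; rewrite -ltNge.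
have [T1 T11 h1] := L2_decay e2.
have [T2 T21 h2] : exists2 T : R, 1 <= T & forall t, T <= t ->
    ((if s == 0%R then 0 else slobodeckij l s (u t)) <= (e ^+ 2 / 2)%:E)%E.
  have [_|sn0] := eqVneq s 0; first by exists 1 => // t _; rewrite lee_fin ltW.
  by apply: slobodeckij_decay => //; rewrite s1 andbT lt_neqAle eq_sym sn0.
exists (Num.max T1 T2) => [|t]; first by rewrite le_max T11.
rewrite ge_max => /andP[t1 t2].
have [Lu _ _] := Hk1P l_gt0 (u_H1 (le_trans ler01 (le_trans T11 t1))).
rewrite /Hr_norm tr0 subr0 /= /Hk_normsq big_ord1/= (EFin_Int (L2_sqr Lu)).
set X := (_ + _)%E; have X0 : (0 <= X)%E.
  rewrite /X adde_ge0 ?lee_fin ?Int_ge0//; first by move=> x _; exact: sqr_ge0.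
  case: ifP => // _; apply: integral_ge0 => x _; apply: integral_ge0 => y _.
  by rewrite lee_fin slobodeckij_ge0.
have Xe : (X <= (e ^+ 2)%:E)%E.
  by rewrite (splitr (e ^+ 2)) EFinD leeD// ?lee_fin ?h1 ?h2.
have -> : e%:E = ((e ^+ 2)%:E `^ 2^-1)%E.
  by rewrite poweR_EFin powR12_sqrt ?sqr_ge0// sqrtr_sqr gtr0_norm.
by apply: gt0_ler_poweR; rewrite ?in_itv/= ?leey ?andbT ?lee_fin ?sqr_ge0 ?invr_ge0.
Qed.

(** [xget] may return any function that vanishes almost everywhere, so the iterates are zero in that
    sense only. *)
Lemma iter_wderiv_cst0 j : L2 l (iter j (wderiv l) (cst 0)) /\ aeq l (iter j (wderiv l) (cst 0)) (cst 0).
Proof.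
elim: j => [|j [Lj ej]]; first by split; [exact: (L2_cst l 0)|exact: aeW].
have L0 : L2 l (fun=> 0) by exact: (L2_cst l 0).
have w0 : is_wderiv l (fun=> 0 : R) (fun=> 0).
  by apply: (ac_is_wderiv l_ge0 (ac_cst l 0) (L2_intble L0)); exact: aeW.
have wj := is_wderiv_ae (L2_intble L0) (L2_intble Lj) (aeq_sym ej) w0.
by have [? _ ?] := wderivP l_gt0 L0 wj.
Qed.

Lemma Hr_norm_cst0 s : Hr_norm l s (cst 0) = 0%E.
Proof.
have I0 j : (\int[mu]_(x in D) ((iter j (wderiv l) (cst 0) x) ^+ 2)%:E = 0)%E.
  have [Lj ej] := iter_wderiv_cst0 j.
  rewrite (EFin_Int (L2_sqr Lj)) (_ : Int _ = 0)//.
  rewrite -[RHS](Int0 l); apply: eq_Int_ae; [exact: intble_meas (L2_sqr Lj)|exact: measurable_cst|].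
  by apply: ae_impl ej => x + xD => /(_ xD) ->; rewrite expr0n.
have S0 r j : slobodeckij l r (iter j (wderiv l) (cst 0)) = 0%E.
  have [Lj ej] := iter_wderiv_cst0 j.
  have mc : measurable_fun D (cst 0 : R -> R) by exact: measurable_cst.
  rewrite (slobodeckij_ae r (L2_meas Lj) mc ej).
  apply: integral0_eq => x _; apply: integral0_eq => y _.
  by rewrite /= subrr expr0n/= mul0r.
rewrite /Hr_norm /Hk_normsq big1; last by move=> j _; exact: I0.
rewrite add0e S0; case: ifP => _; by rewrite poweR_EFin powR0// invr_neq0.
Qed.

Lemma test_function0 : test_function l (cst 0 : R -> R).
Proof.
split; last by exists (l / 3), (l / 2); split => //; [rewrite divr_gt0|rewrite ltr_pdivrMr// mulr_natr mulr2n ltrDl].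
have E n : derive1n n (cst 0 : R -> R) = cst 0.
  elim: n => // n IH; rewrite derive1nS IH; apply/funext => x.
  exact: derive1_cst.
by move=> n x; rewrite E; exact: derivable_cst.
Qed.

Lemma Hs_norm_decay s e : s < 1 -> 0 < e ->
  exists2 T : R, 1 <= T & forall t, T <= t -> (0 <= Hs_norm l s (u t) <= e%:E)%E.
Proof.
move=> s1 e0; rewrite /Hs_norm; case: leP => s0.
  have s01 : 0 <= s < 1 by rewrite s0.
  have [T T1 hT] := Hr_norm_decay s01 e0.
  by exists T => // t Tt; rewrite hT// andbT poweR_ge0.
(* For negative s the L^2 norm suffices: the norm of order -s dominates the L^2 norm of a test
   function, so the dual norm is at most the L^2 norm of u(t). *)
have [T T1 hT] := L2_decay (exprn_gt0 2 e0); exists T => // t Tt.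
have [Lu _ _] := Hk1P l_gt0 (u_H1 (le_trans ler01 (le_trans T1 Tt))).
apply/andP; split.
  (* The zero test function is admissible and keeps the supremum nonnegative; over an empty set it
     would be -oo. *)
  apply: le_ereal_sup_tmp; exists 0%E => //; exists (cst 0 : R -> R).
    by split; [exact: test_function0|rewrite Hr_norm_cst0].
  have -> : \int[mu]_(x in D) (u t x * (cst 0 : R -> R) x) = 0.
    by rewrite -[RHS](Int0 l); apply: eq_Int => x _; rewrite mulr0.
  by rewrite normr0.
apply: ge_ereal_sup => _ [phi [tphi phi1] <-].
rewrite lee_fin.
have Lphi : L2 l phi := ac_L2 l_ge0 (test_ac l_ge0 tphi).
have phi2 : Int (fun x => phi x ^+ 2) <= 1.
  move: phi1; rewrite /Hr_norm /Hk_normsq big_ord_recl /= (EFin_Int (L2_sqr Lphi)).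
  set Y := (\sum_(_ < _) _)%E; set Z := (if _ then _ else _).
  have Y0 : (0 <= Y)%E by apply: sume_ge0 => j _; apply: integral_ge0 => x _; rewrite lee_fin sqr_ge0.
  have Z0 : (0 <= Z)%E.
    rewrite /Z; case: ifP => // _; apply: integral_ge0 => x _; apply: integral_ge0 => y _.
    by rewrite lee_fin slobodeckij_ge0.
  set X := (_ + _)%E => X1.
  have IX : ((Int (fun x => phi x ^+ 2))%:E <= X)%E by rewrite /X -addeA leeDl// adde_ge0.
  have I0 : 0 <= Int (fun x => phi x ^+ 2) by apply: Int_ge0 => x _; exact: sqr_ge0.
  have X2 : ((Int (fun x => phi x ^+ 2))%:E `^ 2^-1 <= 1)%E.
    apply: le_trans X1; apply: gt0_ler_poweR; rewrite ?in_itv/= ?leey ?andbT ?lee_fin ?invr_ge0//.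
    exact: le_trans IX.
  move: X2; rewrite poweR_EFin lee_fin powR12_sqrt// => X2.
  by rewrite -(sqr_sqrtr I0) expr_le1 ?sqrtr_ge0.
apply: norm_le_sqr; first exact: ltW.
rewrite (le_trans (CauchySchwarz Lu Lphi))// -[leRHS]mulr1 ler_pM ?hT//; by apply: Int_ge0 => x _; exact: sqr_ge0.
Qed.

End SobolevDecay.

Theorem corollary5p1 (R : realType) (l mu0 mul : R) (u0 : R -> R)
    (u : R -> R -> R) (l_gt0 : 0 < l)
    (mu0_gt : 2^-1 < mu0) (mul_lt : mul < 2^-1)
    (u0_H1 : Hk l 1 u0) (u_sol : bbm_solution l mu0 mul u0 u) :
  H1_weak_cvg l u (cst 0) /\
  (forall s : R, s < 1 -> Hs_norm l s (u t) @[t --> +oo] --> 0%E).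
Proof.
have [U_cvg [K K_ge0 G_bnd]] := bbm_decay l_gt0 mu0_gt mul_lt u_sol.
have u_H1 : forall t, 0 <= t -> Hk l 1 (u t) by case: u_sol => [[]].
split; first exact: (weak_cvg0 l_gt0 u_H1 U_cvg K_ge0 G_bnd).
move=> s s1; have dec := Hs_norm_decay l_gt0 u_H1 U_cvg K_ge0 G_bnd s1.
apply/fine_cvgP; split.
  have [T T1 hT] := dec 1 ltr01; near=> t.
  have /andP[h0 h1] : (0 <= Hs_norm l s (u t) <= 1%:E)%E.
    by apply: hT; near: t; apply: nbhs_pinfty_ge; exact: num_real.
  by rewrite ge0_fin_numE// (le_lt_trans h1)// ltry.
apply/cvgrPdist_le => e e0; have [T T1 hT] := dec e e0; near=> t.
have /andP[h0 h1] : (0 <= Hs_norm l s (u t) <= e%:E)%E.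
  by apply: hT; near: t; apply: nbhs_pinfty_ge; exact: num_real.
rewrite sub0r normrN /= ger0_norm ?fine_ge0//.
by rewrite -lee_fin fineK// ge0_fin_numE// (le_lt_trans h1)// ltry.
Unshelve. all: by end_near. Qed.
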